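(* Let $\mathcal{V}=M_\Theta\mathcal{H}_0$ be a subspace of $\mathcal{H}_0=L^2([0,+\infty))$ invariant under the semigroup of right shifts, where $\Theta$ is an inner function, and let $R=(R_t)_{t\in\mathbb{R}}$ be a unitary $C_0$-group in the Hilbert space $\mathcal{H}_0\ominus\mathcal{V}$. Define a family of unitary operators in $\mathcal{H}_0$ by $$W_{-t}=\bigl(R_tP_{\mathcal{H}_0\ominus\mathcal{V}}S_t+P_{\mathcal{V}}\bigr)P_{[t,+\infty)}+M_\Theta P_{[0,t]},\qquad t\ge0,$$ and let $W_{-t}$ act identically on $\mathcal{H}\ominus\mathcal{H}_0$; the family is extended to positive times by $W_t=S_tW_{-t}^*S_{-t}$, $t\ge0$. Then $W=(W_t)_{t\in\mathbb{R}}$ is a multiplicative markovian cocycle such that $\lim_{t\to+\infty}W_{-t}f=M_\Theta f$ for $f\in\mathcal{H}_0$ and $\lim_{t\to+\infty}W_{-t}f=f$ for $f\in\mathcal{H}\ominus\mathcal{H}_0$. The unitary part of the semigroup $V$ associated with the markovian cocycle perturbation by $W$ is $R$.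
   Context: $\mathcal{H}=L^2(\mathbb{R})$ and $S=(S_t)_{t\in\mathbb{R}}$ is the unitary group $(S_tf)(x)=f(x+t)$. For $t\in\mathbb{R}$, $\mathcal{H}_t\subset\mathcal{H}$ is the subspace of functions supported in $[-t,+\infty)$; thus $\mathcal{H}_t=S_t\mathcal{H}_0$. The semigroup of right shifts in $\mathcal{H}_0$ is $S_{-t}|_{\mathcal{H}_0}$, $t\ge0$. For an inner function $\Theta$, $M_\Theta$ denotes the isometric operator on $\mathcal{H}_0$ which under the Fourier transform becomes the operator of multiplication by $\Theta$; subspaces of $\mathcal{H}_0$ invariant under the right shifts have the form $M_\Theta\mathcal{H}_0$. $P_{\mathcal{L}}$ is the orthogonal projection onto a subspace $\mathcal{L}$; $P_{[0,t]}$ and $P_{[t,+\infty)}$ are the orthogonal projections onto $\mathcal{H}_0\ominus\mathcal{H}_{-t}$ and $\mathcal{H}_{-t}$ respectively, $t\ge0$. A multiplicative $1$-$S$-cocycle is a strongly continuous family $W=(W_t)_{t\in\mathbb{R}}$ of unitary operators in $\mathcal{H}$ with $W_{t+s}=W_tS_tW_sS_{-t}$ for all $s,t\in\mathbb{R}$ and $W_0=I$. It is called markovian if $W_t|_{\mathcal{H}\ominus\mathcal{H}_t}=I$ for all $t\ge0$; equivalently, $W_{-t}|_{\mathcal{H}\ominus\mathcal{H}_0}=I$ for all $t\ge0$. The cocycle perturbation of $S$ by $W$ is the unitary group $U_t=W_tS_t$, $t\in\mathbb{R}$. For markovian $W$ the operators $V_t=U_{-t}|_{\mathcal{H}_0}=W_{-t}S_{-t}|_{\mathcal{H}_0}$,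 $t\ge0$, form a $C_0$-semigroup of isometries $V$ in $\mathcal{H}_0$, called the semigroup associated with the markovian cocycle perturbation. Its Wold decomposition is $\mathcal{H}_0=\mathcal{H}^{(0)}\oplus\mathcal{H}^{(1)}$ with both subspaces reducing $V$, $V|_{\mathcal{H}^{(0)}}$ consisting of unitary operators and $V|_{\mathcal{H}^{(1)}}$ completely nonunitary (isomorphic to the semiflow of right shifts in $\mathcal{K}\otimes L^2(\mathbb{R}_+)$ for a Hilbert space $\mathcal{K}$); $V|_{\mathcal{H}^{(0)}}$ is called the unitary part of $V$. That it is $R$ means $\mathcal{H}^{(0)}=\mathcal{H}_0\ominus\mathcal{V}$ and $V_t|_{\mathcal{H}^{(0)}}=R_t$ for $t\ge0$.
   Formalization: In the formula for W_{-t} the term P_V is replaced by the projection onto S_{-t}V; with P_V as printed W_{-t} is not unitary (e.g. Θ=e^{iz}, t=1, f=1_{[1,2]} gives squared norm 2 instead of 1). *)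

(* Defs.v *)
From HB Require Import structures.
From mathcomp Require Import all_boot all_order all_algebra.
From mathcomp Require Import generic_quotient ring_quotient.
From mathcomp Require Import all_classical all_reals all_analysis.
From mathcomp Require Import complex.

Set Implicit Arguments.
Unset Strict Implicit.
Unset Printing Implicit Defensive.

Import Order.TTheory GRing.Theory Num.Theory numFieldNormedType.Exports.

Local Open Scope classical_set_scope.
Local Open Scope ring_scope.
Local Open Scope complex_scope.
Local Open Scope quotient_scope.

Section L2fun.
Variable R : realType.
Local Notation mu := (@lebesgue_measure R).

Definition l2fun : {pred R -> R[i]} := fun f =>
  ((fun x => complex.Re (f x)) \in Lfun mu 2%:E) &&
  ((fun x => complex.Im (f x)) \in Lfun mu 2%:E).

Let lin (a b : R) (f g : R -> R) : f \in Lfun mu 2%:E -> g \in Lfun mu 2%:E ->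
  (fun x => a * f x + b * g x) \in Lfun mu 2%:E.
Proof.
have [L0 LZ] := Lfun_submod_closed mu (lee1n 2 : (1 <= 2%:E :> \bar R)%E).
move=> fL gL.
have gL' : b *: g \in Lfun mu 2%:E by rewrite -[b *: g]addr0; exact: LZ.
exact: LZ.
Qed.

Lemma l2fun_submod_closed : submod_closed l2fun.
Proof.
split.
  have [L0 _] := Lfun_submod_closed mu (lee1n 2 : (1 <= 2%:E :> \bar R)%E).
  by apply/andP; split.
move=> [a b] f g /andP[fr fi] /andP[gr gi]; apply/andP; split.
- have h := lin 1 1 (lin a (- b) fr fi) gr.
  rewrite (_ : (fun _ => _) =
    (fun x => 1 * (a * complex.Re (f x) + - b * complex.Im (f x)) + 1 * complex.Re (g x))) //.
  apply/funext => x /=; rewrite !fctE /=.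
  by case: (f x) (g x) => [u v] [w z] /=; rewrite !mul1r mulNr.
- have h := lin 1 1 (lin a b fi fr) gi.
  rewrite (_ : (fun _ => _) =
    (fun x => 1 * (a * complex.Im (f x) + b * complex.Re (f x)) + 1 * complex.Im (g x))) //.
  apply/funext => x /=; rewrite !fctE /=.
  by case: (f x) (g x) => [u v] [w z] /=; rewrite !mul1r.
Qed.

HB.instance Definition _ :=
  GRing.isSubmodClosed.Build R[i] (R -> R[i]) l2fun l2fun_submod_closed.

End L2fun.

Record L2fun (R : realType) := MkL2fun {
  L2fun_val :> R -> R[i] ;
  L2fun_valP : L2fun_val \in @l2fun R }.

HB.instance Definition _ (R : realType) := [isSub for @L2fun_val R].
HB.instance Definition _ (R : realType) := [Choice of L2fun R by <:].
HB.instance Definition _ (R : realType) := [SubChoice_isSubLmodule of L2fun R by <:].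

Section L2null.
Variable R : realType.
Local Notation mu := (@lebesgue_measure R).

Definition l2null : {pred L2fun R} :=
  fun f => `[< \forall x \ae mu, f x = 0 >].

Lemma l2null_submod_closed : submod_closed l2null.
Proof.
split; first by apply/asboolP; exact: aeW.
move=> a f g /asboolP f0 /asboolP g0; apply/asboolP.
by apply: (@filterS2 _ _ (ae_filter_ringOfSetsType mu)) f0 g0 => x /= fx gx; rewrite !fctE fx gx scaler0 addr0.
Qed.

HB.instance Definition _ :=
  GRing.isSubmodClosed.Build R[i] (L2fun R) l2null l2null_submod_closed.

End L2null.

Definition L2 (R : realType) : Type := Quotient.quot (@l2null R).

Section L2lmod.
Variable R : realType.

HB.instance Definition _ := Choice.on (L2 R).
HB.instance Definition _ := GRing.Zmodule.on (L2 R).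
HB.instance Definition _ := EqQuotient.on (L2 R).

Definition L2scale (a : R[i]) : L2 R -> L2 R :=
  lift_op1 (L2 R) (fun f : L2fun R => a *: f).

Lemma pi_L2scale a : {morph \pi_(L2 R) : f / a *: f >-> L2scale a f}.
Proof.
move=> f; unlock L2scale; apply/eqP; rewrite -Quotient.idealrBE.
rewrite -scalerBr; apply: rpredZ.
by rewrite Quotient.idealrBE reprK.
Qed.

Lemma L2scaleA a b f : L2scale a (L2scale b f) = L2scale (a * b) f.
Proof. by rewrite -[f]reprK -!pi_L2scale scalerA. Qed.

Lemma L2scale1 : left_id 1 L2scale.
Proof. by move=> f; rewrite -[f]reprK -pi_L2scale scale1r. Qed.

Lemma L2scaleDr : right_distributive L2scale +%R.
Proof.
move=> a f g; rewrite -[f]reprK -[g]reprK.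
by rewrite -raddfD -!pi_L2scale -raddfD scalerDr.
Qed.

Lemma L2scaleDl f : {morph L2scale^~ f : a b / a + b}.
Proof.
by move=> a b; rewrite -[f]reprK -!pi_L2scale -raddfD scalerDl.
Qed.

HB.instance Definition _ :=
  GRing.Zmodule_isLmodule.Build R[i] (L2 R) L2scaleA L2scale1 L2scaleDr L2scaleDl.

End L2lmod.
Section Hilbert.
Variable R : realType.
Local Notation mu := (@lebesgue_measure R).
Local Notation H := (L2 R).
Implicit Types (f g h : H) (K L : set H) (T : H -> H).

Definition L2_repr f : R -> R[i] := (repr f : L2fun R).
Coercion L2_repr : L2 >-> Funclass.

(* The class of a square-integrable function, and the junk value 0 for any
   other function. *)
Definition toL2 (u : R -> R[i]) : H := \pi_H (insubd (0 : L2fun R) u).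

Definition cintegral (D : set R) (u : R -> R[i]) : R[i] :=
  (\int[mu]_(x in D) complex.Re (u x)) +i* (\int[mu]_(x in D) complex.Im (u x)).

Definition dot f g : R[i] := cintegral setT (fun x => f x * conjc (g x)).

Definition l2norm f : R := Num.sqrt (complex.Re (dot f f)).

Definition linear_subspace L :=
  L 0 /\ forall (a : R[i]) f g, L f -> L g -> L (a *: f + g).

Definition closed_subspace L := linear_subspace L /\
  forall (u : nat -> H) f, (forall n, L (u n)) ->
    l2norm (u n - f) @[n --> \oo] --> (0 : R) -> L f.

Definition orth L : set H := [set f | forall g, L g -> dot f g = 0].

Definition ominus K L : set H := K `&` orth L.

(* Orthogonal projection: the unique g in L with f - g orthogonal to L, which
   exists as soon as L is a closed subspace. *)
Definition orth_proj L f : H := xget 0 [set g | L g /\ orth L (f - g)].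

(* The adjoint: the vector g exists and is unique whenever T is bounded. *)
Definition adj T f : H := xget 0 [set g | forall h, dot (T h) f = dot h g].

Definition isometry_on K T :=
  [/\ forall f, K f -> K (T f),
      forall (a : R[i]) f g, K f -> K g -> T (a *: f + g) = a *: T f + T g
    & forall f g, K f -> K g -> dot (T f) (T g) = dot f g].

Definition unitary_on K T :=
  isometry_on K T /\ forall g, K g -> exists2 f, K f & T f = g.

Definition strongly_continuous_on K (U : R -> H -> H) :=
  forall f, K f -> forall s : R, l2norm (U t f - U s f) @[t --> s] --> (0 : R).

Definition unitary_C0_group_on K (U : R -> H -> H) :=
  [/\ forall t, unitary_on K (U t),
      forall f, K f -> U 0 f = f,
      forall s t f, K f -> U (s + t) f = U s (U t f)
    & strongly_continuous_on K U].

Definition L2shift (t : R) f : H := toL2 (fun x => f (x + t)).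

Definition Hsupp (t : R) : set H :=
  [set f | \forall x \ae mu, x < - t -> f x = 0].

(* Fourier transform with kernel e^{i lambda x} / sqrt (2 pi), so that it maps
   Hsupp 0 onto the boundary values of the Hardy space of the upper half-plane.
   As f need not be integrable, the transform is the limit in the mean of the
   integrals over [- A, A]. *)
Definition cis (x : R) : R[i] := cos x +i* sin x.

Definition truncated_fourier (A : R) f (lambda : R) : R[i] :=
  ((Num.sqrt (2 * pi))^-1)%:C *
  cintegral `[- A, A] (fun x => cis (lambda * x) * f x).

Definition is_fourier f g :=
  (\int[mu]_lambda
     ((Normc.normc (truncated_fourier A f lambda - g lambda)) ^+ 2)%:E)%E
    @[A --> +oo%R] --> (0 : \bar R)%E.

Definition boundary_value (Theta : R[i] -> R[i]) (x : R) : R[i] :=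
  lim ((Theta (x +i* y) : R[i]^o) @[y --> 0^'+]).

Definition inner_function (Theta : R[i] -> R[i]) :=
  [/\ forall z : R[i], 0 < complex.Im z ->
        derivable (Theta : R[i]^o -> R[i]^o) z 1,
      exists C : R, forall z : R[i], 0 < complex.Im z ->
        Normc.normc (Theta z) <= C
    & \forall x \ae mu, cvg ((Theta (x +i* y) : R[i]^o) @[y --> 0^'+]) /\
        Normc.normc (boundary_value Theta x) = 1].

(* M is the isometric operator M_Theta on Hsupp 0; its values outside Hsupp 0
   are irrelevant. *)
Definition is_inner_multiplier (Theta : R[i] -> R[i]) (M : H -> H) :=
  isometry_on (Hsupp 0) M /\
  forall f, Hsupp 0 f -> exists f' g' : H,
    [/\ is_fourier f f', is_fourier (M f) g'
      & \forall x \ae mu, g' x = boundary_value Theta x * f' x].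

Definition mult_cocycle (W : R -> H -> H) :=
  [/\ forall t, unitary_on setT (W t),
      strongly_continuous_on setT W,
      forall s t f, W (t + s) f = W t (L2shift t (W s (L2shift (- t) f)))
    & forall f, W 0 f = f].

Definition markovian (W : R -> H -> H) :=
  forall t f, 0 <= t -> ominus setT (Hsupp t) f -> W t f = f.

Definition perturbed_semigroup (W : R -> H -> H) (t : R) f : H :=
  W (- t) (L2shift (- t) f).

Definition invariant_under (V : R -> H -> H) L :=
  forall t f, 0 <= t -> L f -> L (V t f).

Definition reduces E (V : R -> H -> H) L :=
  [/\ closed_subspace L, L `<=` E, invariant_under V L
    & invariant_under V (ominus E L)].

Definition completely_nonunitary E (V : R -> H -> H) :=
  forall L, reduces E V L -> (forall t, 0 <= t -> unitary_on L (V t)) ->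
    L `<=` [set 0].

(* V is a semigroup of isometries of E: only the values V t f with 0 <= t and
   f in E matter. *)
Definition wold_decomposition E (V : R -> H -> H) K0 K1 :=
  [/\ reduces E V K0 /\ K1 = ominus E K0,
      reduces E V K1 /\ K0 = ominus E K1,
      forall t, 0 <= t -> unitary_on K0 (V t)
    & completely_nonunitary K1 V].

Definition unitary_part_is E (V : R -> H -> H) K (U : R -> H -> H) :=
  wold_decomposition E V K (ominus E K) /\
  forall t f, 0 <= t -> K f -> V t f = U t f.

Section Model.
Variables (M : H -> H) (U : R -> H -> H).

Local Notation V := (M @` Hsupp 0).

Definition P_ge (t : R) : H -> H := orth_proj (Hsupp (- t)).
Definition P_le (t : R) : H -> H := orth_proj (ominus (Hsupp 0) (Hsupp (- t))).

(* W_{-t} on Hsupp 0, for t >= 0. The projection in the second term is the one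
   onto S_{-t} V, so that W_{-t} S_{-t} g = S_{-t} g for g in V and
   W_{-t} S_{-t} g = U_t g for g orthogonal to V. With the projection onto V in
   its place, |W_{-t} S_{-t} g|^2 = |g|^2 + |P_V S_{-t} g|^2 for g in Hsupp 0
   orthogonal to V, and W_{-t} would not be isometric in general. *)
Definition W_minus0 (t : R) f : H :=
  U t (orth_proj (ominus (Hsupp 0) V) (L2shift t (P_ge t f)))
  + orth_proj (L2shift (- t) @` V) (P_ge t f)
  + M (P_le t f).

Definition W_minus (t : R) f : H :=
  W_minus0 t (orth_proj (Hsupp 0) f) + orth_proj (ominus setT (Hsupp 0)) f.

Definition W_family (t : R) : H -> H :=
  if t <= 0 then W_minus (- t)
  else fun f => L2shift t (adj (W_minus t) (L2shift (- t) f)).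

End Model.

End Hilbert.

(* Main.v *)
Require Import Defs.
From HB Require Import structures.
From mathcomp Require Import all_boot all_order all_algebra.
From mathcomp Require Import generic_quotient ring_quotient.
From mathcomp Require Import all_classical all_reals all_analysis measurable_realfun.
From mathcomp Require Import complex ring lra.

Set Implicit Arguments.
Unset Strict Implicit.
Unset Printing Implicit Defensive.

Import Order.TTheory GRing.Theory Num.Theory numFieldNormedType.Exports.

Local Open Scope classical_set_scope.
Local Open Scope ring_scope.
Local Open Scope complex_scope.
Local Open Scope quotient_scope.

(** Let E be the subspace of functions supported in the half-line from 0 on, V
    the image of E under M, K the orthogonal complement of V in E, and S the shift
    group.

    The family W is the quotient of two unitary groups. Let J be the isometry of
    the whole space that acts as M on E and as the identity on the orthogonal
    complement of E; its range is the orthogonal complement of K. Then G_t, equal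
    to U_{-t} on K and to J S_t J^{-1} on the range of J, is a strongly continuous
    unitary group, and W_t = G_t S_{-t} for all t ([W_minus_model], [W_model]).
    Everything follows from this formula.

    - The cocycle identity is the group law of G and S, and the strong continuity
      of W comes from that of U and S.
    - If f is orthogonal to the functions supported in [- t, +oo), then S_{-t} f
      is orthogonal to E, so J fixes it and G_t S_{-t} f = J S_t S_{-t} f = f.
      This is the markovian property.
    - In the same way W_{-t} f = M f for f supported in [0, t], and both sides are
      isometric, so W_{-t} f tends to M f as the tail of f tends to 0.
    - The associated semigroup is G_{-t} on E: it is U_t on K, and on V it is
      M S_{-t} M^{-1}, which is completely nonunitary because no function but 0
      is supported in [t, +oo) for every t.

    The formula W_{-t} = G_{-t} S_t rests on the fact that M commutes with right
    shifts ([inner_multiplier_shift]). A shift multiplies the Fourier transform by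
    a character, which commutes with multiplication by the boundary value of
    Theta; what this argument needs is that the Fourier transform, a limit in the
    mean of integrals over [- A, A], is injective ([fourier_injective]). To see
    this, integrate the truncated transform of h against exp (- e |l|) times the
    transform of the indicator of an interval. Exchanging the integrals gives the
    integral of h against a difference of arctangents, which tends to 2 pi times
    the integral of h over that interval when e tends to 0. On the other hand this
    pairing is small, uniformly in e, when the energy of the truncated transform
    is, and this energy tends to 0. So all integrals of h over bounded intervals vanish, and by
    Lebesgue differentiation h = 0 almost everywhere.

    The Hilbert space facts behind the formula come from completeness
    ([L2_complete]), which gives orthogonal projections onto closed subspaces.
    The shifts are strongly continuous because the vectors with a continuous
    orbit form a closed subspace that contains the indicators of bounded
    intervals, and only 0 is orthogonal to all of these. *)

(** * Square-integrable functions and their classes *)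

Section L2Basics.
Variable R : realType.
Local Notation mu := (@lebesgue_measure R).
Local Notation H := (L2 R).

Definition abs2 (z : R[i]) : R := complex.Re z ^+ 2 + complex.Im z ^+ 2.

Definition cmeasurable (u : R -> R[i]) :=
  measurable_fun [set: measurableTypeR R] (fun x => complex.Re (u x)) /\
  measurable_fun [set: measurableTypeR R] (fun x => complex.Im (u x)).

Lemma aeS (P Q : R -> Prop) : (forall x, P x -> Q x) ->
  (\forall x \ae mu, P x) -> \forall x \ae mu, Q x.
Proof. by apply: filterS; exact: (ae_filter_ringOfSetsType mu). Qed.

Lemma aeS2 (P1 P2 Q : R -> Prop) : (forall x, P1 x -> P2 x -> Q x) ->
  (\forall x \ae mu, P1 x) -> (\forall x \ae mu, P2 x) -> \forall x \ae mu, Q x.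
Proof. by apply: filterS2; exact: (ae_filter_ringOfSetsType mu). Qed.

Lemma aeS3 (P1 P2 P3 Q : R -> Prop) : (forall x, P1 x -> P2 x -> P3 x -> Q x) ->
  (\forall x \ae mu, P1 x) -> (\forall x \ae mu, P2 x) -> (\forall x \ae mu, P3 x) ->
  \forall x \ae mu, Q x.
Proof. by apply: filterS3; exact: (ae_filter_ringOfSetsType mu). Qed.

Lemma abs2_ge0 z : 0 <= abs2 z.
Proof. by rewrite addr_ge0 ?sqr_ge0. Qed.

Lemma abs2_eq0 z : abs2 z = 0 -> z = 0.
Proof.
case: z => a b; rewrite /abs2 /= => /eqP; rewrite paddr_eq0 ?sqr_ge0// !sqrf_eq0.
by move=> /andP[/eqP -> /eqP ->].
Qed.

Lemma measurable_abs2 u : cmeasurable u -> measurable_fun [set: measurableTypeR R] (fun x => abs2 (u x)).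
Proof. by case=> mr mi; apply: measurable_funD; exact: measurable_funX. Qed.

Lemma Lfun2P (f : R -> R) : f \in Lfun mu 2%:E <->
  measurable_fun [set: measurableTypeR R] f /\ (\int[mu]_x (f x ^+ 2)%:E < +oo)%E.
Proof.
split=> [fL|[mf fi]].
  split; first by move: fL; rewrite inE => /andP[/[!inE]].
  by have /integrableP[_] := Lfun2_integrable_sqr fL;
    under eq_integral do rewrite /= ger0_norm ?sqr_ge0//.
rewrite inE; apply/andP; split; rewrite inE//=.
rewrite /finite_norm unlock /= poweR_lty//.
apply: le_lt_trans fi; rewrite le_eqVlt; apply/orP; left; apply/eqP.
apply: eq_integral => x _; rewrite /= powR_mulrn//.
by rewrite -normrX ger0_norm ?sqr_ge0.
Qed.

Lemma l2funP (u : R -> R[i]) : u \in @l2fun R <->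
  cmeasurable u /\ (\int[mu]_x (abs2 (u x))%:E < +oo)%E.
Proof.
have key : cmeasurable u -> (\int[mu]_x (abs2 (u x))%:E =
    \int[mu]_x (complex.Re (u x) ^+ 2)%:E + \int[mu]_x (complex.Im (u x) ^+ 2)%:E)%E.
  move=> [mr mi]; rewrite -ge0_integralD//=.
  - by move=> x _; rewrite lee_fin sqr_ge0.
  - by apply/measurable_EFinP; exact: measurable_funX.
  - by move=> x _; rewrite lee_fin sqr_ge0.
  - by apply/measurable_EFinP; exact: measurable_funX.
split.
  move=> /andP[/Lfun2P[mr ri] /Lfun2P[mi ii]].
  by split; [split | rewrite key//; exact: lte_add_pinfty].
move=> [mu2 ui]; have [mr mi] := mu2; rewrite (key mu2) in ui.
apply/andP; split; apply/Lfun2P; split=> //; apply: le_lt_trans ui.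
  by rewrite leeDl// integral_ge0// => x _; rewrite lee_fin sqr_ge0.
by rewrite leeDr// integral_ge0// => x _; rewrite lee_fin sqr_ge0.
Qed.

Lemma L2_l2fun (f : H) : (f : R -> R[i]) \in @l2fun R.
Proof. exact: L2fun_valP. Qed.

Lemma L2_cmeasurable (f : H) : cmeasurable f.
Proof. by have /l2funP[] := L2_l2fun f. Qed.

Lemma pi_L2_eq (f g : L2fun R) :
  \pi_H f = \pi_H g <-> \forall x \ae mu, f x = g x.
Proof.
have -> : (\pi_H f = \pi_H g) <-> (f - g \in @l2null R).
  by rewrite -Quotient.equivE; split => [/eqquotP //|fg]; apply/eqquotP.
split => [/asboolP|] fg; last apply/asboolP.
  apply: aeS fg => x /= /eqP; rewrite fctE /=.
  by rewrite -[X in X == 0]/(f x - g x) subr_eq0 => /eqP.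
by apply: aeS fg => x /= fg; rewrite -[LHS]/(f x - g x) fg subrr.
Qed.

Lemma L2_eqP (f g : H) : f = g <-> \forall x \ae mu, f x = g x.
Proof. by rewrite -pi_L2_eq !reprK. Qed.

Lemma toL2E (u : R -> R[i]) : u \in @l2fun R -> \forall x \ae mu, toL2 u x = u x.
Proof.
move=> ul; rewrite /toL2 /L2_repr.
have -> : insubd (0 : L2fun R) u = MkL2fun ul by apply: val_inj; rewrite insubdK.
by apply: (pi_L2_eq _ (MkL2fun ul)).1; rewrite reprK.
Qed.

Lemma L2_lincombE (a : R[i]) (f g : H) :
  \forall x \ae mu, (a *: f + g : H) x = a * f x + g x.
Proof.
have -> : a *: f + g = \pi_H (a *: repr f + repr g).
  rewrite raddfD /= reprK; congr (_ + _).
  by rewrite -[in LHS](reprK f) -[LHS]/(L2scale a _) -pi_L2scale.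
by apply: (pi_L2_eq _ (a *: repr f + repr g)).1; rewrite reprK.
Qed.

Lemma L2_0E : \forall x \ae mu, (0 : H) x = 0.
Proof.
have -> : (0 : H) = \pi_H 0 by rewrite raddf0.
by apply: (pi_L2_eq _ 0).1; rewrite reprK.
Qed.

Lemma L2_scaleE (a : R[i]) (f : H) : \forall x \ae mu, (a *: f : H) x = a * f x.
Proof.
by have := L2_lincombE a f 0; rewrite addr0; apply: aeS2 L2_0E => x -> ->; rewrite addr0.
Qed.

Lemma L2_subE (f g : H) : \forall x \ae mu, (f - g : H) x = f x - g x.
Proof.
have := L2_lincombE (-1) g f; rewrite scaleN1r addrC.
by apply: aeS => x ->; rewrite mulN1r addrC.
Qed.

Definition cintegrable (D : set (measurableTypeR R)) (u : R -> R[i]) :=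
  mu.-integrable D (fun x => (complex.Re (u x))%:E) /\
  mu.-integrable D (fun x => (complex.Im (u x))%:E).

Lemma cReD (z w : R[i]) : complex.Re (z + w) = complex.Re z + complex.Re w.
Proof. by case: z w => [a b] [c d]. Qed.
Lemma cImD (z w : R[i]) : complex.Im (z + w) = complex.Im z + complex.Im w.
Proof. by case: z w => [a b] [c d]. Qed.
Lemma cReB (z w : R[i]) : complex.Re (z - w) = complex.Re z - complex.Re w.
Proof. by case: z w => [a b] [c d]. Qed.
Lemma cImB (z w : R[i]) : complex.Im (z - w) = complex.Im z - complex.Im w.
Proof. by case: z w => [a b] [c d]. Qed.
Lemma cReM (z w : R[i]) :
  complex.Re (z * w) = complex.Re z * complex.Re w - complex.Im z * complex.Im w.
Proof. by case: z w => [a b] [c d]. Qed.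
Lemma cImM (z w : R[i]) :
  complex.Im (z * w) = complex.Re z * complex.Im w + complex.Im z * complex.Re w.
Proof. by case: z w => [a b] [c d]. Qed.

Lemma integrableD_EFin (D : set (measurableTypeR R)) (f g : R -> R) : measurable D ->
  mu.-integrable D (EFin \o f) -> mu.-integrable D (EFin \o g) ->
  mu.-integrable D (EFin \o (fun x => f x + g x)).
Proof. by move=> mD fi gi; have := integrableD mD fi gi. Qed.

Lemma integrableB_EFin (D : set (measurableTypeR R)) (f g : R -> R) : measurable D ->
  mu.-integrable D (EFin \o f) -> mu.-integrable D (EFin \o g) ->
  mu.-integrable D (EFin \o (fun x => f x - g x)).
Proof. by move=> mD fi gi; have := integrableB mD fi gi. Qed.

Lemma integrableZl_EFin (D : set (measurableTypeR R)) (k : R) (f : R -> R) : measurable D ->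
  mu.-integrable D (EFin \o f) -> mu.-integrable D (EFin \o (fun x => k * f x)).
Proof. by move=> mD fi; have := integrableZl mD k fi. Qed.

Lemma ae_Rintegral (D : set (measurableTypeR R)) (f g : R -> R) : measurable D ->
  measurable_fun D f -> measurable_fun D g ->
  (\forall x \ae mu, D x -> f x = g x) ->
  \int[mu]_(x in D) f x = \int[mu]_(x in D) g x.
Proof.
move=> mD mf mg fg; rewrite /Rintegral; congr fine; apply: ae_eq_integral => //.
- exact/measurable_EFinP.
- exact/measurable_EFinP.
- by apply: aeS fg => x fg Dx; rewrite fg.
Qed.

Lemma cintegral_lincomb (D : set (measurableTypeR R)) (a : R[i]) u v : measurable D ->
  cintegrable D u -> cintegrable D v ->
  cintegral D (fun x => a * u x + v x) = a * cintegral D u + cintegral D v.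
Proof.
move=> mD [ur ui] [vr vi]; apply/eqP; rewrite eq_complex.
rewrite !(cReD, cImD) !(cReM, cImM) /=; apply/andP; split; apply/eqP.
  under eq_Rintegral do rewrite cReD cReM.
  rewrite RintegralD//; last by apply: integrableB_EFin => //; exact: integrableZl_EFin.
  by rewrite RintegralB ?RintegralZl//; exact: integrableZl_EFin.
under eq_Rintegral do rewrite cImD cImM.
rewrite RintegralD//; last by apply: integrableD_EFin => //; exact: integrableZl_EFin.
by rewrite RintegralD ?RintegralZl//; exact: integrableZl_EFin.
Qed.

Lemma ae_cintegral (D : set (measurableTypeR R)) u v : measurable D ->
  cmeasurable u -> cmeasurable v -> (\forall x \ae mu, u x = v x) ->
  cintegral D u = cintegral D v.
Proof.
move=> mD [ur ui] [vr vi] uv; rewrite /cintegral.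
congr (_ +i* _); apply: ae_Rintegral => //; try exact: measurable_funTS.
  by apply: aeS uv => x ->.
by apply: aeS uv => x ->.
Qed.

Lemma cmeasurableM u v : cmeasurable u -> cmeasurable v -> cmeasurable (fun x => u x * v x).
Proof.
move=> [ur ui] [vr vi]; split.
  by under eq_fun do rewrite cReM; apply: measurable_funB; apply: measurable_funM.
by under eq_fun do rewrite cImM; apply: measurable_funD; apply: measurable_funM.
Qed.

Lemma cmeasurableD u v : cmeasurable u -> cmeasurable v -> cmeasurable (fun x => u x + v x).
Proof.
move=> [ur ui] [vr vi]; split.
  by under eq_fun do rewrite cReD; apply: measurable_funD.
by under eq_fun do rewrite cImD; apply: measurable_funD.
Qed.

Lemma cmeasurableB u v : cmeasurable u -> cmeasurable v -> cmeasurable (fun x => u x - v x).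
Proof.
move=> [ur ui] [vr vi]; split.
  by under eq_fun do rewrite cReB; apply: measurable_funB.
by under eq_fun do rewrite cImB; apply: measurable_funB.
Qed.

Lemma cmeasurable_cst (a : R[i]) : cmeasurable (fun=> a).
Proof. by split; exact: measurable_cst. Qed.

Lemma cmeasurable_conj u : cmeasurable u -> cmeasurable (fun x => conjc (u x)).
Proof.
move=> [ur ui]; split.
  by rewrite (_ : (fun x => _) = (fun x => complex.Re (u x)))//; apply/funext => x; case: (u x).
rewrite (_ : (fun x => _) = (\- (fun x => complex.Im (u x)))); last first.
  by apply/funext => x /=; case: (u x).
exact: measurable_funN.
Qed.

Lemma cintegrable_l2M u v : u \in @l2fun R -> v \in @l2fun R ->
  cintegrable setT (fun x => u x * conjc (v x)).
Proof.
move=> /andP[ur ui] /andP[vr vi].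
have I f g : f \in Lfun mu 2%:E -> g \in Lfun mu 2%:E ->
    mu.-integrable setT (EFin \o (f \* g)).
  by move=> fL gL; apply/Lfun1_integrable; exact: Lfun2_mul_Lfun1.
split.
  have := integrableD measurableT (I _ _ ur vr) (I _ _ ui vi).
  by apply: eq_integrable => // x _; rewrite /= -EFinD cReM; case: (u x) (v x) => [a b] [c d] /=; rewrite mulrN opprK.
have := integrableB measurableT (I _ _ ui vr) (I _ _ ur vi).
by apply: eq_integrable => // x _; rewrite /= -EFinB cImM; case: (u x) (v x) => [a b] [c d] /=; rewrite mulrN addrC.
Qed.

Lemma dot_lincomb (a : R[i]) (f g h : H) : dot (a *: f + g) h = a * dot f h + dot g h.
Proof.
rewrite /dot -cintegral_lincomb//; [|exact: cintegrable_l2M (L2_l2fun _) (L2_l2fun _)..].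
have mf := L2_cmeasurable f; have mg := L2_cmeasurable g; have mh := L2_cmeasurable h.
apply: ae_cintegral => //.
- by apply: cmeasurableM; [exact: L2_cmeasurable|exact: cmeasurable_conj].
- by apply: cmeasurableD; [apply: cmeasurableM; [exact: cmeasurable_cst|]|];
    apply: cmeasurableM => //; exact: cmeasurable_conj.
- by apply: aeS (L2_lincombE a f g) => x ->; rewrite mulrDl mulrA.
Qed.

Lemma dotC (f g : H) : dot g f = conjc (dot f g).
Proof.
rewrite /dot /cintegral /=; apply/eqP; rewrite eq_complex /=; apply/andP; split; apply/eqP.
  apply: eq_Rintegral => x _.
  by case: (f x) (g x) => [a b] [c d] /=; ring.
rewrite -[RHS]mulN1r -RintegralZl//.
  apply: eq_Rintegral => x _.
  by case: (f x) (g x) => [a b] [c d] /=; ring.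
by have [] := cintegrable_l2M (L2_l2fun f) (L2_l2fun g).
Qed.

(** The squared norm, with values in the extended reals so that it applies to
    functions not yet known to be square integrable. *)
Definition energy (u : R -> R[i]) : \bar R := (\int[mu]_x (abs2 (u x))%:E)%E.

Lemma energy_ge0 u : (0 <= energy u)%E.
Proof. by apply: integral_ge0 => x _; rewrite lee_fin abs2_ge0. Qed.

Lemma energy_eq0 u : cmeasurable u -> energy u = 0%E -> \forall x \ae mu, u x = 0.
Proof.
move=> mu_ u0.
have mf : measurable_fun [set: measurableTypeR R] (fun x => (abs2 (u x))%:E).
  by apply/measurable_EFinP; exact: measurable_abs2.
have : (\int[mu]_(x in setT) `|(abs2 (u x))%:E| = 0)%E.
  by rewrite -[RHS]u0; apply: eq_integral => x _; rewrite gee0_abs// lee_fin abs2_ge0.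
move/(ae_eq_integral_abs mu measurableT mf).
by apply: aeS => x /(_ I) /= [] /abs2_eq0.
Qed.

Lemma energy_ae u v : cmeasurable u -> cmeasurable v ->
  (\forall x \ae mu, u x = v x) -> energy u = energy v.
Proof.
move=> mu_ mv uv; apply: ae_eq_integral => //.
- by apply/measurable_EFinP; exact: measurable_abs2.
- by apply/measurable_EFinP; exact: measurable_abs2.
- by apply: aeS uv => x ->.
Qed.

Lemma dot_self (f : H) : complex.Re (dot f f) = fine (energy f).
Proof.
rewrite /dot /cintegral /=; congr fine; apply: eq_integral => x _.
by rewrite /abs2; case: (f x) => a b /=; congr EFin; ring.
Qed.

Lemma energy_fin (f : H) : energy f \is a fin_num.
Proof. by rewrite ge0_fin_numE ?energy_ge0//; have /l2funP[] := L2_l2fun f. Qed.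

Lemma dot_self_ge0 (f : H) : 0 <= complex.Re (dot f f).
Proof. by rewrite dot_self fine_ge0// energy_ge0. Qed.

Lemma dot_self_eq0 (f : H) : complex.Re (dot f f) = 0 -> f = 0.
Proof.
rewrite dot_self => /eqP; rewrite fine_eq0 ?energy_fin// => /eqP f0; apply/L2_eqP.
by apply: aeS2 (energy_eq0 (L2_cmeasurable f) f0) L2_0E => x -> ->.
Qed.

Lemma l2norm_energy (f : H) : energy f = ((l2norm f) ^+ 2)%:E.
Proof. by rewrite sqr_sqrtr ?dot_self_ge0// dot_self fineK ?energy_fin. Qed.

End L2Basics.
(** * Geometry of the inner product *)

Section Geometry.
Variable R : realType.
Local Notation mu := (@lebesgue_measure R).
Local Notation H := (L2 R).
Implicit Types (f g h : H).

Lemma dotDl f g h : dot (f + g) h = dot f h + dot g h.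
Proof. by have := dot_lincomb 1 f g h; rewrite scale1r mul1r. Qed.

Lemma dot0l h : dot 0 h = 0.
Proof. by apply: (addrI (dot 0 h)); rewrite -dotDl !addr0. Qed.

Lemma dotZl a f h : dot (a *: f) h = a * dot f h.
Proof. by have := dot_lincomb a f 0 h; rewrite dot0l !addr0. Qed.

Lemma dotNl f h : dot (- f) h = - dot f h.
Proof. by rewrite -scaleN1r dotZl mulN1r. Qed.

Lemma dotBl f g h : dot (f - g) h = dot f h - dot g h.
Proof. by rewrite dotDl dotNl. Qed.

Lemma dotDr f g h : dot h (f + g) = dot h f + dot h g.
Proof. by rewrite !(dotC _ h) dotDl raddfD. Qed.

Lemma dot0r h : dot h 0 = 0.
Proof. by rewrite dotC dot0l conjc0. Qed.

Lemma dotZr a f h : dot h (a *: f) = conjc a * dot h f.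
Proof. by rewrite !(dotC _ h) dotZl rmorphM. Qed.

Lemma dotNr f h : dot h (- f) = - dot h f.
Proof. by rewrite !(dotC _ h) dotNl raddfN. Qed.

Lemma dotBr f g h : dot h (f - g) = dot h f - dot h g.
Proof. by rewrite dotDr dotNr. Qed.

Lemma dot_eq0C f g : dot f g = 0 -> dot g f = 0.
Proof. by move=> fg; rewrite dotC fg conjc0. Qed.

Definition rdot f g : R := complex.Re (dot f g).

Lemma rdotC f g : rdot f g = rdot g f.
Proof. by rewrite /rdot dotC; case: (dot g f). Qed.

Lemma rdotDl f g h : rdot (f + g) h = rdot f h + rdot g h.
Proof. by rewrite /rdot dotDl cReD. Qed.

Lemma rdotNl f h : rdot (- f) h = - rdot f h.
Proof. by rewrite /rdot dotNl; case: (dot f h). Qed.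

Lemma rdotZl (a : R) f h : rdot (a%:C *: f) h = a * rdot f h.
Proof. by rewrite /rdot dotZl cReM /= mul0r subr0. Qed.

Lemma rdotDr f g h : rdot h (f + g) = rdot h f + rdot h g.
Proof. by rewrite !(rdotC h) rdotDl. Qed.

Lemma rdotNr f h : rdot h (- f) = - rdot h f.
Proof. by rewrite !(rdotC h) rdotNl. Qed.

Lemma rdotZr (a : R) f h : rdot h (a%:C *: f) = a * rdot h f.
Proof. by rewrite !(rdotC h) rdotZl. Qed.

(** Since multiplication by 'i exchanges real and imaginary parts, statements about
    dot reduce to its real part. *)
Lemma dot_rdot f g : dot f g = rdot f g +i* - rdot ('i *: f) g.
Proof. by rewrite /rdot dotZl; case: (dot f g) => a b /=; rewrite mul0r mul1r sub0r opprK. Qed.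

Lemma l2norm_ge0 f : 0 <= l2norm f. Proof. exact: sqrtr_ge0. Qed.

Lemma l2norm_sqr f : l2norm f ^+ 2 = rdot f f.
Proof. by rewrite sqr_sqrtr ?dot_self_ge0. Qed.

Lemma l2norm_eq0 f : l2norm f = 0 -> f = 0.
Proof. by move=> f0; apply: dot_self_eq0; rewrite -/(rdot f f) -l2norm_sqr f0 expr0n. Qed.

Lemma l2norm0 : l2norm (0 : H) = 0.
Proof. by rewrite /l2norm dot0l sqrtr0. Qed.

Lemma l2normN f : l2norm (- f) = l2norm f.
Proof. by rewrite /l2norm dotNl dotNr opprK. Qed.

Lemma l2normBC f g : l2norm (f - g) = l2norm (g - f).
Proof. by rewrite -opprB l2normN. Qed.

Lemma l2normD_sqr f g : l2norm (f + g) ^+ 2 = l2norm f ^+ 2 + 2 * rdot f g + l2norm g ^+ 2.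
Proof. by rewrite !l2norm_sqr rdotDl !rdotDr (rdotC g f); ring. Qed.

Lemma cauchy_schwarz f g : `|rdot f g| <= l2norm f * l2norm g.
Proof.
have [/l2norm_eq0 ->|g0] := eqVneq (l2norm g) 0.
  by rewrite /rdot dot0r /= normr0 l2norm0 mulr0.
have gp : 0 < l2norm g by rewrite lt_neqAle eq_sym g0 l2norm_ge0.
rewrite -(ler_pXn2r (isT : (0 < 2)%N)) ?nnegrE ?mulr_ge0 ?l2norm_ge0//.
rewrite exprMn -normrX ger0_norm ?sqr_ge0//.
(* the minimiser of the norm of f + t g *)
pose t : R := - (rdot f g / l2norm g ^+ 2).
have : 0 <= l2norm (f + t%:C *: g) ^+ 2 by rewrite sqr_ge0.
rewrite (l2normD_sqr f (t%:C *: g)) rdotZr (l2norm_sqr (t%:C *: g)) rdotZl rdotZr.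
rewrite -(l2norm_sqr g).
have -> : l2norm f ^+ 2 + 2 * (t * rdot f g) + t * (t * l2norm g ^+ 2) =
    l2norm f ^+ 2 - rdot f g ^+ 2 / l2norm g ^+ 2.
  by rewrite /t; field.
by rewrite subr_ge0 ler_pdivrMr// exprn_gt0.
Qed.

Lemma l2normD f g : l2norm (f + g) <= l2norm f + l2norm g.
Proof.
rewrite -(ler_pXn2r (isT : (0 < 2)%N)) ?nnegrE ?addr_ge0 ?l2norm_ge0//.
rewrite (l2normD_sqr f g) sqrrD lerD2r lerD2l -[leRHS]mulr_natl ler_pM2l//.
exact: le_trans (ler_norm _) (cauchy_schwarz f g).
Qed.

Lemma l2norm_triangle f g h : l2norm (f - h) <= l2norm (f - g) + l2norm (g - h).
Proof. by apply: le_trans (l2normD _ _); rewrite addrA subrK. Qed.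

Lemma parallelogram f g :
  l2norm (f + g) ^+ 2 + l2norm (f - g) ^+ 2 = 2 * l2norm f ^+ 2 + 2 * l2norm g ^+ 2.
Proof. by rewrite (l2normD_sqr f g) (l2normD_sqr f (- g)) l2normN rdotNr; ring. Qed.

Lemma l2normZ (a : R) f : l2norm (a%:C *: f) = `|a| * l2norm f.
Proof.
apply/eqP; rewrite -(@eqrXn2 _ 2)// ?mulr_ge0 ?l2norm_ge0//.
rewrite exprMn real_normK ?num_real// !l2norm_sqr rdotZl rdotZr.
by rewrite mulrA expr2.
Qed.

Lemma l2normZi f : l2norm ('i *: f) = l2norm f.
Proof.
rewrite /l2norm dotZl dotZr mulrA.
have -> : ('i * conjc 'i = 1 :> R[i]) by simpc.
by rewrite mul1r.
Qed.

(** By the Cauchy-Schwarz inequality the inner product is continuous. *)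
Lemma orth_limit (u : nat -> H) f g : (forall n, dot (u n) g = 0) ->
  l2norm (u n - f) @[n --> \oo] --> (0 : R) -> dot f g = 0.
Proof.
move=> u0 uf.
have key v k : (forall n, rdot (v n) g = 0) ->
    l2norm (v n - k) @[n --> \oo] --> (0 : R) -> rdot k g = 0.
  move=> v0 vk.
  have H1 : `|rdot k g| <= 0.
    have c1 : (l2norm (v n - k) * l2norm g) @[n --> \oo] --> (0 : R).
      by rewrite -(mul0r (l2norm g)); apply: cvgMl.
    apply: (ler_cvg_to (cvg_cst _) c1).
    apply: nearW => n; apply: le_trans (cauchy_schwarz _ _).
    by rewrite rdotDl v0 add0r rdotNl normrN.
  by apply/eqP; rewrite -normr_le0.
rewrite dot_rdot (key u)//; last by move=> n; rewrite /rdot u0.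
rewrite (key (fun n => 'i *: u n)) ?oppr0//.
  by move=> n; rewrite /rdot dotZl u0 mulr0.
by apply: cvg_trans uf; apply: near_eq_cvg; apply: nearW => n /=; rewrite -scalerBr l2normZi.
Qed.

End Geometry.

(** * Completeness *)

Section Completeness.
Variable R : realType.
Local Notation mu := (@lebesgue_measure R).
Local Notation H := (L2 R).

(** If d_n is the n-th increment and q_n = 2^-n, the functions d_n^2 / q_n have
    integrals at most q_n, so their sum is finite almost everywhere. As
    |d_n| <= d_n^2 / q_n + q_n, the increments are then absolutely summable. *)
Lemma fast_cauchy_cvg_ae (v : nat -> R -> R) :
  (forall n, measurable_fun [set: measurableTypeR R] (v n)) ->
  (forall n, (\int[mu]_x ((v n.+1 x - v n x) ^+ 2)%:E <= ((2^-1 ^+ n) ^+ 2)%:E)%E) ->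
  \forall x \ae mu, cvgn (v ^~ x).
Proof.
move=> mv dv; pose q n : R := 2^-1 ^+ n.
have q0 n : 0 < q n by rewrite exprn_gt0// invr_gt0.
pose d n x := v n.+1 x - v n x.
have md n : measurable_fun [set: measurableTypeR R] (d n) by exact: measurable_funB.
pose F n x := ((q n)^-1 * d n x ^+ 2)%:E.
have F0 n x : (0 <= F n x)%E by rewrite lee_fin mulr_ge0 ?sqr_ge0// invr_ge0 ltW.
have mF n : measurable_fun [set: measurableTypeR R] (F n).
  apply/measurable_EFinP; apply: measurable_funM => //; exact: measurable_funX.
have IF n : (\int[mu]_x F n x <= (q n)%:E)%E.
  rewrite /F; under eq_integral do rewrite EFinM.
  rewrite ge0_integralZl//=; last 3 first.
  - by apply/measurable_EFinP; exact: measurable_funX.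
  - by move=> x _; rewrite lee_fin sqr_ge0.
  - by rewrite lee_fin invr_ge0 ltW.
  apply: (@le_trans _ _ ((q n)^-1%:E * ((q n) ^+ 2)%:E)%E).
    by rewrite lee_pmul2l ?lte_fin ?invr_gt0//; exact: dv.
  by rewrite -EFinM lee_fin expr2 mulKf// gt_eqF.
have sq : cvgn (series q).
  have -> : q = geometric 1 2^-1 by apply/funext => n; rewrite /q /= mul1r.
  by apply: is_cvg_geometric_series; rewrite ger0_norm// invf_lt1// ltr1n.
have qle n : series q n <= 2.
  have -> : q = geometric 1 2^-1 by apply/funext => k; rewrite /q /= mul1r.
  have h1 : `|2^-1 : R| < 1 by rewrite ger0_norm// invf_lt1// ltr1n.
  have h0 : 0 < (2^-1 : R) by rewrite invr_gt0.
  apply: le_trans (@geometric_le_lim R n 1 2^-1 ler01 h0 h1) _.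
  by rewrite mul1r le_eqVlt; apply/orP; left; apply/eqP; field.
have SF : (\int[mu]_x (\sum_(n <oo) F n x) < +oo)%E.
  rewrite integral_nneseries//.
  apply: (@le_lt_trans _ _ 2%:E); last exact: ltry.
  apply: lime_le; first by apply: is_cvg_nneseries => n _ _; exact: integral_ge0.
  apply: nearW => n; apply: le_trans (_ : _ <= (series q n)%:E)%E _; last by rewrite lee_fin.
  by rewrite /series /= -sumEFin lee_sum.
have S0 x : (0 <= \sum_(n <oo) F n x)%E by apply: nneseries_ge0 => n _ _.
have iS : mu.-integrable setT (fun x => (\sum_(n <oo) F n x)%E).
  apply/integrableP; split.
    exact: ge0_emeasurable_sum.
  by under eq_integral do rewrite gee0_abs//.
apply: aeS (integrable_ae measurableT iS) => x /(_ I) Sfin.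
have bnd n : `|d n x| <= (q n)^-1 * d n x ^+ 2 + q n.
  have [dq|/ltW qd] := leP `|d n x| (q n).
    by apply: le_trans dq _; rewrite lerDr mulr_ge0 ?sqr_ge0// invr_ge0 ltW.
  rewrite -[leLHS]addr0 lerD ?(ltW (q0 n))//.
  rewrite mulrC ler_pdivlMr// -real_normK ?num_real// expr2 ler_wpM2l//.
have cF : cvgn (series (fun n => (q n)^-1 * d n x ^+ 2)).
  apply: nondecreasing_is_cvgn.
    by apply: nondecreasing_series => n _ _; rewrite mulr_ge0 ?sqr_ge0// invr_ge0 ltW.
  exists (fine (\sum_(n <oo) F n x)%E) => _ [n _ <-].
  rewrite -lee_fin fineK// /series /= -sumEFin.
  by apply: nneseries_lim_ge => k _ _; exact: F0.
have cd : cvgn (series (fun n => d n x)).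
  apply: normed_cvg.
  apply: (series_le_cvg _ _ bnd).
  - by move=> n; exact: normr_ge0.
  - by move=> n; apply: le_trans (normr_ge0 _) (bnd n).
  - have -> : series (fun n => (q n)^-1 * d n x ^+ 2 + q n) =
      series (fun n => (q n)^-1 * d n x ^+ 2) + series q.
      by apply/funext => n; rewrite !fctE /series /= big_split.
    exact: is_cvgD.
have -> : v ^~ x = (fun n => v 0%N x) + series (fun n => d n x).
  apply/funext => n; rewrite fctE.
  by rewrite [LHS](eq_sum_telescope (v ^~ x) n).
by apply: is_cvgD => //; exact: is_cvg_cst.
Qed.

Lemma limn_einf_le (u : (\bar R)^nat) (c : \bar R) :
  (forall n, (u n <= c)%E) -> (limn_einf u <= c)%E.
Proof.
move=> uc; rewrite limn_einf_lim; apply: lime_le; first exact: is_cvg_einfs.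
apply: nearW => n; apply: le_trans (uc n).
by apply: ereal_inf_lbound; exists n => /=.
Qed.

Lemma energy_lty_l2fun u : cmeasurable u -> (energy u < +oo)%E -> u \in @l2fun R.
Proof. by move=> mu_ ul; apply/l2funP. Qed.

Lemma l2norm_le_energy (u : R -> R[i]) (f : H) (c : R) : 0 <= c ->
  cmeasurable u -> (\forall x \ae mu, f x = u x) ->
  (energy u <= (c ^+ 2)%:E)%E -> l2norm f <= c.
Proof.
move=> c0 mu_ fu; rewrite -(energy_ae (L2_cmeasurable f) mu_ fu) l2norm_energy lee_fin.
by rewrite ler_pXn2r// nnegrE ?l2norm_ge0.
Qed.

Lemma fast_cauchy_bound (u : nat -> H) :
  (forall n, l2norm (u n.+1 - u n) <= 2^-1 ^+ n) ->
  forall n m, l2norm (u (n + m)%N - u n) <= 2 * 2^-1 ^+ n.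
Proof.
move=> hu n m.
apply: (@le_trans _ _ (2 * 2^-1 ^+ n - 2 * 2^-1 ^+ (n + m))); last first.
  by rewrite gerBl mulr_ge0// exprn_ge0// invr_ge0.
elim: m => [|m IH]; first by rewrite addn0 !subrr l2norm0.
apply: le_trans (l2norm_triangle _ (u (n + m)%N) _) _.
rewrite addnS; apply: le_trans (lerD (hu _) IH) _.
rewrite exprS mulrA divff// mul1r.
by set a := _ ^+ n; set b := _ ^+ _; lra.
Qed.

(** The pointwise limit exists almost everywhere by [fast_cauchy_cvg_ae], and
    Fatou's lemma passes the geometric bounds on distances to the limit. Every
    Cauchy sequence has a subsequence with increments this small. *)
Lemma L2_complete (u : nat -> H) :
  (forall n, l2norm (u n.+1 - u n) <= 2^-1 ^+ n) ->
  exists f : H, l2norm (u n - f) @[n --> \oo] --> (0 : R).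
Proof.
move=> hu.
have mu_ n := L2_cmeasurable (u n).
have e1 n : (\int[mu]_x (abs2 (u n.+1 x - u n x))%:E <= ((2^-1 ^+ n) ^+ 2)%:E)%E.
  have <- : energy (u n.+1 - u n : H) = (\int[mu]_x (abs2 (u n.+1 x - u n x))%:E)%E.
    apply: energy_ae (L2_subE _ _); first exact: L2_cmeasurable.
    by apply: cmeasurableB.
  by rewrite l2norm_energy lee_fin ler_pXn2r ?nnegrE ?l2norm_ge0 ?exprn_ge0 ?invr_ge0.
have mB n m : cmeasurable (fun x => u n x - u m x) by exact: cmeasurableB.
have cr : \forall x \ae mu, cvgn (fun n => complex.Re (u n x)).
  apply: fast_cauchy_cvg_ae => n; first by have [] := mu_ n.
  apply: le_trans (e1 n); apply: ge0_le_integral => //=.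
  - by move=> x _; rewrite lee_fin sqr_ge0.
  - apply/measurable_EFinP; apply: measurable_funX; apply: measurable_funB;
      by have [] := mu_ n; have [] := mu_ n.+1.
  - by apply/measurable_EFinP; exact: measurable_abs2.
  - by move=> x _; rewrite lee_fin /abs2 cReB lerDl sqr_ge0.
have ci : \forall x \ae mu, cvgn (fun n => complex.Im (u n x)).
  apply: fast_cauchy_cvg_ae => n; first by have [] := mu_ n.
  apply: le_trans (e1 n); apply: ge0_le_integral => //=.
  - by move=> x _; rewrite lee_fin sqr_ge0.
  - apply/measurable_EFinP; apply: measurable_funX; apply: measurable_funB;
      by have [] := mu_ n; have [] := mu_ n.+1.
  - by apply/measurable_EFinP; exact: measurable_abs2.
  - by move=> x _; rewrite lee_fin /abs2 cImB lerDr sqr_ge0.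
have [N [mN N0 Nc]] : \forall x \ae mu, cvgn (fun n => complex.Re (u n x)) /\
    cvgn (fun n => complex.Im (u n x)) by apply: aeS2 cr ci.
have mNC : measurable (~` N) by exact: measurableC.
(* redefined as 0 on the null set N, the sequence converges everywhere, which
   makes its limit measurable *)
pose vr n := (fun x => complex.Re (u n x)) \_ (~` N).
pose vi n := (fun x => complex.Im (u n x)) \_ (~` N).
have mvr n : measurable_fun [set: measurableTypeR R] (vr n).
  by apply: (measurable_restrictT _ mNC).1; apply: measurable_funTS; have [] := mu_ n.
have mvi n : measurable_fun [set: measurableTypeR R] (vi n).
  by apply: (measurable_restrictT _ mNC).1; apply: measurable_funTS; have [] := mu_ n.
have cN x : ~ N x -> cvgn (fun n => complex.Re (u n x)) /\ cvgn (fun n => complex.Im (u n x)).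
  by move=> Nx; apply: contrapT => h; apply: Nx; exact: Nc.
have cvr x : cvgn (vr ^~ x).
  have [Nx|Nx] := pselect (N x).
    rewrite (_ : vr ^~ x = fun=> 0); first exact: is_cvg_cst.
    by apply/funext => n; rewrite /vr patchE memNset//= => /(_ Nx).
  rewrite (_ : vr ^~ x = fun n => complex.Re (u n x)); first by have [] := cN x Nx.
  by apply/funext => n; rewrite /vr patchE mem_set.
have cvi x : cvgn (vi ^~ x).
  have [Nx|Nx] := pselect (N x).
    rewrite (_ : vi ^~ x = fun=> 0); first exact: is_cvg_cst.
    by apply/funext => n; rewrite /vi patchE memNset//= => /(_ Nx).
  rewrite (_ : vi ^~ x = fun n => complex.Im (u n x)); first by have [] := cN x Nx.
  by apply/funext => n; rewrite /vi patchE mem_set.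
pose w x := limn (vr ^~ x) +i* limn (vi ^~ x).
have mw : cmeasurable w.
  split.
  - by apply: (@measurable_fun_cvg _ _ _ _ vr _ mvr) => x _; exact: cvr.
  - by apply: (@measurable_fun_cvg _ _ _ _ vi _ mvi) => x _; exact: cvi.
have aeN n : \forall x \ae mu, u n x = vr n x +i* vi n x.
  exists N; split => // x /= ux; apply: contrapT => Nx; apply: ux.
  by rewrite /vr /vi !patchE mem_set//=; case: (u n x).
have mv n : cmeasurable (fun x => vr n x +i* vi n x) by split; [exact: mvr|exact: mvi].
pose dw n x := u n x - w x.
have ew n : (energy (dw n) <= ((2 * 2^-1 ^+ n) ^+ 2)%:E)%E.
  have -> : energy (dw n) = energy (fun x => (vr n x +i* vi n x) - w x).
    by apply: energy_ae; [exact: cmeasurableB|exact: cmeasurableB|apply: aeS (aeN n) => x ux; rewrite /dw ux].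
  (* Fatou's lemma is applied to the distances from u n to the later terms *)
  pose g m x := (abs2 ((vr n x +i* vi n x) - (vr (n + m)%N x +i* vi (n + m)%N x)))%:E.
  have -> : energy (fun x => (vr n x +i* vi n x) - w x) = (\int[mu]_x limn_einf (g ^~ x))%E.
    apply: eq_integral => x _; have : g ^~ x @ \oo --> (abs2 ((vr n x +i* vi n x) - w x))%:E.
      apply: cvg_EFin; first exact: nearW.
      have sh (v : nat -> R) : cvgn v -> (v n - v (n + m)%N) @[m --> \oo] --> v n - limn v.
        move=> cv; apply: cvgB; first exact: cvg_cst.
        move: cv; rewrite -(cvg_shiftn n v); apply: cvg_trans.
        by apply: near_eq_cvg; apply: nearW => m /=; rewrite addnC.
      rewrite /abs2 /= !expr2; apply: cvgD; apply: cvgM;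
        by [exact: sh (cvr x)|exact: sh (cvi x)].
    by move=> /cvg_limn_einf_sup[-> _].
  apply: le_trans (fatou _ _ _ _) _ => //.
  - by move=> m; apply/measurable_EFinP; apply: measurable_abs2; exact: cmeasurableB.
  - by move=> m x _; rewrite lee_fin abs2_ge0.
  apply: limn_einf_le => m.
  have -> : (\int[mu]_x g m x)%E = energy (u n - u (n + m)%N : H).
    apply: energy_ae; [exact: cmeasurableB|exact: L2_cmeasurable|].
    by apply: aeS3 (L2_subE (u n) (u (n + m)%N)) (aeN n) (aeN (n + m)%N) => x -> -> ->.
  rewrite l2norm_energy lee_fin ler_pXn2r ?nnegrE ?l2norm_ge0 ?mulr_ge0 ?exprn_ge0 ?invr_ge0//.
  by rewrite l2normBC; exact: fast_cauchy_bound.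
have wl : w \in @l2fun R.
  have l0 : (fun x => u 0%N x - w x) \in @l2fun R.
    apply: energy_lty_l2fun; first exact: cmeasurableB.
    by apply: le_lt_trans (ew 0%N) _; exact: ltry.
  have -> : w = (u 0%N : R -> R[i]) - (fun x => u 0%N x - w x).
    by apply/funext => x; rewrite !fctE /= opprB addrC subrK.
  by apply: rpredB => //; exact: L2_l2fun.
exists (toL2 w).
have lim0 : (2 * 2^-1 ^+ n) @[n --> \oo] --> (0 : R).
  have h1 : `|2^-1 : R| < 1 by rewrite ger0_norm// invf_lt1// ltr1n.
  exact: (@cvg_geometric R 2 2^-1 h1).
apply: (squeeze_cvgr _ (cvg_cst 0) lim0); apply: nearW => n; rewrite l2norm_ge0/=.
apply: (@l2norm_le_energy (fun x => u n x - w x)) (ew n).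
- by rewrite mulr_ge0// exprn_ge0// invr_ge0.
- exact: cmeasurableB.
- by apply: aeS2 (L2_subE (u n) (toL2 w)) (toL2E wl) => x -> ->.
Qed.

End Completeness.

(** * Orthogonal projections, isometries and adjoints *)

Section Projection.
Variable R : realType.
Local Notation H := (L2 R).
Implicit Types (f g h : H) (K L : set H).

Lemma subspaceD L f g : linear_subspace L -> L f -> L g -> L (f + g).
Proof. by move=> [_ Ll] Lf Lg; rewrite -[f]scale1r; exact: Ll. Qed.

Lemma subspaceZ L a f : linear_subspace L -> L f -> L (a *: f).
Proof. by move=> [L0 Ll] Lf; rewrite -[a *: f]addr0; exact: Ll. Qed.

Lemma subspaceN L f : linear_subspace L -> L f -> L (- f).
Proof. by move=> Ll Lf; rewrite -scaleN1r; exact: subspaceZ. Qed.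

Lemma subspaceB L f g : linear_subspace L -> L f -> L g -> L (f - g).
Proof. by move=> Ll Lf Lg; apply: subspaceD => //; exact: subspaceN. Qed.

Lemma setT_closed : closed_subspace (setT : set H).
Proof. by []. Qed.

Lemma orth_closed L : closed_subspace (orth L).
Proof.
split; first split; first by move=> g _; exact: dot0l.
  by move=> a f g Lf Lg h Lh; rewrite dot_lincomb Lf// Lg// mulr0 addr0.
by move=> u f Lu uf g Lg; apply: (orth_limit _ uf) => n; exact: Lu.
Qed.

Lemma closed_subspaceI K L :
  closed_subspace K -> closed_subspace L -> closed_subspace (K `&` L).
Proof.
move=> [[K0 Kl] Kc] [[L0 Ll] Lc]; split; first split => //.
  by move=> a f g [Kf Lf] [Kg Lg]; split; [exact: Kl|exact: Ll].
by move=> u f KLu uf; split;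
  [apply: Kc uf => n; have [] := KLu n|apply: Lc uf => n; have [] := KLu n].
Qed.

Lemma ominus_closed K L : closed_subspace K -> closed_subspace (ominus K L).
Proof. by move=> Kc; exact: closed_subspaceI Kc (orth_closed L). Qed.

Lemma orth_self f L : L f -> orth L f -> f = 0.
Proof. by move=> Lf Of; apply: dot_self_eq0; rewrite (Of f Lf). Qed.

(** Moving g along h by the real multiple t = <f - g, h> / |h|^2 lowers the squared
    distance by <f - g, h>^2 / |h|^2, so at a minimum this inner product vanishes. *)
Lemma dist_min_orth L f g : linear_subspace L -> L g ->
  (forall h, L h -> l2norm (f - g) <= l2norm (f - h)) -> orth L (f - g).
Proof.
move=> Ll Lg gmin.
have key h : L h -> rdot (f - g) h = 0.
  move=> Lh; have [/l2norm_eq0 ->|h0] := eqVneq (l2norm h) 0; first by rewrite /rdot dot0r.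
  have hp : 0 < l2norm h by rewrite lt_neqAle eq_sym h0 l2norm_ge0.
  pose t : R := rdot (f - g) h / l2norm h ^+ 2.
  have Lt : L (g + t%:C *: h) by apply: subspaceD => //; exact: subspaceZ.
  have : l2norm (f - g) ^+ 2 <= l2norm ((f - g) + (- t)%:C *: h) ^+ 2.
    rewrite ler_pXn2r ?nnegrE ?l2norm_ge0//.
    have -> : (f - g) + (- t)%:C *: h = f - (g + t%:C *: h).
      by rewrite opprD addrA raddfN scaleNr.
    exact: gmin.
  rewrite (l2normD_sqr (f - g) ((- t)%:C *: h)) (l2norm_sqr ((- t)%:C *: h)).
  rewrite !(rdotZr (- t)) (rdotZl (- t)) -(l2norm_sqr h).
  have -> : l2norm (f - g) ^+ 2 + 2 * (- t * rdot (f - g) h) + - t * (- t * l2norm h ^+ 2)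
      = l2norm (f - g) ^+ 2 - (rdot (f - g) h) ^+ 2 / l2norm h ^+ 2 by rewrite /t; field.
  rewrite lerDl oppr_ge0 => le0; apply/eqP; rewrite -sqrf_eq0 eq_le sqr_ge0 andbT.
  by rewrite -(pmulr_lle0 _ (_ : 0 < (l2norm h ^+ 2)^-1)) ?invr_gt0 ?exprn_gt0 // mulrC.
move=> h Lh; rewrite dot_rdot (key h Lh).
have -> : rdot ('i *: (f - g)) h = rdot (f - g) ((- 'i) *: h).
  rewrite /rdot dotZl dotZr; congr (complex.Re (_ * _)).
  by apply/eqP; rewrite eq_complex /= !oppr0 opprK !eqxx.
by rewrite (key _ (subspaceZ _ Ll Lh)) oppr0.
Qed.

(** A minimising sequence for the distance to L is Cauchy by the parallelogram law,
    since the midpoint of two of its terms lies in L. *)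
Lemma projection_exists L f : closed_subspace L ->
  exists g, L g /\ orth L (f - g).
Proof.
move=> [Ll Lc].
pose D := [set l2norm (f - h) ^+ 2 | h in L].
have D0 : D (l2norm (f - 0) ^+ 2) by exists 0 => //; case: Ll.
have lbD : has_inf D.
  by split; [exists (l2norm (f - 0) ^+ 2)|exists 0 => _ [h _ <-]; exact: sqr_ge0].
(* the slack for which the parallelogram law gives increments of norm at most
   2^-n: twice the sum of two slacks is at most (2^-n)^2 *)
pose c n : R := (2^-1 ^+ n) ^+ 2 / 4.
have c0 n : 0 < c n by rewrite divr_gt0// exprn_gt0// exprn_gt0// invr_gt0.
have ex n : exists h, L h /\ l2norm (f - h) ^+ 2 < inf D + c n.
  by have [_ [h Lh <-] hlt] := inf_adherent (c0 n) lbD; exists h.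
have [u uP] := choice ex.
have infle h : L h -> inf D <= l2norm (f - h) ^+ 2.
  by move=> Lh; apply: ge_inf; [case: lbD|exists h].
have fast n : l2norm (u n.+1 - u n) <= 2^-1 ^+ n.
  have [Ln un] := uP n; have [Ln1 un1] := uP n.+1.
  rewrite -(ler_pXn2r (isT : (0 < 2)%N)) ?nnegrE ?l2norm_ge0 ?exprn_ge0 ?invr_ge0//.
  have := parallelogram (f - u n) (f - u n.+1).
  have -> : f - u n - (f - u n.+1) = u n.+1 - u n by rewrite opprB addrC addrA subrK.
  pose m := 2^-1%:C *: (u n + u n.+1).
  have Lm : L m by apply: subspaceZ => //; exact: subspaceD.
  have -> : f - u n + (f - u n.+1) = 2%:C *: (f - m).
    rewrite scalerBr scalerA -rmorphM divff// rmorph1 scale1r.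
    have -> : (2%:C : R[i]) = 1 + 1 by rewrite rmorphD rmorph1.
    by rewrite scalerDl scale1r addrACA opprD.
  rewrite l2normZ exprMn ger0_norm// => eqn.
  have := infle m Lm.
  have cc : c n.+1 <= c n.
    rewrite /c ler_pM2r// ?invr_gt0// ler_pXn2r ?nnegrE ?exprn_ge0 ?invr_ge0// exprS.
    by rewrite ler_piMl// ?exprn_ge0 ?invr_ge0// invf_le1// ler1n.
  have ce : 4 * c n = (2^-1 ^+ n) ^+ 2 by rewrite /c mulrC divfK.
  by rewrite -ce; move: eqn un un1 cc; set A := l2norm _ ^+ 2;
    set B := l2norm _ ^+ 2; set C := l2norm _ ^+ 2; set E := l2norm _ ^+ 2; lra.
have [g ug] := L2_complete fast.
have Lg : L g by apply: Lc ug => n; have [] := uP n.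
exists g; split => //; apply: dist_min_orth => // h Lh.
(* the limit g attains the infimum, because the square root of the slack is
   at most 2^-n *)
have e0 : 2^-1 ^+ n @[n --> \oo] --> (0 : R).
  by apply: cvg_expr; rewrite ger0_norm// invf_lt1// ltr1n.
have cv : l2norm (f - h) + (2^-1 ^+ n + l2norm (u n - g)) @[n --> \oo] --> l2norm (f - h).
  rewrite -[X in _ --> X]addr0; apply: cvgD; first exact: cvg_cst.
  by rewrite -[X in _ --> X]addr0; apply: cvgD.
apply: (ler_cvg_to (cvg_cst _) cv); apply: nearW => n.
apply: le_trans (l2norm_triangle _ (u n) _) _; rewrite addrA lerD2r.
have [Ln un] := uP n.
rewrite -(ler_pXn2r (isT : (0 < 2)%N)) ?nnegrE ?l2norm_ge0//; last first.
  by rewrite addr_ge0 ?l2norm_ge0// exprn_ge0// invr_ge0.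
have := infle h Lh.
have q0 : 0 <= 2^-1 ^+ n :> R by rewrite exprn_ge0// invr_ge0.
have p0 := mulr_ge0 q0 (l2norm_ge0 (f - h)).
move: un; rewrite sqrrD /c; set A := l2norm _ ^+ 2; set B := l2norm _ ^+ 2.
have := sqr_ge0 (2^-1 ^+ n : R).
by move: p0; rewrite mulrC -mulr_natl; lra.
Qed.

(** Two candidates differ by a vector of L that is orthogonal to L. *)
Lemma orth_proj_uniq L f g : linear_subspace L -> L g -> orth L (f - g) -> orth_proj L f = g.
Proof.
move=> Ll Lg Og; apply: xget_subset1 => // h k [Lh Oh] [Lk Ok].
apply/eqP; rewrite -subr_eq0; apply/eqP; apply: (@orth_self _ L); first exact: subspaceB.
have -> : h - k = (f - k) - (f - h) by rewrite opprB [RHS]addrC addrA subrK.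
by have [[_ +] _] := orth_closed L => /(_ (-1) (f - h) (f - k) Oh Ok); rewrite scaleN1r addrC.
Qed.

Lemma orth_projP L f : closed_subspace L ->
  L (orth_proj L f) /\ orth L (f - orth_proj L f).
Proof.
move=> Lc; have [g [Lg Og]] := projection_exists f Lc.
by rewrite (orth_proj_uniq _ Lg Og)//; case: Lc.
Qed.

Lemma orth_proj_in L f : linear_subspace L -> L f -> orth_proj L f = f.
Proof. by move=> Ll Lf; apply: orth_proj_uniq => // g _; rewrite subrr dot0l. Qed.

Lemma orth_proj_orth L f : linear_subspace L -> orth L f -> orth_proj L f = 0.
Proof. by move=> Ll Lf; apply: orth_proj_uniq => //; [case: Ll|rewrite subr0]. Qed.

Lemma orth_proj_ominus K L f : closed_subspace K -> closed_subspace L -> L `<=` K -> K f ->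
  orth_proj (ominus K L) f = f - orth_proj L f.
Proof.
move=> Kc Lc LK Kf; have [Lp Op] := orth_projP f Lc.
apply: orth_proj_uniq; first by case: (ominus_closed L Kc).
  by split => //; apply: subspaceB => //; [case: Kc|exact: LK].
by rewrite opprB addrC subrK => g [_ Og]; apply: dot_eq0C; exact: Og.
Qed.

Lemma ominusK K L : closed_subspace K -> closed_subspace L -> L `<=` K ->
  ominus K (ominus K L) = L.
Proof.
move=> Kc Lc LK; apply/seteqP; split => f.
  move=> [Kf Of]; have [Lp Op] := orth_projP f Lc.
  suff : f - orth_proj L f = 0 by move/eqP; rewrite subr_eq0 => /eqP ->.
  apply: (@orth_self _ (ominus K L)).
    by split => //; apply: subspaceB => //; [case: Kc|exact: LK].
  move=> g Kg; rewrite dotBl Of// sub0r; have [_ Og] := Kg.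
  by rewrite (dot_eq0C (Og _ Lp)) oppr0.
by move=> Lf; split; [exact: LK|move=> g [_ Og]; apply: dot_eq0C; exact: Og].
Qed.

Lemma iso_lincomb K T a f g : isometry_on K T -> K f -> K g -> T (a *: f + g) = a *: T f + T g.
Proof. by move=> [_ + _]; exact. Qed.

Lemma isoD K T f g : isometry_on K T -> K f -> K g -> T (f + g) = T f + T g.
Proof. by move=> Ti Kf Kg; rewrite -[f]scale1r (iso_lincomb _ Ti)// !scale1r. Qed.

Lemma isoB K T f g : isometry_on K T -> K f -> K g -> T (f - g) = T f - T g.
Proof.
by move=> Ti Kf Kg; rewrite addrC -scaleN1r (iso_lincomb _ Ti)// scaleN1r addrC.
Qed.

Lemma iso0 K T : linear_subspace K -> isometry_on K T -> T 0 = 0.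
Proof. by move=> [K0 _] Ti; rewrite -[X in T X](subrr 0) (isoB Ti)// subrr. Qed.

Lemma iso_norm K T f : isometry_on K T -> K f -> l2norm (T f) = l2norm f.
Proof. by move=> [_ _ Td] Kf; rewrite /l2norm Td. Qed.

Lemma iso_dist K T f g : linear_subspace K -> isometry_on K T -> K f -> K g ->
  l2norm (T f - T g) = l2norm (f - g).
Proof. by move=> Kl Ti Kf Kg; rewrite -(isoB Ti)// (iso_norm Ti)//; exact: subspaceB. Qed.

Lemma iso_inj K T f g : linear_subspace K -> isometry_on K T -> K f -> K g -> T f = T g -> f = g.
Proof.
move=> Kl Ti Kf Kg Tfg; apply/eqP; rewrite -subr_eq0; apply/eqP; apply: l2norm_eq0.
by rewrite -(iso_dist Kl Ti)// Tfg subrr l2norm0.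
Qed.

(** Extracts the rate of convergence that [L2_complete] asks for. *)
Lemma fast_subsequence (u : nat -> H) f : l2norm (u n - f) @[n --> \oo] --> (0 : R) ->
  exists s : nat -> nat, forall k, l2norm (u (s k) - f) <= 2^-1 * 2^-1 ^+ k.
Proof.
move=> uf.
suff ex k : exists n, l2norm (u n - f) <= 2^-1 * 2^-1 ^+ k.
  by have [s sP] := choice ex; exists s.
have e0 : 0 < 2^-1 * 2^-1 ^+ k :> R by rewrite mulr_gt0// ?exprn_gt0// invr_gt0.
have /cvgr0Pnorm_le /(_ _ e0) [N _ /(_ N (leqnn N))/= Nk] := uf.
by exists N; move: Nk; rewrite ger0_norm// l2norm_ge0.
Qed.

(** An isometry reflects the Cauchy property, so a limit of images is the image of
    a limit. *)
Lemma iso_image_closed K T : closed_subspace K -> isometry_on K T -> closed_subspace (T @` K).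
Proof.
move=> [Kl Kc] Ti; split; first split.
- by exists 0; [case: Kl|exact: iso0 Ti].
- move=> a _ _ [f Kf <-] [g Kg <-]; exists (a *: f + g); last exact: (iso_lincomb _ Ti).
  by case: Kl => _; exact.
move=> u f TKu uf; have [s sP] := fast_subsequence uf.
have [v vP] : exists v : nat -> H, forall k, K (v k) /\ T (v k) = u (s k).
  have ex k : exists g, K g /\ T g = u (s k) by have [g Kg Tg] := TKu (s k); exists g.
  by have [v vP] := choice ex; exists v.
have fast n : l2norm (v n.+1 - v n) <= 2^-1 ^+ n.
  have [Kv Tv] := vP n; have [Kv1 Tv1] := vP n.+1.
  rewrite -(iso_dist Kl Ti)// Tv Tv1; apply: le_trans (l2norm_triangle _ f _) _.
  rewrite (l2normBC f); apply: le_trans (lerD (sP _) (sP _)) _.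
  have q0 : 0 <= 2^-1 ^+ n :> R by rewrite exprn_ge0// invr_ge0.
  by rewrite exprS; move: q0; set q := _ ^+ n; lra.
have [g vg] := L2_complete fast.
have Kg : K g by apply: Kc vg => n; have [] := vP n.
exists g => //; apply/eqP; rewrite -subr_eq0; apply/eqP; apply: l2norm_eq0.
apply/eqP; rewrite eq_le l2norm_ge0 andbT.
have e0 : 2^-1 * 2^-1 ^+ n @[n --> \oo] --> (0 : R).
  have h1 : `|2^-1 : R| < 1 by rewrite ger0_norm// invf_lt1// ltr1n.
  exact: (@cvg_geometric R 2^-1 2^-1 h1).
have cv : l2norm (v n - g) + 2^-1 * 2^-1 ^+ n @[n --> \oo] --> (0 : R).
  by rewrite -[X in _ --> X]addr0; apply: cvgD.
apply: (ler_cvg_to (cvg_cst _) cv); apply: nearW => n.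
have [Kv Tv] := vP n.
apply: le_trans (l2norm_triangle _ (u (s n)) _) _; apply: lerD; last exact: sP.
by rewrite -Tv (iso_dist Kl Ti)// l2normBC.
Qed.

Lemma adj_uniq T f g : (forall h, dot (T h) f = dot h g) -> adj T f = g.
Proof.
move=> Tg; apply: xget_subset1 => // h k Hh Hk.
apply/eqP; rewrite -subr_eq0; apply/eqP; apply: dot_self_eq0.
by rewrite dotBr -Hh -Hk subrr.
Qed.

End Projection.

(** * Shifts and half-line subspaces *)

Section Translation.
Variable R : realType.
Local Notation mu := (@lebesgue_measure R).
Local Notation H := (L2 R).

Lemma measurable_translation (t : R) :
  measurable_fun [set: measurableTypeR R] (fun x : R => x + t : measurableTypeR R).
Proof. by apply: measurable_funD => //; exact: measurable_cst. Qed.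

(** Lebesgue measure is determined by the lengths of half-open intervals. *)
Lemma lebesgue_measure_translation (t : R) (A : set (measurableTypeR R)) : measurable A ->
  pushforward mu (fun x : R => x + t : measurableTypeR R) A = mu A.
Proof.
have mt := measurable_translation t.
move=> mA; apply/esym/lebesgue_measure_unique => //= _ [[a b]] _ <-.
rewrite /pushforward.
have -> : (fun x : R => x + t : measurableTypeR R) @^-1` `]a, b] = `]a - t, b - t]%classic.
  by apply/seteqP; split => x /=; rewrite !in_itv/= ltrBlDr lerBrDr.
rewrite !lebesgue_measure_itv/= !lte_fin ltrD2r.
by case: ifP => // _; rewrite -!EFinB; congr EFin; ring.
Qed.

(** Integrability is not assumed: the positive and negative parts of f are treated
    separately, by the change of variables for nonnegative functions. *)
Lemma integral_preserving (phi : measurableTypeR R -> measurableTypeR R) (f : R -> \bar R) :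
  measurable_fun [set: measurableTypeR R] phi ->
  (forall A, measurable A -> pushforward mu phi A = mu A) ->
  measurable_fun [set: measurableTypeR R] f ->
  (\int[mu]_x f (phi x) = \int[mu]_x f x)%E.
Proof.
move=> mphi pres mf.
have ge0 (g : R -> \bar R) : measurable_fun [set: measurableTypeR R] g ->
    (forall x, 0 <= g x)%E -> (\int[mu]_x g (phi x) = \int[mu]_x g x)%E.
  move=> mg g0.
  have -> : (\int[mu]_x g x)%E = (\int[pushforward mu phi]_x g x)%E.
    by apply: eq_measure_integral => A mA _; exact/esym/pres.
  by rewrite ge0_integral_pushforward// preimage_setT.
rewrite integralE [RHS]integralE; congr (_ - _)%E.
  rewrite -[RHS]ge0; last by move=> x; exact: funepos_ge0.
    by apply: eq_integral => x _; rewrite !funeposE.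
  exact: measurable_funepos.
rewrite -[RHS]ge0; last by move=> x; exact: funeneg_ge0.
  by apply: eq_integral => x _; rewrite !funenegE.
exact: measurable_funeneg.
Qed.

Lemma integral_translation (t : R) (f : R -> \bar R) :
  measurable_fun [set: measurableTypeR R] f ->
  (\int[mu]_x f (x + t)%R = \int[mu]_x f x)%E.
Proof.
apply: (@integral_preserving (fun x : R => x + t)); first exact: measurable_translation.
exact: lebesgue_measure_translation.
Qed.

Lemma integral_reflection (f : R -> \bar R) : measurable_fun [set: measurableTypeR R] f ->
  (\int[mu]_x f (- x)%R = \int[mu]_x f x)%E.
Proof.
apply: (@integral_preserving (fun x : R => - x)); first exact: oppr_measurable.
exact: lebesgue_measureN.
Qed.

Lemma ae_translation (t : R) (P : R -> Prop) :
  (\forall x \ae mu, P x) -> \forall x \ae mu, P (x + t).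
Proof.
move=> [N [mN N0 PN]].
exists ((fun x : R => x + t : measurableTypeR R) @^-1` N); split.
- by rewrite -[X in measurable X]setTI; exact: (measurable_translation t).
- by rewrite -[RHS]N0 -(lebesgue_measure_translation t mN).
- by move=> x Px; exact: PN.
Qed.

Lemma cmeasurable_translation (t : R) u : cmeasurable u -> cmeasurable (fun x : R => u (x + t)).
Proof.
move=> [ur ui]; have mt := measurable_translation t; split.
- exact: (measurableT_comp ur mt).
- exact: (measurableT_comp ui mt).
Qed.

Lemma energy_translation (t : R) u : cmeasurable u -> energy (fun x => u (x + t)) = energy u.
Proof.
move=> mu_; apply: (@integral_translation t (fun x => (abs2 (u x))%:E)).
by apply/measurable_EFinP; exact: measurable_abs2.
Qed.

Lemma cintegral_translation (t : R) u : cmeasurable u ->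
  cintegral setT (fun x => u (x + t)) = cintegral setT u.
Proof.
move=> [ur ui]; rewrite /cintegral /Rintegral; congr (fine _ +i* fine _).
  by apply: (@integral_translation t (fun x => (complex.Re (u x))%:E)); exact/measurable_EFinP.
by apply: (@integral_translation t (fun x => (complex.Im (u x))%:E)); exact/measurable_EFinP.
Qed.

Lemma l2fun_translation (t : R) (u : R -> R[i]) :
  u \in @l2fun R -> (fun x : R => u (x + t)) \in @l2fun R.
Proof.
move=> /l2funP[mu_ ul]; apply: energy_lty_l2fun; first exact: cmeasurable_translation.
by rewrite energy_translation.
Qed.

Lemma L2shiftE (t : R) (f : H) : \forall x \ae mu, L2shift t f x = f (x + t).
Proof. by apply: toL2E; apply: l2fun_translation; exact: L2_l2fun. Qed.

Lemma L2shift_lincomb t (a : R[i]) (f g : H) :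
  L2shift t (a *: f + g) = a *: L2shift t f + L2shift t g.
Proof.
apply/L2_eqP.
have h1 := L2shiftE t (a *: f + g); have h2 := ae_translation t (L2_lincombE a f g).
have h3 := L2_lincombE a (L2shift t f) (L2shift t g).
have h4 : \forall x \ae mu, L2shift t (a *: f + g) x = a * f (x + t) + g (x + t).
  by apply: aeS2 h1 h2 => x -> ->.
have h5 : \forall x \ae mu, (a *: L2shift t f + L2shift t g : H) x = a * f (x + t) + g (x + t).
  by apply: aeS3 h3 (L2shiftE t f) (L2shiftE t g) => x -> -> ->.
by apply: aeS2 h4 h5 => x -> ->.
Qed.

Lemma cmeasurable_dot (f g : H) : cmeasurable (fun x => f x * conjc (g x)).
Proof.
by apply: cmeasurableM; [|apply: cmeasurable_conj]; exact: L2_cmeasurable.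
Qed.

Lemma L2shift_dot t (f g : H) : dot (L2shift t f) (L2shift t g) = dot f g.
Proof.
rewrite /dot -[RHS](cintegral_translation t); last exact: cmeasurable_dot.
apply: ae_cintegral => //; first exact: cmeasurable_dot.
  exact: (cmeasurable_translation t (cmeasurable_dot f g)).
by apply: aeS2 (L2shiftE t f) (L2shiftE t g) => x -> ->.
Qed.

Lemma L2shiftD s t (f : H) : L2shift s (L2shift t f) = L2shift (s + t) f.
Proof.
apply/L2_eqP; apply: aeS3 (L2shiftE s (L2shift t f)) (ae_translation s (L2shiftE t f))
  (L2shiftE (s + t) f) => x -> -> ->.
by rewrite addrA.
Qed.

Lemma L2shift0 (f : H) : L2shift 0 f = f.
Proof. by apply/L2_eqP; apply: aeS (L2shiftE 0 f) => x ->; rewrite addr0. Qed.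

Lemma L2shiftK t : cancel (@L2shift R t) (L2shift (- t)).
Proof. by move=> f; rewrite L2shiftD addNr L2shift0. Qed.

Lemma L2shiftNK t : cancel (@L2shift R (- t)) (L2shift t).
Proof. by move=> f; rewrite L2shiftD subrr L2shift0. Qed.

Lemma L2shift_adj t (f g : H) : dot (L2shift t f) g = dot f (L2shift (- t) g).
Proof. by rewrite -[g in LHS](L2shiftNK t) L2shift_dot. Qed.

Lemma L2shift_unitary t : unitary_on setT (@L2shift R t).
Proof.
split; last by move=> g _; exists (L2shift (- t) g) => //; exact: L2shiftNK.
by split => // [a f g _ _|f g _ _]; [exact: L2shift_lincomb|exact: L2shift_dot].
Qed.

Lemma Hsupp_closed (t : R) : closed_subspace (@Hsupp R t).
Proof.
have sub : linear_subspace (@Hsupp R t).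
  split; first by apply: aeS (@L2_0E R) => x ->.
  move=> a f g ft gt; apply: aeS3 (L2_lincombE a f g) ft gt => x -> fx gx xt.
  by rewrite fx// gx// mulr0 addr0.
split => // u f ut uf.
(* the part of f to the left of - t is bounded in norm by u n - f *)
pose v := (fun x : R => if x < - t then f x else 0).
have mv : cmeasurable v.
  have [fr fi] := L2_cmeasurable f.
  have E (k : R -> R) : measurable_fun [set: measurableTypeR R] k ->
      measurable_fun [set: measurableTypeR R] (fun x => if x < - t then k x else 0).
    move=> mk; apply: measurable_fun_ifT => //.
    by apply: measurable_fun_ltr => //; exact: measurable_cst.
  split.
    by under eq_fun do rewrite (fun_if (@complex.Re R)); exact: E.
  by under eq_fun do rewrite (fun_if (@complex.Im R)); exact: E.
have vle n : (energy v <= ((l2norm (u n - f)) ^+ 2)%:E)%E.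
  rewrite -l2norm_energy; apply: ae_ge0_le_integral => //.
  - by move=> x _; rewrite lee_fin abs2_ge0.
  - by apply/measurable_EFinP; exact: measurable_abs2.
  - by move=> x _; rewrite lee_fin abs2_ge0.
  - by apply/measurable_EFinP; apply: measurable_abs2; exact: L2_cmeasurable.
  - apply: aeS2 (L2_subE (u n) f) (ut n) => x -> ux _; rewrite lee_fin /v.
    case: ifPn => [xt|_]; first by rewrite ux// sub0r /abs2; case: (f x) => a b /=; rewrite !sqrrN.
    by rewrite {1}/abs2 /= expr0n addr0 abs2_ge0.
have v0 : energy v = 0%E.
  apply/eqP; rewrite eq_le energy_ge0 andbT.
  have c0 : ((l2norm (u n - f)) ^+ 2)%:E @[n --> \oo] --> 0%E.
    apply: cvg_EFin; first exact: nearW.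
    rewrite -(mulr0 (0 : R)); under eq_cvg do rewrite /= expr2.
    by apply: cvgM.
  rewrite -(cvg_lim _ c0)//; apply: lime_ge; first by apply/cvg_ex; exists 0%E.
  exact: nearW.
by apply: aeS (energy_eq0 mv v0) => x; rewrite /v => + xt; rewrite xt.
Qed.

Lemma HsuppS s t : s <= t -> @Hsupp R s `<=` Hsupp t.
Proof. by move=> st f; apply: aeS => x fx xt; apply: fx; apply: lt_le_trans xt _; rewrite lerN2. Qed.

Lemma Hsupp_shift s t (f : H) : Hsupp s f -> Hsupp (s + t) (L2shift t f).
Proof.
move=> fs; apply: aeS2 (L2shiftE t f) (ae_translation t fs) => x -> fx xst.
by apply: fx; rewrite -ltrBrDr -opprD.
Qed.

End Translation.

(** * Restrictions and interval indicators *)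

Section Density.
Variable R : realType.
Local Notation mu := (@lebesgue_measure R).
Local Notation H := (L2 R).

Lemma cmeasurable_real (k : R -> R) : measurable_fun [set: measurableTypeR R] k ->
  cmeasurable (fun x => (k x)%:C).
Proof. by move=> mk; split => //=; exact: measurable_cst. Qed.

Definition restr (D : set (measurableTypeR R)) (u : R -> R[i]) : R -> R[i] :=
  fun x => (\1_D x : R)%:C * u x.

Lemma measurable_indicT (D : set (measurableTypeR R)) : measurable D ->
  measurable_fun [set: measurableTypeR R] (\1_D : R -> R).
Proof. by move=> mD; exact: measurable_indic. Qed.

Lemma cmeasurable_restr D u : measurable D -> cmeasurable u -> cmeasurable (restr D u).
Proof.
by move=> mD mu_; apply: cmeasurableM => //; apply: cmeasurable_real; exact: measurable_indicT.
Qed.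

Lemma abs2_real (a : R) z : abs2 (a%:C * z) = a ^+ 2 * abs2 z.
Proof. by case: z => b c; rewrite /abs2 /=; ring. Qed.

Lemma indic_sqr (D : set (measurableTypeR R)) x : (\1_D x : R) ^+ 2 = \1_D x.
Proof. by rewrite indicE; case: (_ \in _); rewrite ?expr1n ?expr0n. Qed.

Lemma abs2_restr D u x : abs2 (restr D u x) = \1_D x * abs2 (u x).
Proof. by rewrite abs2_real indic_sqr. Qed.

Lemma restr_in (D : set (measurableTypeR R)) u x : D x -> restr D u x = u x.
Proof. by move=> Dx; rewrite /restr indicE mem_set// mul1r. Qed.

Lemma restr_out (D : set (measurableTypeR R)) u x : ~ D x -> restr D u x = 0.
Proof. by move=> Dx; rewrite /restr indicE memNset// mul0r. Qed.

Lemma energy_le u v : cmeasurable u -> cmeasurable v ->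
  (\forall x \ae mu, abs2 (u x) <= abs2 (v x)) -> (energy u <= energy v)%E.
Proof.
move=> mu_ mv uv; apply: ae_ge0_le_integral => //.
- by move=> x _; rewrite lee_fin abs2_ge0.
- by apply/measurable_EFinP; exact: measurable_abs2.
- by move=> x _; rewrite lee_fin abs2_ge0.
- by apply/measurable_EFinP; exact: measurable_abs2.
- by apply: aeS uv => x uv _; rewrite lee_fin.
Qed.

Lemma l2fun_restr D (u : R -> R[i]) : measurable D -> u \in @l2fun R -> restr D u \in @l2fun R.
Proof.
move=> mD /l2funP[mu_ ul]; apply: energy_lty_l2fun; first exact: cmeasurable_restr.
apply: le_lt_trans ul; apply: energy_le => //; first exact: cmeasurable_restr.
by apply: aeW => x; rewrite abs2_restr ler_piMl ?abs2_ge0.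
Qed.

Lemma restrE D (f : H) : measurable D -> \forall x \ae mu, toL2 (restr D f) x = restr D f x.
Proof. by move=> mD; apply: toL2E; apply: l2fun_restr => //; exact: L2_l2fun. Qed.

(** The part of f to the left of t and the functions supported in [t, +oo) have
    disjoint supports. *)
Lemma orth_proj_Hsupp (t : R) (f : H) :
  orth_proj (Hsupp (- t)) f = toL2 (restr `[t, +oo[ f).
Proof.
have mD : measurable (`[t, +oo[%classic : set (measurableTypeR R)) by exact: measurable_itv.
apply: orth_proj_uniq; first by case: (Hsupp_closed (- t)).
  apply: aeS (restrE f mD) => x -> xt; apply: restr_out.
  by rewrite /= in_itv/= andbT; apply/negP; rewrite -ltNge -[t]opprK.
move=> g gt; rewrite /dot.
rewrite (@ae_cintegral _ _ _ (fun=> 0))//.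
- by rewrite /cintegral /= !Rintegral_cst//= ?mul0r.
- exact: cmeasurable_dot.
- apply: aeS3 (L2_subE f (toL2 (restr `[t, +oo[ f))) (restrE f mD) gt => x -> -> gx.
  have [xt|xt] := ltP x t; first by rewrite gx ?opprK// conjc0 mulr0.
  by rewrite restr_in ?subrr ?mul0r//= in_itv/= xt.
Qed.

(** Dominated convergence gives the limit along the integers; the norm of the tail
    is nonincreasing in t. *)
Lemma tail_cvg0 (f : H) :
  l2norm (orth_proj (Hsupp (- t)) f) @[t --> +oo] --> (0 : R).
Proof.
have mD t : measurable (`[t, +oo[%classic : set (measurableTypeR R)) by exact: measurable_itv.
have mf := L2_cmeasurable f.
pose F (n : nat) x := (abs2 (restr `[n%:R, +oo[ f x))%:E.
have en (t : R) : ((l2norm (orth_proj (Hsupp (- t)) f)) ^+ 2)%:E = energy (restr `[t, +oo[ f).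
  rewrite orth_proj_Hsupp -l2norm_energy; apply: energy_ae; last exact: restrE.
    exact: L2_cmeasurable.
  exact: cmeasurable_restr.
have lim : (\int[mu]_x F n x)%E @[n --> \oo] --> 0%E.
  have [|||||_ _] := @dominated_convergence _ _ _ mu setT measurableT F (cst 0%E)
    (fun x => (abs2 (f x))%:E).
  - by move=> n; apply/measurable_EFinP; apply: measurable_abs2; exact: cmeasurable_restr.
  - exact: measurable_cst.
  - apply: aeW => x _; apply: cvg_near_cst.
    near=> n; rewrite /F restr_out ?/abs2 /= ?expr0n ?addr0//.
    rewrite in_itv/= andbT; apply/negP; rewrite -ltNge.
    by near: n; exact: nbhs_infty_gtr.
  - apply/integrableP; split; first by apply/measurable_EFinP; exact: measurable_abs2.
    under eq_integral do rewrite gee0_abs ?lee_fin ?abs2_ge0//.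
    by have /l2funP[] := L2_l2fun f.
  - apply: aeW => x n _; rewrite gee0_abs ?lee_fin ?abs2_ge0// abs2_restr.
    by rewrite ler_piMl ?abs2_ge0.
  by rewrite integral_cst// mul0e.
apply/cvgr0Pnorm_lt => e e0.
have e20 : 0 < e ^+ 2 by rewrite exprn_gt0.
have [N _ HN] : \forall n \near \oo, (\int[mu]_x F n x < (e ^+ 2)%:E)%E.
  by move/(_ _ (@open_ereal_lt' R 0 (e ^+ 2)%:E e20)): lim.
near=> t.
have tN : N%:R <= t by near: t; exact: nbhs_pinfty_ge.
rewrite ger0_norm ?l2norm_ge0// -(ltr_pXn2r (isT : (0 < 2)%N)) ?nnegrE ?l2norm_ge0 ?ltW//.
rewrite -lte_fin en; apply: le_lt_trans (HN N (leqnn N)).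
apply: energy_le; try exact: cmeasurable_restr.
apply: aeW => x; rewrite !abs2_restr ler_wpM2r ?abs2_ge0//.
rewrite !indicE; have [xt|//] := boolP (x \in `[t, +oo[%classic).
rewrite (_ : (x \in _) = true)//; apply/mem_set; move/set_mem: xt => /=.
by rewrite !in_itv/= !andbT; exact: le_trans.
Unshelve. all: by end_near. Qed.

(** On a set of finite measure |k| <= 1 + k^2 is integrable. *)
Lemma Lfun2_integrable_on (k : R -> R) (D : set (measurableTypeR R)) :
  k \in Lfun mu 2%:E -> measurable D -> (mu D < +oo)%E -> mu.-integrable D (EFin \o k).
Proof.
move=> /Lfun2P[mk ki] mD fD; apply/integrableP; split.
  by apply/measurable_EFinP; exact: measurable_funTS.
apply: (@le_lt_trans _ _ (\int[mu]_(x in D) (1 + (k x ^+ 2)%:E))%E).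
  apply: ge0_le_integral => //.
  - by apply/measurable_EFinP; apply: measurable_funTS; exact: measurableT_comp.
  - by apply: emeasurable_funD => //; apply/measurable_EFinP;
      apply: measurable_funTS; exact: measurable_funX.
  - move=> x _; rewrite -EFinD lee_fin.
    rewrite -[k x ^+ 2]real_normK ?num_real//.
    by have := sqr_ge0 (`|k x| - 1); rewrite sqrrB1; have := normr_ge0 (k x); nra.
rewrite ge0_integralD//; last 2 first.
- by move=> x _; rewrite lee_fin sqr_ge0.
- by apply/measurable_EFinP; apply: measurable_funTS; exact: measurable_funX.
rewrite integral_cst// mul1e lte_add_pinfty//.
apply: le_lt_trans ki; apply: ge0_subset_integral => //.
- by apply/measurable_EFinP; exact: measurable_funX.
- by move=> x _; rewrite lee_fin sqr_ge0.
Qed.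

Lemma Lfun2_integrable_itv (k : R -> R) (a b : R) :
  k \in Lfun mu 2%:E -> mu.-integrable `[a, b] (EFin \o k).
Proof.
move=> kL; apply: Lfun2_integrable_on => //.
by rewrite lebesgue_measure_itv/=; case: ifP => _; rewrite -?EFinB ltry.
Qed.

(** By Lebesgue differentiation k is almost everywhere the derivative of its
    indefinite integrals, which are all 0. *)
Lemma interval_integrals_eq0 (k : R -> R) : k \in Lfun mu 2%:E ->
  (forall a b, \int[mu]_(x in `[a, b]) k x = 0) -> \forall x \ae mu, k x = 0.
Proof.
move=> kL k0; have /Lfun2P[mk ki] := kL.
have lk : locally_integrable setT k.
  split => //; first exact: openT.
  move=> K _ cK; have mK : measurable (K : set (measurableTypeR R)).
    exact: (compact_measurable cK).
  by have /integrableP[] := Lfun2_integrable_on kL mK (compact_finite_measure cK).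
(* the indefinite integral from - n is only differentiated to the right of
   - n, so all n are needed to reach every x *)
pose F (n : nat) (y : R) : R :=
  \int[mu]_(t in [set` Interval (BLeft (- n%:R)) (BRight y)]) k t.
have : \forall x \ae mu, forall n : nat, - n%:R < x -> derivable (F n) x 1 /\ derive1 (F n) x = k x.
  apply: ae_foralln => n.
  have := @FTC1 R k (BLeft (- n%:R)).
  have ikn y : mu.-integrable `[- n%:R, y] (EFin \o k).
    exact: Lfun2_integrable_itv.
  by move=> /(_ ikn lk); apply: aeS => y Fy ny; apply: Fy; rewrite ?bnd_simp ?lte_fin ?ltW.
apply: aeS => x; have [n xn] : exists n : nat, - n%:R < x.
  exists (Num.truncn `|x|).+1; rewrite ltrNl; apply: le_lt_trans (ler_norm _) _.
  by rewrite normrN truncnS_gt.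
move=> /(_ n xn)[_ <-].
rewrite (_ : F n = cst 0); first exact: derive1_cst.
by apply/funext => y; exact: k0.
Qed.

Definition itv_indic (a b : R) : H := toL2 (fun x => (\1_`[a, b] x : R)%:C).

Lemma l2fun_itv (a b : R) : (fun x => (\1_`[a, b] x : R)%:C) \in @l2fun R.
Proof.
have mD : measurable (`[a, b]%classic : set (measurableTypeR R)) by exact: measurable_itv.
apply: energy_lty_l2fun; first by apply: cmeasurable_real; exact: measurable_indicT.
rewrite /energy; under eq_integral do rewrite /abs2 /= expr0n addr0 indic_sqr.
rewrite integral_indic//= setIT lebesgue_measure_itv/=.
by case: ifP => _; rewrite -?EFinB ltry.
Qed.

Lemma itv_indicE a b : \forall x \ae mu, itv_indic a b x = (\1_`[a, b] x : R)%:C.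
Proof. by apply: toL2E; exact: l2fun_itv. Qed.

Lemma dot_itv (h : H) a b : dot h (itv_indic a b) = cintegral `[a, b] h.
Proof.
have mD : measurable (`[a, b]%classic : set (measurableTypeR R)) by exact: measurable_itv.
have mh := L2_cmeasurable h.
rewrite /dot (@ae_cintegral _ _ _ (fun x => (\1_`[a, b] x : R)%:C * h x))//; last 3 first.
- exact: cmeasurable_dot.
- exact: cmeasurable_restr.
- by apply: aeS (itv_indicE a b) => x ->; rewrite conjc_real mulrC.
rewrite /cintegral; congr (_ +i* _); rewrite [RHS]Rintegral_mkcond; apply: eq_Rintegral => x _.
  by rewrite patchE indicE; case: (_ \in _); case: (h x) => c d /=; rewrite ?mul1r ?mul0r ?subr0 ?addr0.
by rewrite patchE indicE; case: (_ \in _); case: (h x) => c d /=; rewrite ?mul1r ?mul0r ?subr0 ?addr0.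
Qed.

(** The indicators of bounded intervals span a dense subspace; this is the form in
    which density is used, for closed subspaces containing them. *)
Lemma intervals_total (h : H) : (forall a b, dot h (itv_indic a b) = 0) -> h = 0.
Proof.
move=> h0; have /andP[hr hi] := L2_l2fun h.
have r0 : \forall x \ae mu, complex.Re (h x) = 0.
  by apply: interval_integrals_eq0 => // a b; have := h0 a b; rewrite dot_itv => -[].
have i0 : \forall x \ae mu, complex.Im (h x) = 0.
  by apply: interval_integrals_eq0 => // a b; have := h0 a b; rewrite dot_itv => -[].
apply/L2_eqP; apply: aeS3 (@L2_0E R) r0 i0 => x ->.
by case: (h x) => a b /= -> ->.
Qed.

End Density.

(** * Strong continuity of the shift group *)

Section StrongContinuity.
Variable R : realType.
Local Notation mu := (@lebesgue_measure R).
Local Notation H := (L2 R).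

Lemma l2normZc (a : R[i]) (f : H) : l2norm (a *: f) = Normc.normc a * l2norm f.
Proof.
have n0 : 0 <= Normc.normc a by case: a => x y; exact: sqrtr_ge0.
apply/eqP; rewrite -(@eqrXn2 _ 2)// ?mulr_ge0 ?l2norm_ge0//.
rewrite exprMn !l2norm_sqr /rdot dotZl dotZr mulrA.
have -> : a * conjc a = (Normc.normc a ^+ 2)%:C.
  case: a n0 => x y _ /=; rewrite sqr_sqrtr ?addr_ge0 ?sqr_ge0//.
  by simpc; rewrite -!expr2; congr (_ +i* _); ring.
by rewrite cReM /= mul0r subr0.
Qed.

Lemma l2norm_cvgD (T : Type) (F : set_system T) (FF : Filter F) (u v : T -> H) :
  l2norm (u x) @[x --> F] --> (0 : R) -> l2norm (v x) @[x --> F] --> (0 : R) ->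
  l2norm (u x + v x) @[x --> F] --> (0 : R).
Proof.
move=> u0 v0.
have uv0 : l2norm (u x) + l2norm (v x) @[x --> F] --> (0 : R).
  by rewrite -(addr0 (0 : R)); apply: cvgD.
apply: (squeeze_cvgr _ (cvg_cst 0) uv0); apply: nearW => x.
by rewrite l2norm_ge0 l2normD.
Qed.

(** The indicators of [a, b] and of its translate by t agree at the points whose
    distances to a and b exceed |t|. *)
Lemma itv_shift_energy (a b t : R) :
  l2norm (L2shift t (itv_indic a b) - itv_indic a b) ^+ 2 <= 4 * `|t|.
Proof.
rewrite -lee_fin -l2norm_energy.
pose u (x : R) : R[i] := (\1_`[a, b] x : R)%:C.
have mu_ : cmeasurable u.
  apply: cmeasurable_real; apply: measurable_indicT; exact: measurable_itv.
have -> : energy (L2shift t (itv_indic a b) - itv_indic a b : H) =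
    energy (fun x => u (x + t) - u x).
  apply: energy_ae; first exact: L2_cmeasurable.
    by apply: cmeasurableB => //; exact: cmeasurable_translation.
  have h1 := L2_subE (L2shift t (itv_indic a b)) (itv_indic a b).
  have h2 : \forall x \ae mu, L2shift t (itv_indic a b) x = u (x + t).
    by apply: aeS2 (L2shiftE t (itv_indic a b)) (ae_translation t (itv_indicE a b)) => x ->.
  by apply: aeS3 h1 h2 (itv_indicE a b) => x -> -> ->.
(* the two indicators differ only near the end points, on I a and I b *)
pose I (c : R) : set (measurableTypeR R) := `[c - `|t|, c + `|t|]%classic.
have mI c : measurable (I c) by exact: measurable_itv.
have muI c : (\int[mu]_x (\1_(I c) x)%:E)%E = (2 * `|t|)%:E.
  rewrite integral_indic//= setIT /I lebesgue_measure_itv/= lte_fin.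
  case: ltP => [_|le]; first by rewrite -EFinB; congr EFin; ring.
  have -> : `|t| = 0 by apply/eqP; rewrite eq_le normr_ge0 andbT; lra.
  by rewrite mulr0.
apply: (@le_trans _ _ (\int[mu]_x ((\1_(I a) x)%:E + (\1_(I b) x)%:E))%E); last first.
  rewrite ge0_integralD//=; last 2 first.
  - by apply/measurable_EFinP; exact: measurable_indicT.
  - by apply/measurable_EFinP; exact: measurable_indicT.
  by rewrite !muI -EFinD lee_fin; lra.
apply: ge0_le_integral => //.
- by move=> x _; rewrite lee_fin abs2_ge0.
- apply/measurable_EFinP; apply: measurable_abs2; apply: cmeasurableB => //.
  exact: cmeasurable_translation.
- by apply: emeasurable_funD; apply/measurable_EFinP; exact: measurable_indicT.
move=> x _; rewrite -EFinD lee_fin /u -rmorphB /abs2 /= expr0n addr0 !indicE.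
have sq1 (p q : bool) : (p%:R - q%:R) ^+ 2 <= 1 :> R.
  by case: p; case: q; rewrite ?subrr ?subr0 ?sub0r ?sqrrN ?expr0n ?expr1n.
have [xa|xa] := boolP (x \in I a); first by apply: le_trans (sq1 _ _) _; rewrite lerDl.
have [xb|xb] := boolP (x \in I b); first by apply: le_trans (sq1 _ _) _; rewrite lerDr.
have out c : x \notin I c -> `|t| < `|x - c|.
  rewrite notin_setE /I /= in_itv/= => /negP; rewrite negb_and -!ltNge.
  by move=> /orP[h|h]; rewrite ltr_normr; apply/orP; [right|left]; lra.
have tb := ler_norm t; have tNb : - t <= `|t| by rewrite -normrN ler_norm.
have -> : (x + t \in `[a, b]%classic) = (x \in `[a, b]%classic).
  have := out _ xa; have := out _ xb; rewrite !ltr_normr => /orP[] hb /orP[] ha;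
  by apply/idP/idP; rewrite !inE /= !in_itv/= => /andP[h1 h2]; apply/andP; split; lra.
by rewrite subrr expr0n addr0.
Qed.

(** The vectors with this property form a closed subspace, the shifts being
    isometric, and the subspace contains the indicators of bounded intervals. *)
Lemma L2shift_cvg0 (f : H) : l2norm (L2shift t f - f) @[t --> (0 : R)] --> (0 : R).
Proof.
(* the subspace of vectors with a continuous orbit *)
pose D := [set g : H | l2norm (L2shift t g - g) @[t --> (0 : R)] --> (0 : R)].
have Dl : linear_subspace D.
  split.
    have E t : L2shift t (0 : H) = 0.
      by have := L2shift_lincomb t (-1) (0 : H) 0; rewrite scaler0 addr0 scaleN1r addNr.
    rewrite /D /= (_ : (fun t => _) = fun=> 0); first exact: cvg_cst.
    by apply/funext => t; rewrite E subrr l2norm0.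
  move=> a g h gD hD.
  have lim : l2norm (a *: (L2shift t g - g) + (L2shift t h - h)) @[t --> (0 : R)] --> (0 : R).
    apply: l2norm_cvgD => //.
    have lim : Normc.normc a * l2norm (L2shift t g - g) @[t --> (0 : R)] --> (0 : R).
      have := cvgMl_tmp (a := Normc.normc a) gD; rewrite mulr0; exact.
    by apply: cvg_trans lim; apply: near_eq_cvg; apply: nearW => t; rewrite l2normZc.
  rewrite /D /=; apply: cvg_trans lim; apply: near_eq_cvg; apply: nearW => t /=.
  by rewrite L2shift_lincomb opprD addrACA -scalerBr.
have Dc : closed_subspace D.
  split => // u g uD ug; apply/cvgr0Pnorm_le => e e0.
  have e3 : 0 < e / 3 by rewrite divr_gt0.
  have /cvgr0Pnorm_le /(_ _ e3) [N _ /(_ N (leqnn N))/= uN] := ug.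
  rewrite ger0_norm ?l2norm_ge0// in uN.
  have /cvgr0Pnorm_le /(_ _ e3) := uD N.
  apply: filterS => t; rewrite !ger0_norm ?l2norm_ge0// => ut.
  have -> : L2shift t g - g = (L2shift t g - L2shift t (u N)) +
      ((L2shift t (u N) - u N) + (u N - g)) by rewrite !addrA !subrK.
  apply: le_trans (l2normD _ _) _; apply: le_trans (lerD (lexx _) (l2normD _ _)) _.
  have [iso _] := @L2shift_unitary R t.
  rewrite (iso_dist (setT_closed R).1 iso)// (l2normBC g).
  by lra.
have oD g : orth D g -> g = 0.
  move=> gD; apply: intervals_total => a b; apply: gD.
  rewrite /D /=; apply/cvgr0Pnorm_le => e e0.
  have e4 : 0 < e ^+ 2 / 4 by rewrite divr_gt0// exprn_gt0.
  have := @cvg_id _ (nbhs (0 : R)) => /cvgr0Pnorm_le /(_ _ e4).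
  apply: filterS => t te; rewrite ger0_norm ?l2norm_ge0//.
  rewrite -(ler_pXn2r (isT : (0 < 2)%N)) ?nnegrE ?l2norm_ge0 ?(ltW e0)//.
  apply: le_trans (itv_shift_energy _ _ _) _.
  by rewrite mulrC -ler_pdivlMr.
have [g [Dg og]] := projection_exists f Dc.
by have /eqP := oD _ og; rewrite subr_eq0 => /eqP ->.
Qed.

Lemma L2shift_continuous (f : H) (s : R) :
  l2norm (L2shift t f - L2shift s f) @[t --> s] --> (0 : R).
Proof.
have E t : l2norm (L2shift t f - L2shift s f) = l2norm (L2shift (t - s) f - f).
  have [iso _] := @L2shift_unitary R s.
  rewrite -[RHS](iso_norm iso)//; congr l2norm.
  by rewrite (isoB iso)// L2shiftD (addrC s) subrK.
have lim : l2norm (L2shift (t - s) f - f) @[t --> s] --> (0 : R).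
  apply: (cvg_comp (fun t => t - s) _ _ (@L2shift_cvg0 f)).
  have h : (t - s) @[t --> s] --> s - s by apply: cvgB; [exact: cvg_id|exact: cvg_cst].
  by rewrite subrr in h.
by apply: cvg_trans lim; apply: near_eq_cvg; apply: nearW => t; rewrite E.
Qed.

End StrongContinuity.

(** * Exponentially damped integrals *)

Section Kernels.
Variable R : realType.
Local Notation mu := (@lebesgue_measure R).

Lemma FTC2_everywhere (f F : R -> R) (a b : R) : a < b -> continuous f ->
  (forall x : R, is_derive x 1 F (f x)) ->
  (\int[mu]_(x in `[a, b]) (f x)%:E = (F b - F a)%:E)%E.
Proof.
move=> ab cf dF.
have cF : continuous F.
  by move=> x; apply/differentiable_continuous/derivable1_diffP; exact: ex_derive.
rewrite (@continuous_FTC2 _ f F)//.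
- exact: continuous_subspaceT.
- split=> [x _||]; first exact: ex_derive.
    by apply: cvg_at_right_filter; exact: cF.
  by apply: cvg_at_left_filter; exact: cF.
- by move=> x _; rewrite derive1E derive_val.
Qed.

Lemma ge0_FTC2y_everywhere (f F : R -> R) (a l : R) : (forall x, a <= x -> 0 <= f x) ->
  continuous f -> (forall x : R, is_derive x 1 F (f x)) -> F x @[x --> +oo] --> l ->
  (\int[mu]_(x in `[a, +oo[) (f x)%:E = (l - F a)%:E)%E.
Proof.
move=> f0 cf dF Fl.
have cF : continuous F.
  by move=> x; apply/differentiable_continuous/derivable1_diffP; exact: ex_derive.
rewrite (@ge0_continuous_FTC2y _ f F a l)//.
- exact: continuous_subspaceT.
- by apply: cvg_at_right_filter; exact: cF.
- by move=> x _; rewrite derive1E derive_val.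
Qed.

Lemma is_derive_mulK (u x : R) : is_derive x 1 (fun x : R => u * x) u.
Proof.
have H := @is_deriveZ R R^o R^o id u x 1 1 (is_derive_id _ _).
by apply: (is_derive_eq H); rewrite /GRing.scale /= mulr1.
Qed.

Lemma is_derive_sinM (u x : R) : is_derive x 1 (fun x => sin (u * x)) (u * cos (u * x)).
Proof.
have d1 := is_derive_mulK u x.
have := @is_derive1_comp R sin (fun x => u * x) x _ _ (is_derive_sin _) d1.
by rewrite mulrC.
Qed.

Lemma is_derive_cosM (u x : R) : is_derive x 1 (fun x => cos (u * x)) (- (u * sin (u * x))).
Proof.
have d1 := is_derive_mulK u x.
have := @is_derive1_comp R cos (fun x => u * x) x _ _ (is_derive_cos _) d1.
by rewrite mulNr mulrC.
Qed.

Lemma is_derive_expM (u x : R) : is_derive x 1 (fun x => expR (u * x)) (u * expR (u * x)).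
Proof.
have d1 := is_derive_mulK u x.
have := @is_derive1_comp R expR (fun x => u * x) x _ _ (is_derive_expR _) d1.
by rewrite mulrC.
Qed.

Lemma is_derive_atanV (e x : R) : 0 < e ->
  is_derive x 1 (fun x => atan (x / e)) (e / (e ^+ 2 + x ^+ 2)).
Proof.
move=> e0; have d1 : is_derive x 1 (fun x : R => x / e) (e^-1).
  have -> : (fun x : R => x / e) = (fun x => e^-1 * x) by apply/funext => y; rewrite mulrC.
  exact: is_derive_mulK.
have := @is_derive1_comp R atan (fun x => x / e) x _ _ (is_derive1_atan _) d1.
have -> : (1 + (x / e) ^+ 2)^-1 * e^-1 = e / (e ^+ 2 + x ^+ 2); last by [].
have h : e ^+ 2 + x ^+ 2 != 0 by rewrite gt_eqF// ltr_wpDr ?sqr_ge0// exprn_gt0.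
have h1 : 1 + (x / e) ^+ 2 != 0 by rewrite gt_eqF// ltr_wpDr ?sqr_ge0.
by field; rewrite h gt_eqF.
Qed.

Lemma continuous_cosM (u : R) : continuous (fun x : R => cos (u * x)).
Proof.
by move=> x; apply/differentiable_continuous/derivable1_diffP; exact: (@ex_derive _ _ _ _ _ _ _ (is_derive_cosM u x)).
Qed.

Lemma continuous_sinM (u : R) : continuous (fun x : R => sin (u * x)).
Proof.
by move=> x; apply/differentiable_continuous/derivable1_diffP; exact: (@ex_derive _ _ _ _ _ _ _ (is_derive_sinM u x)).
Qed.

Lemma measurable_damping (e : R) :
  measurable_fun [set: measurableTypeR R] (fun x : R => expR (- (e * `|x|))).
Proof.
apply: measurableT_comp => //; apply: measurable_funN; apply: measurable_funM => //.
Qed.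

Lemma continuous_damping (e : R) : continuous (fun x : R => expR (- (e * `|x|))).
Proof.
move=> x; apply: continuous_comp; last exact: continuous_expR.
apply: continuousN; apply: continuousM; first exact: cst_continuous.
exact: norm_continuous.
Qed.

(** With the summand 1 the integrand is nonnegative, so that the fundamental
    theorem of calculus applies on an unbounded interval without integrability;
    the summand is removed in [damped_cos_integral]. *)
Lemma half_line_integral (e u : R) : 0 < e ->
  (\int[mu]_(x in `[0%R, +oo[) (expR (- (e * `|x|)) * (1 + cos (u * x)))%:E =
   (e^-1 + e / (e ^+ 2 + u ^+ 2))%:E)%E.
Proof.
move=> e0.
have h : e ^+ 2 + u ^+ 2 != 0 by rewrite gt_eqF// ltr_wpDr ?sqr_ge0// exprn_gt0.
pose D := e ^+ 2 + u ^+ 2.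
transitivity (\int[mu]_(x in `[0%R, +oo[) (expR (- e * x) * (1 + cos (u * x)))%:E)%E.
  by apply: eq_integral => x; rewrite inE /= in_itv/= andbT => x0; rewrite ger0_norm// mulNr.
(* the antiderivative that tends to 0 at +oo *)
pose F (x : R) : R := expR (- e * x) * (- e^-1 + (u / D * sin (u * x) - e / D * cos (u * x))).
have dF (x : R) : is_derive x 1 F (expR (- e * x) * (1 + cos (u * x))).
  have dg : is_derive x 1 (fun x => - e^-1 + (u / D * sin (u * x) - e / D * cos (u * x)))
      (0 + (u / D * (u * cos (u * x)) - e / D * (- (u * sin (u * x))))).
    have h1 := @is_deriveZ R R^o R^o _ (u / D) x 1 _ (is_derive_sinM u x).
    have h2 := @is_deriveZ R R^o R^o _ (e / D) x 1 _ (is_derive_cosM u x).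
    exact: (is_deriveD (is_derive_cst (- e^-1) x 1) (is_deriveB h1 h2)).
  have := @is_deriveM _ _ _ _ x 1 _ _ (is_derive_expM (- e) x) dg.
  rewrite /GRing.scale /= => dF; apply: (is_derive_eq dF).
  by rewrite /D; field; rewrite h gt_eqF.
have cf : continuous (fun x : R => expR (- e * x) * (1 + cos (u * x))).
  move=> x; apply: (@continuousM R R^o (fun x : R => expR (- e * x)) (fun x => 1 + cos (u * x))).
    by apply: continuous_comp; [exact: mulrl_continuous|exact: continuous_expR].
  by apply: continuousD; [exact: cst_continuous|exact: continuous_cosM].
have e1 : expR (- e * x) @[x --> +oo] --> (0 : R).
  under eq_cvg do rewrite mulNr.
  apply: (@cvg_comp _ _ _ (fun x => e * x) (fun y => expR (- y)) _ _ _ _ (@cvgr_expR R)).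
  exact: gt0_cvgMry.
pose C := e^-1 + (`|u / D| + `|e / D|).
have e2 : C * expR (- e * x) @[x --> +oo] --> (0 : R).
  by rewrite -(mulr0 C); apply: cvgMr.
have Fl : F x @[x --> +oo] --> (0 : R).
  apply/cvgr0Pnorm_le => d d0; have /cvgr0Pnorm_le/(_ _ d0) := e2.
  apply: filterS => x; apply: le_trans.
  rewrite /F !normrM [`|expR _|]ger0_norm ?expR_ge0// mulrC ler_wpM2r ?expR_ge0//.
  apply: le_trans (ler_norm _); rewrite /C.
  apply: le_trans (ler_normD _ _) _; apply: lerD.
    by rewrite normrN ger0_norm// invr_ge0 ltW.
  apply: le_trans (ler_normB _ _) _; rewrite !normrM; apply: lerD.
    by rewrite ler_piMr// ler_norml sin_geN1 sin_le1.
  by rewrite ler_piMr// ler_norml cos_geN1 cos_le1.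
rewrite (ge0_FTC2y_everywhere _ cf dF Fl); last first.
  by move=> x x0; rewrite mulr_ge0 ?expR_ge0//; have := cos_geN1 (u * x); lra.
rewrite /F !mulr0 expR0 sin0 cos0 mulr0 !mulr1; congr EFin; rewrite /D; field.
by rewrite h gt_eqF.
Qed.

Lemma whole_line_integral (e u : R) : 0 < e ->
  (\int[mu]_x (expR (- (e * `|x|)) * (1 + cos (u * x)))%:E =
   (2 * e^-1 + 2 * e / (e ^+ 2 + u ^+ 2))%:E)%E.
Proof.
move=> e0; rewrite ge0_symfun_integralT.
- rewrite (_ : [set x : R | 0 <= x] = `[0, +oo[%classic); last first.
    by apply/seteqP; split => x /=; rewrite in_itv/= andbT.
  by rewrite half_line_integral// -EFinM mulrDr mulrA.
- by move=> x; rewrite mulr_ge0 ?expR_ge0//; have := cos_geN1 (u * x); lra.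
- move=> x; apply: (@continuousM R R^o (fun x : R => expR (- (e * `|x|))) (fun x => 1 + cos (u * x))).
    exact: continuous_damping.
  by apply: continuousD; [exact: cst_continuous|exact: continuous_cosM].
- by move=> x; rewrite /= normrN mulrN cosN.
Qed.

Lemma damping_integral (e : R) : 0 < e ->
  (\int[mu]_x (expR (- (e * `|x|)))%:E = (2 / e)%:E)%E.
Proof.
move=> e0; have := whole_line_integral 0 e0.
under eq_integral do rewrite mul0r cos0 mulrC EFinM.
rewrite ge0_integralZl//=.
- move=> h.
  have : ((2^-1)%:E * (2%:E * (\int[mu]_x (expR (- (e * `|x|)))%:E)) =
     (2^-1)%:E * (2 / e + 2 * e / (e ^+ 2 + 0 ^+ 2))%:E)%E by rewrite -h.
  rewrite muleA -!EFinM mulVf// mul1e => ->; congr EFin; field.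
  by rewrite gt_eqF.
- by apply/measurable_EFinP; exact: measurable_damping.
Qed.

Lemma integrable_damping (e : R) : 0 < e -> mu.-integrable setT (fun x => (expR (- (e * `|x|)))%:E).
Proof.
move=> e0; apply/integrableP; split; first by apply/measurable_EFinP; exact: measurable_damping.
under eq_integral do rewrite gee0_abs ?lee_fin ?expR_ge0//.
by rewrite damping_integral// ltry.
Qed.

Lemma integrable_damped (e C : R) (k : R -> R) : 0 < e ->
  measurable_fun [set: measurableTypeR R] k -> (forall x, `|k x| <= C) ->
  mu.-integrable setT (fun x => (expR (- (e * `|x|)) * k x)%:E).
Proof.
move=> e0 mk kC.
apply: le_integrable (integrableZl measurableT C (integrable_damping e0)) => //.
  by apply/measurable_EFinP; apply: measurable_funM => //; exact: measurable_damping.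
move=> x _; rewrite -EFinM !abse_EFin lee_fin !normrM mulrC ler_wpM2r//.
by apply: le_trans (kC x) _; exact: ler_norm.
Qed.

Lemma damped_cos_integral (e u : R) : 0 < e ->
  (\int[mu]_x (expR (- (e * `|x|)) * cos (u * x))%:E = (2 * e / (e ^+ 2 + u ^+ 2))%:E)%E.
Proof.
move=> e0.
have ic : mu.-integrable setT (fun x => (expR (- (e * `|x|)) * cos (u * x))%:E).
  apply: (@integrable_damped _ 1) => //; first by apply: continuous_measurable_fun; exact: continuous_cosM.
  by move=> x; rewrite ler_norml cos_geN1 cos_le1.
have := whole_line_integral u e0.
under eq_integral do rewrite mulrDr mulr1 EFinD.
rewrite integralD//; last exact: integrable_damping.
rewrite damping_integral//.
case: (integral _ _ _) (integrable_fin_num measurableT ic) => //= r _ [].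
by move=> h; congr EFin; move: h; lra.
Qed.

End Kernels.

(** * The damped sinc kernel *)

Section Multiplier.
Variable R : realType.
Local Notation mu := (@lebesgue_measure R).

(** The Fourier transform of the indicator of [- r, r], except at x = 0. *)
Definition sincR (r x : R) : R := 2 * sin (r * x) / x.

Lemma measurable_sinM (u : R) : measurable_fun [set: measurableTypeR R] (fun x : R => sin (u * x)).
Proof. by apply: continuous_measurable_fun; exact: continuous_sinM. Qed.

Lemma measurable_cosM (u : R) : measurable_fun [set: measurableTypeR R] (fun x : R => cos (u * x)).
Proof. by apply: continuous_measurable_fun; exact: continuous_cosM. Qed.

Lemma measurable_inv : measurable_fun [set: measurableTypeR R] (fun x : R => x^-1).
Proof.
have -> : [set: measurableTypeR R] = [set 0] `|` ~` [set 0] by rewrite setUv.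
have m0 : measurable ([set 0] : set (measurableTypeR R)) by exact: measurable_set1.
apply/measurable_funU => //; first exact: measurableC.
split.
  have h : measurable_fun ([set 0] : set (measurableTypeR R)) (cst (0 : R)).
    exact: measurable_cst.
  by apply: eq_measurable_fun h => x; rewrite inE => ->; rewrite invr0.
apply: open_continuous_measurable_fun.
  by apply: closed_openC; apply: accessible_closed_set1; exact: hausdorff_accessible (@Rhausdorff R).
by move=> x; rewrite inE /= => /eqP x0; exact: inv_continuous.
Qed.

Lemma measurable_sincR (r : R) : measurable_fun [set: measurableTypeR R] (sincR r).
Proof.
apply: measurable_funM; last exact: measurable_inv.
by apply: measurable_funM => //; exact: measurable_sinM.
Qed.

Lemma norm_sin_le (x : R) : `|sin x| <= `|x|.
Proof.
wlog x0 : x / 0 <= x.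
  move=> W; have [/W//|xn] := leP 0 x.
  by rewrite -normrN -sinN -[`|x|]normrN; apply: W; rewrite oppr_ge0 ltW.
have [->|xn0] := eqVneq x 0; first by rewrite sin0.
have xp : 0 < x by rewrite lt_neqAle eq_sym xn0.
have cs : {within `[0, x], continuous (@sin R)}.
  by apply: continuous_subspaceT => y; exact: continuous_sin.
have [c _] := @MVT R sin cos 0 x xp (fun y _ => is_derive_sin y) cs.
rewrite sin0 !subr0 => ->; rewrite normrM ler_piMl// ler_norml.
by rewrite cos_geN1 cos_le1.
Qed.

Lemma sincR_le (r x : R) : `|sincR r x| <= 2 * `|r|.
Proof.
have [->|x0] := eqVneq x 0; first by rewrite /sincR invr0 mulr0 normr0 mulr_ge0.
rewrite /sincR normrM normfV ler_pdivrMr ?normr_gt0// normrM ger0_norm//.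
by rewrite -mulrA ler_pM2l// -normrM norm_sin_le.
Qed.

(** The factor 4 r^2 comes from |sin y| <= |y| and controls the kernel near 0; the
    summand 4 comes from |sin y| <= 1 and gives the decay at infinity. *)
Lemma sincR_bound (r x : R) : sincR r x ^+ 2 <= (4 * r ^+ 2 + 4) * (1 + x ^+ 2)^-1.
Proof.
have p : 0 < 1 + x ^+ 2 by rewrite ltr_pwDl ?sqr_ge0.
rewrite ler_pdivlMr// mulrDr mulr1; apply: lerD.
  have [->|x0] := eqVneq x 0; first by rewrite /sincR invr0 mulr0 expr0n mulr_ge0 ?sqr_ge0.
  rewrite /sincR exprMn exprVn ler_pdivrMr ?exprn_even_gt0//.
  rewrite exprMn -[2 ^+ 2](natrX R 2 2) -mulrA ler_pM2l//.
  rewrite -exprMn -[sin _ ^+ 2]real_normK ?num_real// -[(r * x) ^+ 2]real_normK ?num_real//.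
  by rewrite ler_pXn2r ?nnegrE// norm_sin_le.
have [->|x0] := eqVneq x 0; first by rewrite expr0n mulr0.
by rewrite /sincR -exprMn divfK// exprMn -[2 ^+ 2](natrX R 2 2) ler_piMr.
Qed.

Lemma measurable_cauchy : measurable_fun [set: measurableTypeR R] (fun x : R => (1 + x ^+ 2)^-1).
Proof. by apply: (measurableT_comp measurable_inv); apply: measurable_funD. Qed.

Lemma cauchy_integral : (\int[mu]_x ((1 + x ^+ 2)^-1)%:E = pi%:E)%E.
Proof.
have c0 x : 0 <= (1 + x ^+ 2)^-1 :> R by rewrite invr_ge0 addr_ge0 ?sqr_ge0.
have cc : continuous (fun x : R => (1 + x ^+ 2)^-1).
  move=> x; apply: (@continuousV R R^o (fun x : R => 1 + x ^+ 2)).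
    by rewrite gt_eqF// ltr_pwDl ?sqr_ge0.
  by apply: continuousD; [exact: cst_continuous|exact: exprn_continuous].
rewrite ge0_symfun_integralT//; last by move=> x; rewrite /= sqrrN.
rewrite (_ : [set x : R | 0 <= x] = `[0, +oo[%classic); last first.
  by apply/seteqP; split => x /=; rewrite in_itv/= andbT.
rewrite (ge0_FTC2y_everywhere _ cc (fun x => is_derive1_atan x) (@cvgy_atan R))//.
by rewrite atan0 subr0 -EFinM; congr EFin; field.
Qed.

Lemma sincR_sqr_integral (r : R) :
  (\int[mu]_x (sincR r x ^+ 2)%:E <= ((4 * r ^+ 2 + 4) * pi)%:E)%E.
Proof.
have C0 : 0 <= 4 * r ^+ 2 + 4 :> R by have := sqr_ge0 r; lra.
apply: (@le_trans _ _ (\int[mu]_x ((4 * r ^+ 2 + 4)%:E * ((1 + x ^+ 2)^-1)%:E))%E).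
  apply: ge0_le_integral => //.
  - by move=> x _; rewrite lee_fin sqr_ge0.
  - by apply/measurable_EFinP; apply: measurable_funX; exact: measurable_sincR.
  - apply/measurable_EFinP; apply: measurable_funM => //; exact: measurable_cauchy.
  - by move=> x _; rewrite -EFinM lee_fin sincR_bound.
rewrite ge0_integralZl//.
- by rewrite cauchy_integral.
- by apply/measurable_EFinP; exact: measurable_cauchy.
- by move=> x _; rewrite lee_fin invr_ge0 addr_ge0 ?sqr_ge0.
Qed.

(** The integral over [v - r, v + r] of the Poisson kernel 2 e / (e^2 + s^2); as e
    tends to 0 it tends to 2 pi times the indicator of [- r, r] at v. *)
Definition damped_step (e r v : R) : R := 2 * (atan ((v + r) / e) - atan ((v - r) / e)).

Lemma norm_damped (e x c : R) : `|c| <= 1 ->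
  `|expR (- (e * `|x|)) * c| <= expR (- (e * `|x|)).
Proof. by move=> c1; rewrite normrM ger0_norm ?expR_ge0// ler_piMr// expR_ge0. Qed.

Lemma cos_itv_integral (r v x : R) : 0 < r -> x != 0 ->
  (\int[mu]_(s in `[(v - r)%R, (v + r)%R]) (cos (x * s))%:E = (cos (v * x) * sincR r x)%:E)%E.
Proof.
move=> r0 x0.
have dF (s : R) : is_derive s 1 (fun s => x^-1 * sin (x * s)) (cos (x * s)).
  have h := @is_deriveZ R R^o R^o _ (x^-1) s 1 _ (is_derive_sinM x s).
  by apply: (is_derive_eq h); rewrite /GRing.scale /= mulKf.
rewrite (FTC2_everywhere _ (@continuous_cosM R x) dF); last lra.
congr EFin; rewrite /sincR (mulrDr x v r) (mulrDr x v (- r)) (mulrN x r) !sinD cosN sinN.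
by rewrite (mulrC x r) (mulrC x v); field.
Qed.

(** For x <> 0 the factor cos (v x) sincR r x is the integral of cos (x s) over
    s in [v - r, v + r]. Exchanging the integrals leaves [damped_cos_integral],
    twice the derivative of atan (s / e). *)
Lemma damped_step_integral (e r v : R) : 0 < e -> 0 < r ->
  (\int[mu]_x (expR (- (e * `|x|)) * (cos (v * x) * sincR r x))%:E = (damped_step e r v)%:E)%E.
Proof.
move=> e0 r0; pose D : set (measurableTypeR R) := `[v - r, v + r]%classic.
have mD : measurable D by exact: measurable_itv.
have muD : (\int[mu]_y (\1_D y)%:E = (2 * r)%:E)%E.
  rewrite integral_indic//= setIT /D lebesgue_measure_itv/= lte_fin ltrD2l gt0_cp//.
  by rewrite -EFinB; congr EFin; ring.
pose f (p : measurableTypeR R * measurableTypeR R) : \bar R :=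
  (\1_D p.2 * (expR (- (e * `|p.1|)) * cos (p.1 * p.2)))%:E.
have mf : measurable_fun setT f.
  apply/measurable_EFinP; apply: measurable_funM.
    by apply: (measurableT_comp (measurable_indicT mD)).
  apply: measurable_funM.
    by apply: (measurableT_comp (measurable_damping e)).
  apply: (measurableT_comp (f := @cos R)); last exact: measurable_funM.
  by apply: continuous_measurable_fun; exact: continuous_cos.
have fi : (mu \x mu)%E.-integrable setT f.
  apply: (@integrable12ltyP _ _ _ _ R mu mu f mf).2.
  apply: (@le_lt_trans _ _ (\int[mu]_x ((2 * r)%:E * (expR (- (e * `|x|)))%:E))%E).
    apply: ge0_le_integral => //.
    - by move=> x _; exact: integral_ge0.
    - by have := measurable_fun_fubini_tonelli_F (m2 := mu) (abse \o f)
        (measurableT_comp (@abse_measurable R setT) mf) (fun _ => abse_ge0 _).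
    - by apply/measurable_EFinP; apply: measurable_funM => //; exact: measurable_damping.
    - move=> x _; apply: (@le_trans _ _ (\int[mu]_y ((expR (- (e * `|x|)))%:E * (\1_D y)%:E))%E).
        apply: ge0_le_integral => //.
        + by have := measurableT_comp (@abse_measurable R setT)
            (measurableT_comp mf (@pair1_measurable _ _ _ _ x)).
        + by apply/measurable_EFinP; apply: measurable_funM => //; exact: measurable_indicT.
        + move=> y _; rewrite abse_EFin -EFinM lee_fin normrM ger0_norm// mulrC ler_wpM2r//.
          by apply: norm_damped => //; rewrite ler_norml cos_geN1 cos_le1.
      rewrite ge0_integralZl//=; last by apply/measurable_EFinP; exact: measurable_indicT.
      by rewrite muD muleC.
  rewrite ge0_integralZl//=.
  - by rewrite damping_integral// -EFinM ltry.
  - by apply/measurable_EFinP; exact: measurable_damping.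
  - by rewrite lee_fin mulr_ge0 ?ltW.
have := Fubini fi.
have -> : (\int[mu]_x \int[mu]_y f (x, y) =
    \int[mu]_x (expR (- (e * `|x|)) * (cos (v * x) * sincR r x))%:E)%E.
  apply: ae_eq_integral => //.
  - by have := measurable_fubini_F fi.
  - apply/measurable_EFinP; apply: measurable_funM; first exact: measurable_damping.
    by apply: measurable_funM; [exact: measurable_cosM|exact: measurable_sincR].
  (* the value of sincR at 0 is not the limit there, so the two integrands agree
     only off the null set containing 0 *)
  - exists [set 0]; split; [exact: measurable_set1|exact: lebesgue_measure_set1|].
    move=> x /= xP; apply/eqP; apply: contrapT => /negP x0; apply: xP => _.
    rewrite EFinM -(cos_itv_integral v r0 x0) -integralZl//; last first.
      apply: continuous_compact_integrable; first exact: segment_compact.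
      by apply: continuous_subspaceT; exact: continuous_cosM.
    rewrite [RHS]integral_mkcond; apply: eq_integral => y _; rewrite /f /= patchE indicE.
    by case: (_ \in _); rewrite ?mul1r ?mul0r ?mule0.
have -> : (\int[mu]_y \int[mu]_x f (x, y) = (damped_step e r v)%:E)%E.
  transitivity (\int[mu]_(y in D) (2 * (e / (e ^+ 2 + y ^+ 2)))%:E)%E.
    rewrite [RHS]integral_mkcond; apply: eq_integral => y _; rewrite patchE /f /= indicE.
    case: (_ \in _); last by under eq_integral do rewrite mul0r; rewrite integral0.
    under eq_integral do rewrite mul1r mulrC (mulrC _ y) mulrC.
    by rewrite damped_cos_integral// mulrA.
  have dF (y : R) : is_derive y 1 (fun y => 2 * atan (y / e)) (2 * (e / (e ^+ 2 + y ^+ 2))).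
    exact: (@is_deriveZ R R^o R^o _ 2 y 1 _ (is_derive_atanV y e0)).
  have cf : continuous (fun y : R => 2 * (e / (e ^+ 2 + y ^+ 2))).
    move=> y; apply: (@continuousM R R^o (fun=> 2) (fun y : R => e / (e ^+ 2 + y ^+ 2))).
      exact: cst_continuous.
    apply: (@continuousM R R^o (fun=> e) (fun y : R => (e ^+ 2 + y ^+ 2)^-1)).
      exact: cst_continuous.
    apply: (@continuousV R R^o (fun y : R => e ^+ 2 + y ^+ 2)).
      by rewrite gt_eqF// ltr_wpDr ?sqr_ge0// exprn_gt0.
    by apply: continuousD; [exact: cst_continuous|exact: exprn_continuous].
  rewrite (FTC2_everywhere _ cf dF); last lra.
  by rewrite /damped_step mulrBr.
by [].
Qed.

Lemma damped_odd_integral (e r v : R) : 0 < e ->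
  (\int[mu]_x (expR (- (e * `|x|)) * (sin (v * x) * sincR r x))%:E = 0)%E.
Proof.
move=> e0; pose g (x : R) : \bar R := (expR (- (e * `|x|)) * (sin (v * x) * sincR r x))%:E.
have mg : measurable_fun [set: measurableTypeR R] g.
  apply/measurable_EFinP; apply: measurable_funM; first exact: measurable_damping.
  by apply: measurable_funM; [exact: measurable_sinM|exact: measurable_sincR].
have gN x : g (- x) = (- g x)%E.
  rewrite /g -EFinN; congr EFin; rewrite normrN /sincR !mulrN !sinN invrN.
  by ring.
have gi : mu.-integrable setT g.
  apply: (@integrable_damped _ _ (2 * `|r|)) => //.
    by apply: measurable_funM; [exact: measurable_sinM|exact: measurable_sincR].
  move=> x; rewrite normrM -[leRHS]mul1r ler_pM// ?sincR_le// ler_norml.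
  by rewrite sin_geN1 sin_le1.
have h : (\int[mu]_x g x = - \int[mu]_x g x)%E.
  rewrite -{1}(integral_reflection mg); under eq_integral do rewrite gN.
  by rewrite integralN// integrable_add_def.
rewrite -/g; case: (integral _ _ _) (integrable_fin_num measurableT gi) h => //= z _ [] h.
by congr EFin; lra.
Qed.

End Multiplier.

(** * Pairing the truncated Fourier transform with the kernel *)

Section FourierInjectivity.
Variable R : realType.
Local Notation mu := (@lebesgue_measure R).
Local Notation H := (L2 R).
Implicit Types (h : H) (A m r e : R).

Definition unscaled_fourier A h (l : R) : R[i] :=
  cintegral `[- A, A] (fun x => cis (l * x) * h x).

Lemma abs2M (z w : R[i]) : abs2 (z * w) = abs2 z * abs2 w.
Proof. by case: z w => [a b] [c d]; rewrite /abs2 /=; ring. Qed.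

Lemma abs2_cis (x : R) : abs2 (cis x) = 1.
Proof. by rewrite /abs2 /= cos2Dsin2. Qed.

Lemma cisD (x y : R) : cis (x + y) = cis x * cis y.
Proof. by apply/eqP; rewrite eq_complex /= cosD sinD addrC [_ * sin y + _]addrC !eqxx. Qed.

Lemma cmeasurable_cis (l : R) : cmeasurable (fun x : R => cis (l * x)).
Proof. by split; [exact: measurable_cosM|exact: measurable_sinM]. Qed.

Lemma le_abs2_Re (z : R[i]) : complex.Re z ^+ 2 <= abs2 z.
Proof. by rewrite lerDl sqr_ge0. Qed.

(** Integrability is not assumed: Tonelli's theorem is applied to the positive and
    negative parts. *)
Lemma measurable_integral_param (K : measurableTypeR R * measurableTypeR R -> \bar R) :
  measurable_fun setT K -> measurable_fun [set: measurableTypeR R] (fun l => \int[mu]_x K (l, x))%E.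
Proof.
move=> mK.
have E : (fun l => \int[mu]_x K (l, x))%E =
    (fun l => \int[mu]_x K^\+ (l, x) - \int[mu]_x K^\- (l, x))%E.
  apply/funext => l; rewrite integralE; congr (_ - _)%E; apply: eq_integral => x _.
    by rewrite !funeposE.
  by rewrite !funenegE.
rewrite E; apply: emeasurable_funB.
  apply: (measurable_fun_fubini_tonelli_F (m2 := mu) (K^\+)%E (measurable_funepos mK)) => x.
  exact: funepos_ge0.
apply: (measurable_fun_fubini_tonelli_F (m2 := mu) (K^\-)%E (measurable_funeneg mK)) => x.
exact: funeneg_ge0.
Qed.

Lemma measurable_fun_fst (k : R -> R) : measurable_fun [set: measurableTypeR R] k ->
  measurable_fun setT (fun p : measurableTypeR R * measurableTypeR R => k p.1).
Proof. by move=> mk; exact: (measurableT_comp mk). Qed.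

Lemma measurable_fun_snd (k : R -> R) : measurable_fun [set: measurableTypeR R] k ->
  measurable_fun setT (fun p : measurableTypeR R * measurableTypeR R => k p.2).
Proof. by move=> mk; exact: (measurableT_comp mk). Qed.

Lemma measurable_cosR : measurable_fun [set: measurableTypeR R] (@cos R).
Proof. by apply: continuous_measurable_fun; exact: continuous_cos. Qed.

Lemma measurable_sinR : measurable_fun [set: measurableTypeR R] (@sin R).
Proof. by apply: continuous_measurable_fun; exact: continuous_sin. Qed.

Lemma measurable_itv_cc (a b : R) : measurable (`[a, b]%classic : set (measurableTypeR R)).
Proof. exact: measurable_itv. Qed.

Lemma measurable_cos_mul (k : R -> R) : measurable_fun [set: measurableTypeR R] k ->
  measurable_fun setT (fun p : measurableTypeR R * measurableTypeR R => cos (p.1 * k p.2)).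
Proof.
move=> mk; apply: (measurableT_comp measurable_cosR).
by apply: measurable_funM => //; exact: measurable_fun_snd.
Qed.

Lemma measurable_sin_mul (k : R -> R) : measurable_fun [set: measurableTypeR R] k ->
  measurable_fun setT (fun p : measurableTypeR R * measurableTypeR R => sin (p.1 * k p.2)).
Proof.
move=> mk; apply: (measurableT_comp measurable_sinR).
by apply: measurable_funM => //; exact: measurable_fun_snd.
Qed.

Lemma measurable_Rintegral_param (D : set (measurableTypeR R)) (k : R -> R -> R) : measurable D ->
  measurable_fun setT (fun p : measurableTypeR R * measurableTypeR R => k p.1 p.2) ->
  measurable_fun [set: measurableTypeR R] (fun l => \int[mu]_(x in D) k l x).
Proof.
move=> mD mk.
pose K (p : measurableTypeR R * measurableTypeR R) : \bar R := (\1_D p.2 * k p.1 p.2)%:E.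
have mK : measurable_fun setT K.
  apply/measurable_EFinP; apply: measurable_funM => //.
  by apply: measurable_fun_snd; exact: measurable_indicT.
have -> : (fun l => \int[mu]_(x in D) k l x) = fine \o (fun l => \int[mu]_x K (l, x))%E.
  apply/funext => l; rewrite /= /Rintegral integral_mkcond; congr fine.
  apply: eq_integral => x _; rewrite patchE /K /= indicE.
  by case: (_ \in _); rewrite ?mul1r ?mul0r.
by apply: measurableT_comp => //; exact: measurable_integral_param.
Qed.

Lemma cmeasurable_unscaled_fourier A h : cmeasurable (unscaled_fourier A h).
Proof.
have [hr hi] := L2_cmeasurable h.
have mD := measurable_itv_cc (- A) A.
have mid : measurable_fun [set: measurableTypeR R] (fun x : R => x) by exact: measurable_id.
split.
  apply: (@measurable_Rintegral_param _ (fun l x => complex.Re (cis (l * x) * h x))) => //.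
  under eq_fun do rewrite cReM /=.
  by apply: measurable_funB; apply: measurable_funM;
    [exact: (measurable_cos_mul mid)|exact: (measurable_fun_snd hr)
    |exact: (measurable_sin_mul mid)|exact: (measurable_fun_snd hi)].
apply: (@measurable_Rintegral_param _ (fun l x => complex.Im (cis (l * x) * h x))) => //.
under eq_fun do rewrite cImM /=.
by apply: measurable_funD; apply: measurable_funM;
  [exact: (measurable_cos_mul mid)|exact: (measurable_fun_snd hi)
  |exact: (measurable_sin_mul mid)|exact: (measurable_fun_snd hr)].
Qed.

Lemma cintegrable_fourier A h (l : R) :
  cintegrable `[- A, A] (fun x => cis (l * x) * h x).
Proof.
have [mr mi] := L2_cmeasurable h; have /andP[hr hi] := L2_l2fun h.
have I (k c : R -> R) : k \in Lfun mu 2%:E -> measurable_fun [set: measurableTypeR R] c ->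
    (forall x, `|c x| <= 1) -> mu.-integrable `[- A, A] (EFin \o (fun x => c x * k x)).
  move=> kL mc c1; have mD := measurable_itv_cc (- A) A.
  have /Lfun2P[mk _] := kL.
  apply: le_integrable (Lfun2_integrable_itv (- A) A kL) => //.
    by apply/measurable_EFinP; apply: measurable_funTS; exact: measurable_funM.
  by move=> x _; rewrite /= lee_fin normrM ler_piMl.
have c1 x : `|cos (l * x)| <= 1 by rewrite ler_norml cos_geN1 cos_le1.
have s1 x : `|sin (l * x)| <= 1 by rewrite ler_norml sin_geN1 sin_le1.
have mc := measurable_cosM l; have ms := measurable_sinM l.
have mD := measurable_itv_cc (- A) A.
split.
  have := integrableB_EFin mD (I _ _ hr mc c1) (I _ _ hi ms s1).
  by apply: eq_integrable => // x _; rewrite /= cReM.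
have := integrableD_EFin mD (I _ _ hi mc c1) (I _ _ hr ms s1).
by apply: eq_integrable => // x _; rewrite /= cImM.
Qed.

Lemma cintegralZ (D : set (measurableTypeR R)) (z : R[i]) u : measurable D -> cintegrable D u ->
  cintegral D (fun x => z * u x) = z * cintegral D u.
Proof.
move=> mD ui.
have i0 : cintegrable D (fun=> 0) by split; exact: integrable0.
have c0 : cintegral D (fun=> 0 : R[i]) = 0.
  by apply/eqP; rewrite eq_complex /= !/Rintegral !integral0 !eqxx.
have := cintegral_lincomb z mD ui i0; rewrite c0 addr0 => <-.
by congr cintegral; apply/funext => x; rewrite addr0.
Qed.

(** The exponential factor makes the double integral over l and x absolutely
    convergent. Once the integrals are exchanged, the inner one over l is
    [damped_step_integral] for the real part of h, and vanishes by parity for the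
    imaginary part. *)
Lemma fourier_pairing A h m r e : 0 < e -> 0 < r ->
  (\int[mu]_l (expR (- (e * `|l|)) * (sincR r l *
      complex.Re (cis (l * - m) * unscaled_fourier A h l)))%:E =
   \int[mu]_(x in `[(- A)%R, A]) (complex.Re (h x) * damped_step e r (x - m))%:E)%E.
Proof.
move=> e0 r0.
have [mr mi] := L2_cmeasurable h; have /andP[hr hi] := L2_l2fun h.
pose D : set (measurableTypeR R) := `[- A, A]%classic.
have mD : measurable D := measurable_itv_cc (- A) A.
have mxm : measurable_fun [set: measurableTypeR R] (fun x : R => x - m).
  by apply: measurable_funB => //; exact: measurable_cst.
pose w (l x : R) := complex.Re (cis (l * (x - m)) * h x).
pose f (p : measurableTypeR R * measurableTypeR R) : \bar R :=
  (\1_D p.2 * (expR (- (e * `|p.1|)) * (sincR r p.1 * w p.1 p.2)))%:E.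
have wE l x : w l x = complex.Re (cis (l * - m) * (cis (l * x) * h x)).
  by rewrite /w mulrDr cisD [cis (l * x) * _]mulrC -mulrA.
have mw : measurable_fun setT (fun p : measurableTypeR R * measurableTypeR R => w p.1 p.2).
  rewrite /w; under eq_fun do rewrite cReM /=.
  by apply: measurable_funB; apply: measurable_funM;
    [exact: (measurable_cos_mul mxm)|exact: (measurable_fun_snd mr)
    |exact: (measurable_sin_mul mxm)|exact: (measurable_fun_snd mi)].
have mf : measurable_fun setT f.
  apply/measurable_EFinP; apply: measurable_funM.
    by apply: measurable_fun_snd; exact: measurable_indicT.
  apply: measurable_funM; first exact: (measurable_fun_fst (measurable_damping e)).
  by apply: measurable_funM; [exact: (measurable_fun_fst (measurable_sincR r))|exact: mw].
pose b x := `|complex.Re (h x)| + `|complex.Im (h x)|.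
have b0 x : 0 <= b x by rewrite addr_ge0.
have wb l x : `|w l x| <= b x.
  rewrite /w cReM /=; apply: le_trans (ler_normB _ _) _; rewrite !normrM.
  by apply: lerD; rewrite ler_piMl// ler_norml ?cos_geN1 ?cos_le1 ?sin_geN1 ?sin_le1.
have mb : measurable_fun [set: measurableTypeR R] b.
  by apply: measurable_funD; exact: measurableT_comp.
have bi : mu.-integrable D (EFin \o b).
  apply: integrableD_EFin => //; apply: integrable_norm => //; exact: Lfun2_integrable_itv.
(* f is dominated by the product of the damping factor and of b on [- A, A] *)
have fi : (mu \x mu)%E.-integrable setT f.
  pose C := fine (\int[mu]_(x in D) (b x)%:E)%E.
  have CE : (\int[mu]_(x in D) (b x)%:E)%E = C%:E.
    by rewrite fineK//; exact: (integrable_fin_num mD bi).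
  have C0 : 0 <= C by rewrite fine_ge0// integral_ge0// => x _; rewrite lee_fin.
  apply: (@integrable12ltyP _ _ _ _ R mu mu f mf).2.
  apply: (@le_lt_trans _ _ (\int[mu]_x ((2 * r * C)%:E * (expR (- (e * `|x|)))%:E))%E).
    apply: ge0_le_integral => //.
    - by move=> x _; exact: integral_ge0.
    - by have := measurable_fun_fubini_tonelli_F (m2 := mu) (abse \o f)
        (measurableT_comp (@abse_measurable R setT) mf) (fun _ => abse_ge0 _).
    - by apply/measurable_EFinP; apply: measurable_funM => //; exact: measurable_damping.
    - move=> l _.
      apply: (@le_trans _ _ (\int[mu]_x ((expR (- (e * `|l|)) * (2 * r))%:E * (\1_D x * b x)%:E))%E).
        apply: ge0_le_integral => //.
        + by have := measurableT_comp (@abse_measurable R setT)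
            (measurableT_comp mf (@pair1_measurable _ _ _ _ l)).
        + apply/measurable_EFinP; apply: measurable_funM => //.
          by apply: measurable_funM => //; exact: measurable_indicT.
        + move=> x _; rewrite abse_EFin -EFinM lee_fin normrM ger0_norm//.
          rewrite [leRHS]mulrCA; apply: ler_wpM2l => //.
          rewrite normrM (ger0_norm (expR_ge0 _)) -[X in _ <= X]mulrA; apply: ler_wpM2l; first exact: expR_ge0.
          rewrite normrM; apply: ler_pM => //.
          by apply: le_trans (sincR_le _ _) _; rewrite gtr0_norm.
      rewrite ge0_integralZl//=; last 3 first.
      + apply/measurable_EFinP; apply: measurable_funM => //; exact: measurable_indicT.
      + by move=> x _; rewrite lee_fin mulr_ge0.
      + by rewrite lee_fin !mulr_ge0 ?expR_ge0// ltW.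
      have -> : (\int[mu]_x (\1_D x * b x)%:E = C%:E)%E.
        rewrite -CE [RHS]integral_mkcond; apply: eq_integral => x _; rewrite patchE indicE.
        by case: (_ \in _); rewrite ?mul1r ?mul0r.
      by rewrite -!EFinM lee_fin le_eqVlt; apply/orP; left; apply/eqP; ring.
  rewrite ge0_integralZl//=.
  - by rewrite damping_integral// -EFinM ltry.
  - by apply/measurable_EFinP; exact: measurable_damping.
  - by rewrite lee_fin !mulr_ge0// ltW.
have := Fubini fi.
have -> : (\int[mu]_l \int[mu]_x f (l, x) = \int[mu]_l (expR (- (e * `|l|)) * (sincR r l *
      complex.Re (cis (l * - m) * unscaled_fourier A h l)))%:E)%E.
  apply: eq_integral => l _.
  have ci := cintegrable_fourier A h l.
  rewrite /unscaled_fourier -cintegralZ//= mulrA [RHS]EFinM.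
  have wi : mu.-integrable D (EFin \o (w l)).
    have [ciR ciI] := ci.
    have := integrableB_EFin mD (integrableZl_EFin (cos (l * - m)) mD ciR)
      (integrableZl_EFin (sin (l * - m)) mD ciI).
    by apply: eq_integrable => // x _; rewrite /= wE cReM.
  have -> : \int[mu]_(x in D) complex.Re (cis (l * - m) * (cis (l * x) * h x)) =
      \int[mu]_(x in D) w l x.
    by apply: eq_Rintegral => x _; rewrite wE.
  rewrite /Rintegral fineK; last exact: (integrable_fin_num mD wi).
  rewrite -integralZl// [RHS]integral_mkcond; apply: eq_integral => x _.
  rewrite patchE /f /= indicE.
  by case: (_ \in _); rewrite ?mul1r ?mul0r ?mulrA.
move=> ->; rewrite [RHS]integral_mkcond; apply: eq_integral => x _.
rewrite patchE /f /= indicE.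
case: (_ \in _); last by under eq_integral do rewrite mul0r; rewrite integral0.
have i1 : mu.-integrable setT (fun l => (expR (- (e * `|l|)) * (cos ((x - m) * l) * sincR r l))%:E).
  apply: (@integrable_damped _ _ (2 * `|r|)) => //.
    by apply: measurable_funM; [exact: measurable_cosM|exact: measurable_sincR].
  move=> l; rewrite normrM -[leRHS]mul1r ler_pM// ?sincR_le// ler_norml.
  by rewrite cos_geN1 cos_le1.
have i2 : mu.-integrable setT (fun l => (expR (- (e * `|l|)) * (sin ((x - m) * l) * sincR r l))%:E).
  apply: (@integrable_damped _ _ (2 * `|r|)) => //.
    by apply: measurable_funM; [exact: measurable_sinM|exact: measurable_sincR].
  move=> l; rewrite normrM -[leRHS]mul1r ler_pM// ?sincR_le// ler_norml.
  by rewrite sin_geN1 sin_le1.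
transitivity (\int[mu]_l ((complex.Re (h x))%:E * (expR (- (e * `|l|)) * (cos ((x - m) * l) * sincR r l))%:E
   - (complex.Im (h x))%:E * (expR (- (e * `|l|)) * (sin ((x - m) * l) * sincR r l))%:E))%E.
  apply: eq_integral => l _; rewrite -!EFinM -EFinB mul1r /w cReM /=; congr EFin.
  by rewrite (mulrC l); ring.
rewrite integralB//; try exact: integrableZl.
rewrite !integralZl// damped_step_integral// damped_odd_integral// mule0 sube0.
by rewrite -EFinM.
Qed.

End FourierInjectivity.

(** * Injectivity of the Fourier transform *)

Section FourierUniqueness.
Variable R : realType.
Local Notation mu := (@lebesgue_measure R).
Local Notation H := (L2 R).
Implicit Types (h : H) (A m r e d : R).

(** With s the kernel and p the paired function, |s p| <= d s^2 + p^2 / d. The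
    damping factor is at most 1, so the bound does not depend on e, which can tend
    to 0 while A and d are kept. *)
Lemma pairing_bound A h m r e d : 0 < e -> 0 < r -> 0 < d ->
  (`|\int[mu]_(x in `[(- A)%R, A]) (complex.Re (h x) * damped_step e r (x - m))%:E| <=
   (d * ((4 * r ^+ 2 + 4) * pi))%:E + d^-1%:E * energy (unscaled_fourier A h))%E.
Proof.
move=> e0 r0 d0; rewrite -fourier_pairing//.
have ma := cmeasurable_unscaled_fourier A h.
pose p l := complex.Re (cis (l * - m) * unscaled_fourier A h l).
have mp : measurable_fun [set: measurableTypeR R] p.
  have mc : cmeasurable (fun l : R => cis (l * - m)).
    by split; under eq_fun do rewrite /= mulrC; [exact: measurable_cosM|exact: measurable_sinM].
  by have [] := cmeasurableM mc ma.
have mG : measurable_fun [set: measurableTypeR R] (fun l => expR (- (e * `|l|)) * (sincR r l * p l)).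
  apply: measurable_funM; first exact: measurable_damping.
  by apply: measurable_funM => //; exact: measurable_sincR.
have pb l : p l ^+ 2 <= abs2 (unscaled_fourier A h l).
  by apply: le_trans (le_abs2_Re _) _; rewrite abs2M abs2_cis mul1r.
apply: le_trans (le_abse_integral _ _ _) _ => //; first exact/measurable_EFinP.
apply: (@le_trans _ _ (\int[mu]_l (d%:E * (sincR r l ^+ 2)%:E +
    d^-1%:E * (abs2 (unscaled_fourier A h l))%:E))%E).
  apply: ge0_le_integral => //.
  - by apply: measurableT_comp => //; exact/measurable_EFinP.
  - apply: emeasurable_funD; apply/measurable_EFinP; apply: measurable_funM => //.
      by apply: measurable_funX; exact: measurable_sincR.
    exact: measurable_abs2.
  move=> l _; rewrite abse_EFin -!EFinM -EFinD lee_fin normrM (ger0_norm (expR_ge0 _)).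
  apply: (@le_trans _ _ `|sincR r l * p l|).
    rewrite ler_piMl// -expR0 ler_expR oppr_le0 mulr_ge0// ltW//.
  have := pb l; set q := p l; set s := sincR r l; set a := abs2 _ => qa.
  apply: (@le_trans _ _ (d * s ^+ 2 + d^-1 * q ^+ 2)); last first.
    by rewrite lerD2l ler_pM2l// invr_gt0.
  rewrite normrM -[s ^+ 2]real_normK ?num_real// -[q ^+ 2]real_normK ?num_real//.
  set x := `|s|; set y := `|q|.
  have x0 : 0 <= x by exact: normr_ge0.
  have y0 : 0 <= y by exact: normr_ge0.
  rewrite -(ler_pM2l d0) mulrDr !mulrA divff ?gt_eqF// mul1r.
  by have := sqr_ge0 (d * x - y); have := mulr_ge0 (mulr_ge0 (ltW d0) x0) y0; nra.
rewrite ge0_integralD//=; last 4 first.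
- by move=> l _; rewrite -EFinM lee_fin mulr_ge0 ?sqr_ge0// ltW.
- apply/measurable_EFinP; apply: measurable_funM => //.
  by apply: measurable_funX; exact: measurable_sincR.
- by move=> l _; rewrite -EFinM lee_fin mulr_ge0 ?abs2_ge0// invr_ge0 ltW.
- by apply/measurable_EFinP; apply: measurable_funM => //; exact: measurable_abs2.
apply: leeD.
  rewrite ge0_integralZl//=; last 3 first.
  - by apply/measurable_EFinP; apply: measurable_funX; exact: measurable_sincR.
  - by move=> l _; rewrite lee_fin sqr_ge0.
  - by rewrite lee_fin ltW.
  by rewrite EFinM; apply: lee_wpmul2l; [rewrite lee_fin ltW|exact: sincR_sqr_integral].
rewrite ge0_integralZl//=.
- by apply/measurable_EFinP; exact: measurable_abs2.
- by move=> l _; rewrite lee_fin abs2_ge0.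
- by rewrite lee_fin invr_ge0 ltW.
Qed.

Lemma cvg_atan_pos (y : R) : 0 < y -> atan (y / n.+1%:R^-1) @[n --> \oo] --> (pi / 2 : R).
Proof.
move=> y0; have h : y * n.+1%:R @[n --> \oo] --> +oo.
  apply/cvgryPge => M; exists (Num.truncn (`|M| / y)).+1 => // n /= nM.
  rewrite mulrC -ler_pdivrMr//; apply: (@le_trans _ _ (`|M| / y)).
    by rewrite ler_pM2r ?invr_gt0// ler_norm.
  apply: le_trans (ltW (truncnS_gt _)) _; rewrite ler_nat.
  exact: leq_trans nM (leqnSn _).
apply: cvg_trans (cvg_comp _ _ h (@cvgy_atan R)); apply: near_eq_cvg; apply: nearW => n /=.
by rewrite invrK.
Qed.

Lemma cvg_atan_neg (y : R) : y < 0 -> atan (y / n.+1%:R^-1) @[n --> \oo] --> (- (pi / 2) : R).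
Proof.
move=> y0; have y0' : 0 < - y by rewrite oppr_gt0.
rewrite (_ : (fun n => _) = (fun n => - atan (- y / n.+1%:R^-1))).
  by apply: cvgN; exact: cvg_atan_pos.
by apply/funext => n; rewrite mulNr atanN opprK.
Qed.

(** At v = r and v = - r the limit is half of the jump, hence the two exclusions. *)
Lemma cvg_damped_step r v : 0 < r -> v != r -> v != - r ->
  damped_step n.+1%:R^-1 r v @[n --> \oo] --> (2 * (pi * \1_`[- r, r] v) : R).
Proof.
move=> r0 vr vNr; apply: cvgMl_tmp.
rewrite indicE; have [vin|vout] := boolP (v \in `[- r, r]%classic).
  move: vin; rewrite inE /= in_itv/= => /andP[h1 h2].
  have -> : pi * true%:R = pi / 2 - - (pi / 2) :> R by rewrite mulr1; lra.
  apply: cvgB; [apply: cvg_atan_pos|apply: cvg_atan_neg].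
    by rewrite -(opprK r) subr_gt0 lt_neqAle eq_sym vNr.
  by rewrite subr_lt0 lt_neqAle vr.
rewrite mulr0; move: vout; rewrite notin_setE /= in_itv/= => /negP.
rewrite negb_and -!ltNge => /orP[h|h].
  rewrite -(subrr (- (pi / 2) : R)); apply: cvgB; apply: cvg_atan_neg; lra.
rewrite -(subrr (pi / 2 : R)); apply: cvgB; apply: cvg_atan_pos; lra.
Qed.

Lemma norm_damped_step e r v : `|damped_step e r v| <= 2 * pi.
Proof.
rewrite /damped_step normrM ger0_norm// ler_pM2l//.
have := atan_ltpi2 ((v + r) / e); have := atan_gtNpi2 ((v + r) / e).
have := atan_ltpi2 ((v - r) / e); have := atan_gtNpi2 ((v - r) / e).
by rewrite ler_norml => *; apply/andP; split; lra.
Qed.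

Lemma measurable_damped_step e r m :
  measurable_fun [set: measurableTypeR R] (fun x : R => damped_step e r (x - m)).
Proof.
have ma (c : R) : measurable_fun [set: measurableTypeR R] (fun x : R => atan ((x - m + c) / e)).
  apply: (measurableT_comp (f := @atan R)).
    by apply: continuous_measurable_fun => x; exact: continuous_atan.
  apply: measurable_funM; last exact: measurable_cst.
  apply: measurable_funD; last exact: measurable_cst.
  by apply: measurable_funB => //; exact: measurable_cst.
by apply: measurable_funM => //; apply: measurable_funB; exact: ma.
Qed.

Lemma pairing_limit A h m r : 0 < r ->
  (\int[mu]_(x in `[(- A)%R, A])
     (complex.Re (h x) * damped_step n.+1%:R^-1 r (x - m))%:E)%E @[n --> \oo] -->
  (\int[mu]_(x in `[(- A)%R, A])
     (complex.Re (h x) * (2 * (pi * \1_`[(- r)%R, r] (x - m))))%:E)%E.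
Proof.
move=> r0; have mD := measurable_itv_cc (- A) A.
have [mr _] := L2_cmeasurable h; have /andP[hr _] := L2_l2fun h.
have mI : measurable_fun [set: measurableTypeR R] (fun x : R => (\1_`[- r, r] (x - m) : R)).
  apply: (measurableT_comp (measurable_indicT (measurable_itv_cc (- r) r))).
  by apply: measurable_funB => //; exact: measurable_cst.
have [|||||_ _ //] := @dominated_convergence _ _ _ mu `[- A, A] mD
  (fun n x => (complex.Re (h x) * damped_step n.+1%:R^-1 r (x - m))%:E)
  (fun x => (complex.Re (h x) * (2 * (pi * \1_`[(- r)%R, r] (x - m))))%:E)
  (fun x => ((2 * pi)%:E * `|complex.Re (h x)|%:E)%E).
- move=> n; apply/measurable_EFinP; apply: measurable_funTS; apply: measurable_funM => //.
  exact: measurable_damped_step.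
- apply/measurable_EFinP; apply: measurable_funTS; apply: measurable_funM => //.
  by apply: measurable_funM => //; exact: measurable_funM.
- have ne (c : R) : \forall x \ae mu, x != c.
    exists [set c]; split; [exact: measurable_set1|exact: lebesgue_measure_set1|].
    by move=> x /= /negP; rewrite negbK => /eqP.
  apply: aeS2 (ne (m + r)) (ne (m - r)) => x x1 x2 _.
  apply: cvg_EFin; first exact: nearW.
  apply: cvgMl_tmp; apply: cvg_damped_step => //.
    by apply: contra x1 => /eqP; rewrite eq_sym => <-; rewrite addrC subrK.
  by apply: contra x2 => /eqP; rewrite eq_sym => <-; rewrite addrC subrK.
- apply: integrableZl => //; apply: integrable_norm => //.
  exact: Lfun2_integrable_itv.
- apply: aeW => x n _; rewrite abse_EFin -EFinM lee_fin normrM mulrC.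
  by rewrite ler_wpM2r// norm_damped_step.
Qed.

(** As e tends to 0, the pairing at the midpoint m and half-length r of [a, b]
    tends to 2 pi times the integral over [a, b]. When the energy is below d^2,
    [pairing_bound] makes it at most d times a constant, and d is arbitrary. *)
Lemma unscaled_fourier_Re_eq0 h :
  energy (unscaled_fourier A h) @[A --> +oo] --> 0%E ->
  \forall x \ae mu, complex.Re (h x) = 0.
Proof.
move=> h0; have /andP[hr _] := L2_l2fun h.
apply: interval_integrals_eq0 => // a b.
have [ab|ba] := ltP a b; last first.
  have : `[a, b] `<=` [set a].
    by move=> x /=; rewrite in_itv/= => /andP[h1 h2]; apply/eqP; rewrite eq_le h1 (le_trans h2).
  by move=> sub; rewrite /Rintegral (integral_Sset1 _ sub).
(* [a, b] is centred at m with half-length r *)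
pose m := (a + b) / 2; pose r := (b - a) / 2.
have r0 : 0 < r by rewrite /r; lra.
pose C := (4 * r ^+ 2 + 4) * pi : R.
have C0 : 0 <= C by rewrite mulr_ge0 ?pi_ge0//; have := sqr_ge0 r; lra.
have key d : 0 < d -> `|2 * pi * \int[mu]_(x in `[a, b]) complex.Re (h x)| <= d * (C + 1).
  move=> d0.
  have d20 : 0 < d ^+ 2 by rewrite exprn_gt0.
  have hd : \forall A \near +oo, (energy (unscaled_fourier A h) < (d ^+ 2)%:E)%E.
    by move/(_ _ (@open_ereal_lt' R 0 (d ^+ 2)%:E d20)): h0.
  near (pinfty_nbhs R) => A.
  have Aen : (energy (unscaled_fourier A h) < (d ^+ 2)%:E)%E by near: A.
  have A1 : `|a| + `|b| <= A by near: A; exact: nbhs_pinfty_ge.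
  have sub : `[a, b] `<=` `[- A, A].
    move=> x /=; rewrite !in_itv/= => /andP[h1 h2].
    have := ler_norm b; have := ler_norm (- a); rewrite normrN.
    by have := normr_ge0 a; have := normr_ge0 b; move=> *; apply/andP; split; lra.
  have lim := @pairing_limit A h m r r0.
  have lime : (\int[mu]_(x in `[(- A)%R, A])
     (complex.Re (h x) * (2 * (pi * \1_`[(- r)%R, r] (x - m))))%:E)%E =
     (2 * pi * \int[mu]_(x in `[a, b]) complex.Re (h x))%:E.
    rewrite EFinM /Rintegral fineK; last first.
      by apply: (integrable_fin_num _ (Lfun2_integrable_itv a b hr)); exact: measurable_itv_cc.
    rewrite -integralZl//; [|exact: Lfun2_integrable_itv].
    rewrite [LHS]integral_mkcond [RHS]integral_mkcond; apply: eq_integral => x _.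
    rewrite !patchE.
    have -> : (\1_`[(- r), r] (x - m) : R) = \1_`[a, b] x.
      rewrite !indicE; congr ((nat_of_bool _)%:R); apply/idP/idP; rewrite !inE /= !in_itv/= /r /m;
      by move=> /andP[h1 h2]; apply/andP; split; lra.
    have [xD|xD] := boolP (x \in `[- A, A]%classic).
      rewrite indicE; case: (x \in `[a, b]%classic).
        by rewrite -EFinM; congr EFin; rewrite mulr1; ring.
      by rewrite !mulr0.
    rewrite ifF//; apply/negbTE; apply: contra xD; rewrite !inE; exact: sub.
  rewrite lime in lim.
  have lima := cvg_abse lim; rewrite abse_EFin in lima.
  have {}lima := lima eventually_filter.
  rewrite -lee_fin -(cvg_lim _ lima)//; apply: lime_le; first by apply/cvg_ex; eexists; exact: lima.
  apply: nearW => n /=.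
  apply: le_trans (@pairing_bound A h m r n.+1%:R^-1 d _ r0 d0) _; first by rewrite invr_gt0.
  rewrite (mulrDr d C 1) mulr1 EFinD; apply: leeD => //.
  apply: (@le_trans _ _ (d^-1%:E * (d ^+ 2)%:E)%E).
    by apply: lee_wpmul2l; [rewrite lee_fin invr_ge0 ltW|exact: ltW].
  by rewrite -EFinM lee_fin expr2 mulKf// gt_eqF.
have z : 2 * pi * \int[mu]_(x in `[a, b]) complex.Re (h x) = 0.
  apply/eqP; rewrite -normr_le0; apply/ler_addgt0Pl => d d0; rewrite addr0.
  have C1 : 0 < C + 1 by lra.
  by have := key (d / (C + 1)); rewrite divfK ?gt_eqF//; apply; rewrite divr_gt0.
have p0 : 2 * pi != 0 :> R by rewrite mulf_neq0 ?gt_eqF ?pi_gt0.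
by move/eqP: z; rewrite mulf_eq0 (negbTE p0) /= => /eqP.
Unshelve. all: by end_near. Qed.

Lemma energyZ (z : R[i]) u : cmeasurable u ->
  energy (fun x => z * u x) = ((abs2 z)%:E * energy u)%E.
Proof.
move=> mu_; rewrite /energy -ge0_integralZl//=.
- by apply: eq_integral => x _; rewrite abs2M EFinM.
- by apply/measurable_EFinP; exact: measurable_abs2.
- by move=> x _; rewrite lee_fin abs2_ge0.
- by rewrite lee_fin abs2_ge0.
Qed.

Lemma unscaled_fourierZ (z : R[i]) A h l :
  unscaled_fourier A (z *: h) l = z * unscaled_fourier A h l.
Proof.
have mD := measurable_itv_cc (- A) A.
rewrite /unscaled_fourier -cintegralZ//; last exact: (cintegrable_fourier A h l).
have mc := cmeasurable_cis l.
apply: ae_cintegral => //.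
- by apply: cmeasurableM => //; exact: L2_cmeasurable.
- apply: cmeasurableM; first exact: cmeasurable_cst.
  by apply: cmeasurableM => //; exact: L2_cmeasurable.
- by apply: aeS (L2_scaleE z h) => x ->; rewrite mulrCA.
Qed.

(** The imaginary part of h is handled as minus the real part of 'i *: h. *)
Lemma fourier_injective h :
  energy (unscaled_fourier A h) @[A --> +oo] --> 0%E -> h = 0.
Proof.
move=> h0; have re0 := unscaled_fourier_Re_eq0 h0.
have im0 : \forall x \ae mu, complex.Re (('i *: h : H) x) = 0.
  apply: unscaled_fourier_Re_eq0; apply: cvg_trans h0; apply: near_eq_cvg; apply: nearW => A.
  have -> : unscaled_fourier A ('i *: h) = (fun l => 'i * unscaled_fourier A h l).
    by apply/funext => l; rewrite unscaled_fourierZ.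
  rewrite energyZ; last exact: cmeasurable_unscaled_fourier.
  by rewrite /abs2 /= expr0n expr1n add0r mul1e.
apply/L2_eqP.
have im1 : \forall x \ae mu, complex.Im (h x) = 0.
  apply: aeS2 (L2_scaleE 'i h) im0 => x ->; case: (h x) => a b /=.
  by rewrite mul0r mul1r sub0r => /eqP; rewrite oppr_eq0 => /eqP.
by apply: aeS3 (@L2_0E R) re0 im1 => x ->; case: (h x) => a b /= -> ->.
Qed.

End FourierUniqueness.

(** * Inner multipliers commute with right shifts *)

Section ShiftInvariance.
Variable R : realType.
Local Notation mu := (@lebesgue_measure R).
Local Notation H := (L2 R).
Implicit Types (f g h : H) (A t : R).

(** From |a + b|^2 <= 2 |a|^2 + 2 |b|^2; the square root of the energy, which may
    be infinite, is thus avoided. *)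
Lemma energy_triangle (u v w : R -> R[i]) : cmeasurable u -> cmeasurable v -> cmeasurable w ->
  (energy (fun x => (u x - w x)%R) <=
     2%:E * energy (fun x => (u x - v x)%R) + 2%:E * energy (fun x => (v x - w x)%R))%E.
Proof.
move=> mu_ mv mw.
have muv := cmeasurableB mu_ mv; have mvw := cmeasurableB mv mw.
have ge0 (z : R -> R[i]) x : (0 <= (abs2 (z x))%:E)%E by rewrite lee_fin abs2_ge0.
rewrite /energy -!ge0_integralZl//=; try by apply/measurable_EFinP; exact: measurable_abs2.
all: try by move=> x _; rewrite lee_fin abs2_ge0.
rewrite -ge0_integralD//=; first last.
- by apply/measurable_EFinP; apply: measurable_funM => //; exact: measurable_abs2.
- by move=> x _; rewrite -EFinM lee_fin mulr_ge0 ?abs2_ge0.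
- by apply/measurable_EFinP; apply: measurable_funM => //; exact: measurable_abs2.
- by move=> x _; rewrite -EFinM lee_fin mulr_ge0 ?abs2_ge0.
apply: ge0_le_integral => //.
- by move=> x _; rewrite lee_fin abs2_ge0.
- by apply/measurable_EFinP; apply: measurable_abs2; exact: cmeasurableB.
- by apply: emeasurable_funD; apply/measurable_EFinP; apply: measurable_funM => //;
    exact: measurable_abs2.
move=> x _; rewrite -!EFinM -EFinD lee_fin.
have -> : u x - w x = (u x - v x) + (v x - w x) by rewrite addrA subrK.
move: (u x - v x) (v x - w x) => [a b] [c d]; rewrite /abs2 /=.
by have := sqr_ge0 (a - c); have := sqr_ge0 (b - d); rewrite !sqrrB !sqrrD; lra.
Qed.

Lemma energyN (u v : R -> R[i]) : energy (fun x => u x - v x) = energy (fun x => v x - u x).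
Proof.
apply: eq_integral => x _; congr EFin; move: (u x) (v x) => [a b] [c d].
by rewrite /abs2 /=; ring.
Qed.

Definition mean_cvg (a : R -> R -> R[i]) (g : R -> R[i]) :=
  energy (fun l => a A l - g l) @[A --> +oo] --> 0%E.

Lemma mean_cvg_sum0 (a b : R -> \bar R) :
  a A @[A --> +oo] --> 0%E -> b A @[A --> +oo] --> 0%E ->
  (2%:E * a A + 2%:E * b A)%E @[A --> +oo] --> 0%E.
Proof.
move=> a0 b0; rewrite -[X in _ --> X](adde0 0%E); apply: cvgeD => //.
  by rewrite -[X in _ --> X](mule0 2%:E); exact: cvgeZl.
by rewrite -[X in _ --> X](mule0 2%:E); exact: cvgeZl.
Qed.

Lemma mean_cvg_unique (a : R -> R -> R[i]) (g g' : R -> R[i]) :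
  (forall A, cmeasurable (a A)) -> cmeasurable g -> cmeasurable g' ->
  mean_cvg a g -> mean_cvg a g' -> \forall l \ae mu, g l = g' l.
Proof.
move=> ma mg mg' ag ag'.
have e0 : energy (fun l => g l - g' l) = 0%E.
  apply/eqP; rewrite eq_le energy_ge0 andbT.
  have lim := mean_cvg_sum0 ag ag'.
  rewrite -(cvg_lim _ lim)//; apply: lime_ge; first by apply/cvg_ex; exists 0%E.
  by apply: nearW => A; rewrite (energyN (a A) g); exact: energy_triangle.
have := energy_eq0 (cmeasurableB mg mg') e0.
by apply: aeS => l /eqP; rewrite subr_eq0 => /eqP.
Qed.

Lemma is_fourierP f g : is_fourier f g <-> mean_cvg (fun A => truncated_fourier A f) g.
Proof.
rewrite /is_fourier /mean_cvg.
suff -> : (fun A => \int[mu]_l ((Normc.normc (truncated_fourier A f l - g l)) ^+ 2)%:E)%E =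
  (fun A => energy (fun l => truncated_fourier A f l - g l)) by [].
apply/funext => A; apply: eq_integral => l _; congr EFin.
by case: (_ - _) => a b; rewrite /abs2 /= sqr_sqrtr// addr_ge0 ?sqr_ge0.
Qed.

Definition fourier_scale : R := (Num.sqrt (2 * pi))^-1.

Lemma fourier_scale_gt0 : 0 < fourier_scale.
Proof. by rewrite invr_gt0 sqrtr_gt0 mulr_gt0// pi_gt0. Qed.

Lemma truncated_fourierE A f l :
  truncated_fourier A f l = fourier_scale%:C * unscaled_fourier A f l.
Proof. by []. Qed.

Lemma cmeasurable_truncated A f : cmeasurable (truncated_fourier A f).
Proof.
apply: (@cmeasurableM _ (fun=> fourier_scale%:C)); first exact: cmeasurable_cst.
exact: cmeasurable_unscaled_fourier.
Qed.

Lemma cintegral_restr (D : set (measurableTypeR R)) u :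
  cintegral D u = cintegral setT (restr D u).
Proof.
rewrite /cintegral; congr (_ +i* _); rewrite Rintegral_mkcond; apply: eq_Rintegral => x _.
  by rewrite patchE /restr indicE; case: (_ \in _); case: (u x) => a b /=;
    rewrite ?mul1r ?mul0r ?subr0.
by rewrite patchE /restr indicE; case: (_ \in _); case: (u x) => a b /=;
  rewrite ?mul1r ?mul0r ?addr0.
Qed.

(** The change of variables turns the window [- A, A] into [- A - t, A - t]. As f
    vanishes to the left of 0, the symmetric window [- (A - t), A - t] gives the
    same integral. *)
Lemma unscaled_fourier_shift A t f l : Hsupp 0 f -> 0 <= t -> t <= A ->
  unscaled_fourier A (L2shift (- t) f) l = cis (l * t) * unscaled_fourier (A - t) f l.
Proof.
move=> f0 t0 tA.
have wide (y : R) : - (A - t) <= y <= A - t -> - A <= y + t <= A.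
  by move=> /andP[h1 h2]; apply/andP; split; lra.
have narrow (y : R) : 0 <= y -> - A <= y + t <= A -> - (A - t) <= y <= A - t.
  by move=> y0 /andP[h1 h2]; apply/andP; split; lra.
have mD (a b : R) := measurable_itv_cc a b.
have mk (g : H) : cmeasurable (fun x => cis (l * x) * g x).
  by apply: cmeasurableM; [exact: cmeasurable_cis|exact: L2_cmeasurable].
rewrite /unscaled_fourier -cintegralZ//; last exact: (cintegrable_fourier (A - t) f l).
rewrite [LHS]cintegral_restr [RHS]cintegral_restr -[LHS](cintegral_translation t); last first.
  exact: (cmeasurable_restr (mD _ _) (mk _)).
apply: ae_cintegral => //.
- exact: (cmeasurable_translation t (cmeasurable_restr (mD _ _) (mk _))).
- apply: cmeasurable_restr => //.
  exact: (cmeasurableM (cmeasurable_cst (cis (l * t))) (mk f)).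
apply: aeS2 f0 (ae_translation t (L2shiftE (- t) f)) => x fx sx.
rewrite /restr sx addrK mulrDr cisD.
have [xD|xD] := boolP (x \in `[- (A - t), A - t]%classic).
  rewrite !indicE xD; move: xD; rewrite inE /= in_itv/= => xD.
  rewrite mem_set/=; last by rewrite in_itv/=; exact: wide.
  by congr (_ * _); rewrite [RHS]mulrCA mulrA.
rewrite [in RHS]indicE (negbTE xD) mul0r.
have [xn|xp] := ltP x 0; first by rewrite fx ?oppr0// !mulr0.
rewrite indicE memNset ?mul0r// => /=; rewrite in_itv/= => xtA.
by move: xD; rewrite notin_setE /= in_itv/=; apply; exact: narrow.
Qed.

(** The factor cis (l * t) has modulus 1, so it does not change the energy. *)
Lemma mean_cvg_shift f g t : Hsupp 0 f -> 0 <= t -> is_fourier f g ->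
  mean_cvg (fun A => truncated_fourier A (L2shift (- t) f)) (fun l => cis (l * t) * g l).
Proof.
move=> f0 t0 /is_fourierP fg.
have lim : energy (fun l => truncated_fourier (A - t) f l - g l) @[A --> +oo] --> 0%E.
  apply: (cvg_comp (fun A => A - t) _ _ fg).
  apply/cvgryPge => B; near=> A; rewrite lerBrDr.
  by near: A; apply: nbhs_pinfty_ge; exact: num_real.
apply: cvg_trans lim; apply: near_eq_cvg; near=> A.
have tA : t <= A by near: A; apply: nbhs_pinfty_ge; exact: num_real.
apply: eq_integral => l _; congr EFin.
rewrite !truncated_fourierE unscaled_fourier_shift// mulrCA -mulrBr.
by rewrite abs2M abs2_cis mul1r.
Unshelve. all: by end_near. Qed.

Lemma truncated_fourierB A f g l :
  truncated_fourier A (f - g) l = truncated_fourier A f l - truncated_fourier A g l.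
Proof.
rewrite !truncated_fourierE -mulrBr; congr (_ * _).
have -> : f - g = (-1) *: g + f by rewrite scaleN1r addrC.
have mD := measurable_itv_cc (- A) A.
have -> : unscaled_fourier A f l - unscaled_fourier A g l =
    (-1) * unscaled_fourier A g l + unscaled_fourier A f l by rewrite mulN1r addrC.
rewrite /unscaled_fourier.
rewrite -cintegral_lincomb//; [|exact: (cintegrable_fourier A _ l)..].
have mk (k : H) : cmeasurable (fun x => cis (l * x) * k x).
  by apply: cmeasurableM; [exact: cmeasurable_cis|exact: L2_cmeasurable].
apply: ae_cintegral => //.
- apply: cmeasurableD => //; apply: (@cmeasurableM _ (fun=> -1)) => //; exact: cmeasurable_cst.
- by apply: aeS (L2_lincombE (-1) g f) => x ->; rewrite mulrDr mulrCA.
Qed.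

Lemma truncated_fourier_injective h :
  energy (truncated_fourier A h) @[A --> +oo] --> 0%E -> h = 0.
Proof.
move=> h0; apply: fourier_injective.
have c0 := fourier_scale_gt0.
have lim : ((fourier_scale ^- 2)%:E * energy (truncated_fourier A h))%E @[A --> +oo] --> 0%E.
  by rewrite -[X in _ --> X](mule0 (fourier_scale ^- 2)%:E); exact: cvgeZl.
apply: cvg_trans lim; apply: near_eq_cvg; apply: nearW => A.
rewrite (_ : truncated_fourier A h = (fun l => fourier_scale%:C * unscaled_fourier A h l)) //.
rewrite energyZ; last exact: cmeasurable_unscaled_fourier.
by rewrite muleA -EFinM /abs2 /= expr0n addr0 mulVf ?mul1e// gt_eqF// exprn_gt0.
Qed.

(** On the Fourier side the shift is multiplication by cis (l * t), and
    multiplications commute. So both sides have the same Fourier transform. *)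
Lemma inner_multiplier_shift (Theta : R[i] -> R[i]) (M : H -> H) f t :
  is_inner_multiplier Theta M -> Hsupp 0 f -> 0 <= t ->
  M (L2shift (- t) f) = L2shift (- t) (M f).
Proof.
move=> [[Min _ _] MF] f0 t0.
have sf0 : Hsupp 0 (L2shift (- t) f).
  by apply: (@HsuppS _ (0 - t)); [rewrite sub0r oppr_le0|exact: Hsupp_shift].
have [f' [g' [ff' gg' fg]]] := MF f f0.
have [f'' [g'' [ff'' gg'' fg'']]] := MF _ sf0.
have mcis : cmeasurable (fun l : R => cis (l * t)).
  by split; under eq_fun do rewrite /= mulrC; [exact: measurable_cosM|exact: measurable_sinM].
have mcg (k : H) : cmeasurable (fun l => cis (l * t) * k l).
  by apply: cmeasurableM => //; exact: L2_cmeasurable.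
have mT (k : H) A : cmeasurable (truncated_fourier A k) by exact: cmeasurable_truncated.
have f''E : \forall l \ae mu, f'' l = cis (l * t) * f' l.
  have lim'' : mean_cvg (fun A => truncated_fourier A (L2shift (- t) f)) f''.
    exact: (is_fourierP _ _).1 ff''.
  exact: (mean_cvg_unique (mT _) (L2_cmeasurable f'') (mcg f') lim''
    (mean_cvg_shift f0 t0 ff')).
have g''E : \forall l \ae mu, g'' l = cis (l * t) * g' l.
  by apply: aeS3 fg fg'' f''E => l -> -> ->; rewrite mulrCA.
have lim1 : mean_cvg (fun A => truncated_fourier A (M (L2shift (- t) f)))
    (fun l => cis (l * t) * g' l).
  have /is_fourierP := gg''; rewrite /mean_cvg.
  suff E A : energy (fun l => truncated_fourier A (M (L2shift (- t) f)) l - g'' l) =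
      energy (fun l => truncated_fourier A (M (L2shift (- t) f)) l - cis (l * t) * g' l).
    by apply: cvg_trans; apply: near_eq_cvg; apply: nearW => A; rewrite E.
  apply: energy_ae; [|exact: cmeasurableB|by apply: aeS g''E => l ->].
  by apply: cmeasurableB => //; exact: L2_cmeasurable.
have lim2 := mean_cvg_shift (Min _ f0) t0 gg'.
apply/eqP; rewrite -subr_eq0; apply/eqP; apply: truncated_fourier_injective.
apply: (squeeze_cvge _ (cvg_cst 0%E) (mean_cvg_sum0 lim1 lim2)).
apply: nearW => A; rewrite energy_ge0/=.
set u := truncated_fourier A (M _); set v := truncated_fourier A (L2shift _ _).
rewrite (_ : truncated_fourier A _ = (fun l => u l - v l)); last first.
  by apply/funext => l; exact: truncated_fourierB.
rewrite (energyN v); apply: energy_triangle => //; exact: mT.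
Qed.

End ShiftInvariance.

(** * The cocycle as a quotient of two unitary groups *)

Section CocycleModel.
Variable R : realType.
Local Notation H := (L2 R).
Local Notation E := (@Hsupp R 0).
Local Notation S := (@L2shift R).
Variables (M : H -> H) (U : R -> H -> H).
Local Notation V := (M @` E).
Local Notation K := (ominus E V).
Hypothesis Miso : isometry_on E M.
Hypothesis Mshift : forall f t, E f -> 0 <= t -> M (S (- t) f) = S (- t) (M f).
Hypothesis Ugroup : unitary_C0_group_on K U.

Let Ecl : closed_subspace E := Hsupp_closed 0.
Let El : linear_subspace E := Ecl.1.
Let MinE f : E f -> E (M f). Proof. by case: Miso => + _ _; exact. Qed.
Let Mdot f g : E f -> E g -> dot (M f) (M g) = dot f g. Proof. by case: Miso => _ _; exact. Qed.
Let Vcl : closed_subspace V := iso_image_closed Ecl Miso.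
Let VE : V `<=` E. Proof. by move=> _ [f Ef <-]; exact: MinE. Qed.
Let Kcl : closed_subspace K := ominus_closed V Ecl.
Let KE : K `<=` E. Proof. by move=> f []. Qed.
Let isoS t : isometry_on setT (S t). Proof. by case: (@L2shift_unitary R t). Qed.
Let SD t f g : S t (f + g) = S t f + S t g. Proof. exact: (isoD (isoS t)). Qed.
Let SB t f g : S t (f - g) = S t f - S t g. Proof. exact: (isoB (isoS t)). Qed.
Let S0 t : S t 0 = 0. Proof. exact: (iso0 (setT_closed R).1 (isoS t)). Qed.
Let SE f t : 0 <= t -> E f -> E (S (- t) f).
Proof.
move=> t0 Ef; apply: (@HsuppS _ (0 - t)); first by rewrite sub0r oppr_le0.
exact: Hsupp_shift.
Qed.

Local Notation P := (orth_proj E).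
Local Notation PK := (orth_proj K).
Local Notation PV := (orth_proj V).

Let PE f : E (P f). Proof. by case: (orth_projP f Ecl). Qed.
Let Porth f : orth E (f - P f). Proof. by case: (orth_projP f Ecl). Qed.
Let orthD (L : set H) f g : orth L f -> orth L g -> orth L (f + g).
Proof. by move=> Lf Lg; exact: (subspaceD (orth_closed L).1). Qed.
Let orthS (L L' : set H) f : L `<=` L' -> orth L' f -> orth L f.
Proof. by move=> LL Of g /LL; exact: Of. Qed.

Lemma dot_orth_sum (a b c d : H) : dot a d = 0 -> dot b c = 0 ->
  dot (a + b) (c + d) = dot a c + dot b d.
Proof. by move=> ad bc; rewrite dotDl (dotDr c d a) (dotDr c d b) ad bc addr0 add0r. Qed.

Lemma orth_proj_lincomb (L : set H) a f g : closed_subspace L ->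
  orth_proj L (a *: f + g) = a *: orth_proj L f + orth_proj L g.
Proof.
move=> Lc; have [Lf Of] := orth_projP f Lc; have [Lg Og] := orth_projP g Lc.
apply: orth_proj_uniq; first by case: Lc.
  by case: Lc => -[_ Ll] _; exact: Ll.
rewrite opprD addrACA -scalerBr.
by case: (orth_closed L) => -[_ Ol] _; exact: (Ol a _ _ Of Og).
Qed.

(** The isometry of the whole space that is M on E and the identity on the
    orthogonal complement of E; its range is the orthogonal complement of K. *)
Definition extend_inner (h : H) : H := M (P h) + (h - P h).
Local Notation J := extend_inner.

Let J_lincomb a f g : J (a *: f + g) = a *: J f + J g.
Proof.
rewrite /J orth_proj_lincomb// (iso_lincomb _ Miso)//.
by rewrite opprD [a *: f + g + _]addrACA -scalerBr addrACA -scalerDr.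
Qed.

Let J_dot f g : dot (J f) (J g) = dot f g.
Proof.
have Z a b : E a -> dot a (b - P b) = 0 by move=> Ea; apply: dot_eq0C; exact: Porth.
have Z' a b : E a -> dot (b - P b) a = 0 by move=> Ea; exact: Porth.
rewrite /J (dot_orth_sum (Z _ g (MinE (PE f))) (Z' _ f (MinE (PE g)))) Mdot//.
rewrite -(dot_orth_sum (Z _ g (PE f)) (Z' _ f (PE g))).
by rewrite addrC subrK [P g + _]addrC subrK.
Qed.

Let Jiso : isometry_on setT J.
Proof. by split. Qed.

Let JE f : E f -> J f = M f.
Proof. by move=> Ef; rewrite /J (orth_proj_in El Ef) subrr addr0. Qed.

Let Jorth f : orth E f -> J f = f.
Proof. by move=> Of; rewrite /J (orth_proj_orth El Of) (iso0 El Miso) subr0 add0r. Qed.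

Let orthKJ k h : K k -> dot k (J h) = 0.
Proof.
move=> [Ek Ok]; rewrite /J dotDr Ok ?add0r; last by exists (P h).
by apply: dot_eq0C; exact: Porth.
Qed.

Let PK_E f : PK f = P f - PV f.
Proof.
have [Vf OVf] := orth_projP f Vcl.
apply: orth_proj_uniq; first by case: Kcl.
  split; first by apply: (subspaceB El) => //; exact: VE.
  have -> : P f - PV f = (f - PV f) - (f - P f) by rewrite opprB [RHS]addrC addrA subrK.
  by apply: (subspaceB (orth_closed V).1) => //; apply: orthS (Porth f).
have -> : f - (P f - PV f) = (f - P f) + PV f by rewrite opprB addrA addrAC.
apply: orthD; first exact: orthS (Porth f).
by move=> g [_ Og]; apply: dot_eq0C; exact: Og.
Qed.

(** A vector is the sum of its components in K, in V and in the orthogonal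
    complement of E, and the last two make up the range of J. *)
Lemma range_decomposition f : exists h, f = PK f + J h.
Proof.
have [[e Ee Me] _] := orth_projP f Vcl.
exists (e + (f - P f)).
rewrite (isoD Jiso)// (JE Ee) (Jorth (Porth f)) Me PK_E.
by rewrite addrA subrK addrC subrK.
Qed.

(** The adjoint of J, obtained as the coordinate along the range of J; it is
    determined because J is injective. *)
Definition range_coord f : H := xget 0 [set h | f = PK f + J h].
Local Notation Q := range_coord.

Let QE f : f = PK f + J (Q f).
Proof. by rewrite /Q; case: xgetP => [_ -> //|no]; have [h hE] := range_decomposition f; have := no h. Qed.

Let PK_decomp k h : K k -> PK (k + J h) = k.
Proof.
move=> Kk; apply: orth_proj_uniq => //; first by case: Kcl.
by rewrite addrC addKr => g Kg; apply: dot_eq0C; exact: orthKJ.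
Qed.

Let Q_decomp k h : K k -> Q (k + J h) = h.
Proof.
move=> Kk; apply: (iso_inj (setT_closed R).1 Jiso) => //.
by have := QE (k + J h); rewrite (PK_decomp h Kk) => /addrI.
Qed.

Let PKK f : K (PK f). Proof. by case: (orth_projP f Kcl). Qed.

(** The unitary group that is U_{-t} on K and J S_t J^{-1} on the range of J. *)
Definition model_group t f : H := U (- t) (PK f) + J (S t (Q f)).
Local Notation G := model_group.

Let UK t k : K k -> K (U t k).
Proof. by case: Ugroup => /(_ t)[[+ _ _] _] _ _ _; exact. Qed.

Let G_decomp t k h : K k -> G t (k + J h) = U (- t) k + J (S t h).
Proof. by move=> Kk; rewrite /G (PK_decomp h Kk) (Q_decomp h Kk). Qed.

Let K0 : K 0. Proof. exact: Kcl.1.1. Qed.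

Let U0 t : U t 0 = 0.
Proof. by case: Ugroup => /(_ t)[Ui _] _ _ _; exact: (iso0 Kcl.1 Ui). Qed.

Let GJ t h : G t (J h) = J (S t h).
Proof. by rewrite -[J h]add0r G_decomp// U0 add0r. Qed.

Let GK t k : K k -> G t k = U (- t) k.
Proof.
move=> Kk; have J0 : J 0 = 0 by exact: (iso0 (setT_closed R).1 Jiso).
by rewrite -[k in G _ k]addr0 -J0 G_decomp// S0 J0 addr0.
Qed.

Let GD s t f : G s (G t f) = G (s + t) f.
Proof.
rewrite {2}/G G_decomp; last exact/UK/PKK.
rewrite L2shiftD /G opprD; case: Ugroup => _ _ UD _; rewrite UD//.
Qed.

Let G0 f : G 0 f = f.
Proof. by rewrite /G oppr0 L2shift0; case: Ugroup => _ Uid _ _; rewrite Uid// -QE. Qed.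

Let Qlin a f g : Q (a *: f + g) = a *: Q f + Q g.
Proof.
apply: (iso_inj (setT_closed R).1 Jiso) => //.
apply: (addrI (PK (a *: f + g))); rewrite -QE J_lincomb orth_proj_lincomb//.
by rewrite addrACA -scalerDr -!QE.
Qed.

Let Giso t : isometry_on setT (G t).
Proof.
case: Ugroup => /(_ (- t))[[_ Ul Ud] _] _ _ _.
split => // [a f g _ _|f g _ _].
  rewrite /G orth_proj_lincomb// Ul// Qlin L2shift_lincomb J_lincomb.
  by rewrite addrACA -scalerDr.
rewrite /G (dot_orth_sum (orthKJ _ (UK _ (PKK f))) (dot_eq0C (orthKJ _ (UK _ (PKK g))))).
rewrite Ud// J_dot L2shift_dot -(J_dot (Q f) (Q g)).
by rewrite -(dot_orth_sum (orthKJ _ (PKK f)) (dot_eq0C (orthKJ _ (PKK g)))) -!QE.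
Qed.

Let G_adj t f g : dot (G t f) g = dot f (G (- t) g).
Proof.
rewrite -[g in LHS](G0 g) -(subrr t) -GD.
by case: (Giso t) => _ _ ->.
Qed.

Let G_continuous f s : l2norm (G t f - G s f) @[t --> s] --> (0 : R).
Proof.
have l1 : l2norm (U (- t) (PK f) - U (- s) (PK f)) @[t --> s] --> (0 : R).
  case: Ugroup => _ _ _ /(_ _ (PKK f) (- s)) c.
  by apply: (cvg_comp (fun t => - t) _ _ c); exact: cvgN.
have l2 : l2norm (J (S t (Q f)) - J (S s (Q f))) @[t --> s] --> (0 : R).
  apply: cvg_trans (L2shift_continuous (Q f) s); apply: near_eq_cvg; apply: nearW => t.
  by rewrite (iso_dist (setT_closed R).1 Jiso).
apply: cvg_trans (l2norm_cvgD _ l1 l2); apply: near_eq_cvg; apply: nearW => t.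
by congr l2norm; rewrite /G (opprD (U (- s) (PK f)) (J (S s (Q f)))) [RHS]addrACA.
Qed.

(** The adjoint S_{-t} of S_t maps E into the functions supported in [t, +oo). So
    S_t moves what lives to the left of t off the half-line. *)
Let shift_orth t f : orth (Hsupp (- t)) f -> orth E (S t f).
Proof.
move=> Of g Eg; rewrite L2shift_adj; apply: Of.
by have := Hsupp_shift (- t) Eg; rewrite add0r.
Qed.

(** V is invariant under right shifts because M commutes with them; the isometry
    S_{-t} carries the projection onto V to the one onto S_{-t} V. *)
Let proj_shift t b : 0 <= t -> orth_proj (S (- t) @` V) b = S (- t) (PV (S t b)).
Proof.
move=> t0; have isoV : isometry_on V (S (- t)).
  split; last by move=> f g _ _; exact: L2shift_dot.
    by move=> _ [e Ee <-]; exists (S (- t) e); [exact: SE|exact: Mshift].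
  by move=> a f g _ _; exact: L2shift_lincomb.
have [Vp Op] := orth_projP (S t b) Vcl.
apply: orth_proj_uniq; first by case: (iso_image_closed Vcl isoV).
  by exists (PV (S t b)).
move=> _ [v Vv <-]; rewrite -{1}(L2shiftK t b) -SB L2shift_dot.
exact: Op.
Qed.

(** Let b be the part of f in [t, +oo) and q the rest, so that S_t b lies in E while
    S_t q is orthogonal to E. If M e is the projection of S_t b onto V, then
    S_t f = PK (S_t b) + J (e + S_t q). Applying G_{-t} gives the three terms of
    W_{-t} on E, as J S_{-t} e = M S_{-t} e = S_{-t} M e and J is M on the part
    of q in [0, t]. *)
Lemma W_minus_model t f : 0 <= t -> W_minus M U t f = G (- t) (S t f).
Proof.
move=> t0; have tE : Hsupp (- t) `<=` E by apply: HsuppS; rewrite oppr_le0.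
have tcl : closed_subspace (@Hsupp R (- t)) := Hsupp_closed (- t).
rewrite /W_minus /W_minus0 /P_ge /P_le.
rewrite (orth_proj_ominus (setT_closed R) Ecl)//.
rewrite (orth_proj_ominus Ecl tcl tE (PE f)).
set b := orth_proj (Hsupp (- t)) (P f).
have [bt Ob] := orth_projP (P f) tcl; rewrite -/b in bt Ob.
have Eb : E b by exact: tE.
have ESb : E (S t b) by have := Hsupp_shift t bt; rewrite addNr.
rewrite proj_shift//.
have [[e Ee Me] _] := orth_projP (S t b) Vcl.
set q := (P f - b) + (f - P f).
have Oq : orth E (S t q).
  by apply: shift_orth; apply: orthD => //; apply: orthS (Porth f).
have -> : S t f = PK (S t b) + J (e + S t q).
  rewrite (isoD Jiso)// (JE Ee) (Jorth Oq) Me PK_E (orth_proj_in El ESb) addrA subrK.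
  by rewrite -SD /q addrA (addrC b) subrK addrC subrK.
rewrite G_decomp// opprK SD L2shiftK -Me -(Mshift Ee t0) (isoD Jiso)// (JE (SE t0 Ee)).
rewrite -!addrA; congr (_ + (_ + _)).
rewrite /q (isoD Jiso)// (Jorth (Porth f)) JE//.
exact: (subspaceB El).
Qed.

Local Notation W := (W_family M U).

(** For positive t this holds because the adjoint of G_{-t} S_t is S_{-t} G_t. *)
Lemma W_model t f : W t f = G t (S (- t) f).
Proof.
rewrite /W_family; case: ifPn => [t0|]; first by rewrite W_minus_model ?opprK// oppr_ge0.
rewrite -ltNge => /ltW t0.
rewrite (adj_uniq (g := S (- t) (G t (S (- t) f)))) ?L2shiftNK// => h.
by rewrite W_minus_model// G_adj opprK L2shift_adj.
Qed.

Let Wiso t : isometry_on setT (W t).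
Proof.
split => // [a f g _ _|f g _ _]; rewrite !W_model.
  by rewrite L2shift_lincomb (iso_lincomb _ (Giso t)).
by case: (Giso t) => _ _ ->//; exact: L2shift_dot.
Qed.

Let W_surj t g : exists f, W t f = g.
Proof. by exists (S t (G (- t) g)); rewrite W_model L2shiftK GD subrr G0. Qed.

Let W_id t f : 0 <= t -> orth E f -> W (- t) f = f.
Proof.
move=> t0 Of; rewrite W_model opprK.
have OSf : orth E (S t f).
  by apply: shift_orth; apply: orthS Of; apply: HsuppS; rewrite oppr_le0.
by rewrite -(Jorth OSf) GJ L2shiftK Jorth.
Qed.

Let E_orthorth f : (forall h, orth E h -> dot f h = 0) -> E f.
Proof.
move=> fE; rewrite -(ominusK (setT_closed R) Ecl)//; split => // g [_ Og].
exact: fE.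
Qed.

(** W_{-t} is unitary and fixes the orthogonal complement of E, hence maps E onto
    itself. *)
Lemma W_unitary_half_line t : 0 <= t -> unitary_on E (W (- t)).
Proof.
move=> t0; case: (Wiso (- t)) => _ Wl Wd; split; first split.
- move=> f Ef; apply: E_orthorth => h Oh; rewrite -(W_id t0 Oh) Wd//.
  by apply: dot_eq0C; exact: Oh.
- by move=> a f g _ _; exact: Wl.
- by move=> f g _ _; exact: Wd.
move=> g Eg; have [f Wf] := W_surj (- t) g; exists f => //.
apply: E_orthorth => h Oh; rewrite -Wd// Wf (W_id t0 Oh).
by apply: dot_eq0C; exact: Oh.
Qed.

Lemma W_cocycle : mult_cocycle W.
Proof.
split.
- by move=> t; split => // g _; have [f Wf] := W_surj t g; exists f.
- move=> f _ s.
  have l1 : l2norm (S (- t) f - S (- s) f) @[t --> s] --> (0 : R).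
    by apply: (cvg_comp (fun t => - t) _ _ (L2shift_continuous f (- s))); exact: cvgN.
  have l1' : l2norm (G t (S (- t) f) - G t (S (- s) f)) @[t --> s] --> (0 : R).
    apply: cvg_trans l1; apply: near_eq_cvg; apply: nearW => t.
    by rewrite (iso_dist (setT_closed R).1 (Giso t)).
  apply: cvg_trans (l2norm_cvgD _ l1' (G_continuous (S (- s) f) s)).
  by apply: near_eq_cvg; apply: nearW => t; rewrite !W_model addrA subrK.
- move=> s t f; rewrite !W_model L2shiftK GD L2shiftD.
  by rewrite opprD addrC (addrC (- s)).
- by move=> f; rewrite W_model oppr0 G0 L2shift0.
Qed.

(** The shift S_{-t} sends f off the half-line, where J is the identity, and G_t
    is J S_t J^{-1} on the range of J. *)
Lemma W_markovian : markovian W.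
Proof.
move=> t f t0 [_ Of]; have EOf : orth E f by apply: orthS Of; exact: HsuppS.
have OSf : orth E (S (- t) f) by apply: shift_orth; rewrite opprK.
by rewrite W_model -(Jorth OSf) GJ L2shiftNK Jorth.
Qed.

(** W_{-t} and M agree on the part of f in [0, t], and are isometric on the rest. *)
Lemma W_limit f : E f -> l2norm (W (- t) f - M f) @[t --> +oo] --> (0 : R).
Proof.
move=> Ef.
have lim : 2 * l2norm (orth_proj (Hsupp (- t)) f) @[t --> +oo] --> (0 : R).
  by rewrite -(mulr0 (2 : R)); apply: cvgMl_tmp; exact: tail_cvg0.
apply: (squeeze_cvgr _ (cvg_cst 0) lim); near=> t; rewrite l2norm_ge0/=.
have t0 : 0 <= t by near: t; apply: nbhs_pinfty_ge; exact: num_real.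
have tE : Hsupp (- t) `<=` E by apply: HsuppS; rewrite oppr_le0.
have [bt Ob] := orth_projP f (Hsupp_closed (- t)).
set b := orth_proj _ f in bt Ob *.
have Ep : E (f - b) by apply: (subspaceB El) => //; exact: tE.
(* f - b is the part of f in [0, t], which S_t moves off the half-line *)
have Wp : W (- t) (f - b) = M (f - b).
  by rewrite W_model opprK -(Jorth (shift_orth Ob)) GJ L2shiftK JE.
have -> : W (- t) f - M f = W (- t) b - M b.
  move: Wp; rewrite (isoB (Wiso (- t)))// (isoB Miso)//; last exact: tE.
  by move=> /eqP; rewrite subr_eq => /eqP ->; rewrite [LHS]addrC !addrA addNr add0r addrC.
apply: le_trans (l2normD _ _) _; rewrite l2normN (iso_norm (Wiso _))// (iso_norm Miso); last exact: tE.
by lra.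
Unshelve. all: by end_near. Qed.

Lemma W_limit_orth f : ominus setT E f -> l2norm (W (- t) f - f) @[t --> +oo] --> (0 : R).
Proof.
move=> [_ Of]; apply/cvgr0Pnorm_le => e e0; near=> t.
have t0 : 0 <= t by near: t; apply: nbhs_pinfty_ge; exact: num_real.
by rewrite (W_id t0 Of) subrr l2norm0 normr0 ltW.
Unshelve. all: by end_near. Qed.

Lemma perturbed_semigroupE t f : perturbed_semigroup W t f = G (- t) f.
Proof. by rewrite /perturbed_semigroup W_model opprK L2shiftNK. Qed.

(** On V the semigroup is the image under M of the right shifts on E. As M commutes
    with these, a subspace of V on which the semigroup is unitary lies in the range
    of every S_{-t}, so its elements are supported in [t, +oo) for all t. *)
Lemma W_unitary_part : unitary_part_is E (perturbed_semigroup W) K U.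
Proof.
have VtK t k : K k -> perturbed_semigroup W t k = U t k.
  by move=> Kk; rewrite perturbed_semigroupE GK// opprK.
have KV : ominus E K = V by exact: ominusK.
have VtV t e : 0 <= t -> E e -> perturbed_semigroup W t (M e) = M (S (- t) e).
  by move=> t0 Ee; rewrite perturbed_semigroupE -(JE Ee) GJ JE//; exact: SE.
have Kinv : invariant_under (perturbed_semigroup W) K.
  by move=> t f _ Kf; rewrite VtK//; exact: UK.
have Vinv : invariant_under (perturbed_semigroup W) V.
  by move=> t _ t0 [e Ee <-]; rewrite VtV//; exists (S (- t) e) => //; exact: SE.
split; last by move=> t f _; exact: VtK.
split.
- by split => //; split => //; rewrite KV.
- by rewrite KV; split => //; split => //; rewrite -?KV ?ominusK// KV.
- move=> t t0; case: Ugroup => /(_ t)[[Ui Ul Ud] Us] _ _ _; split.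
    split => [f Kf|a f g Kf Kg|f g Kf Kg]; first by rewrite VtK//; exact: UK.
      rewrite (VtK t _ Kf) (VtK t _ Kg) VtK; first exact: Ul.
      by case: Kcl => -[_ Kl] _; exact: Kl.
    by rewrite (VtK t _ Kf) (VtK t _ Kg); exact: Ud.
  by move=> g Kg; have [f Kf Uf] := Us g Kg; exists f => //; rewrite VtK.
rewrite KV => L [_ LV _ _] Lu f Lf /=.
have ft t : 0 <= t -> Hsupp (- t) f.
  move=> t0; have [_ /(_ f Lf)[g Lg <-]] := Lu t t0.
  have [e Ee <-] := LV g Lg; rewrite VtV// (Mshift Ee t0).
  by have := Hsupp_shift (- t) (MinE Ee); rewrite add0r.
apply: l2norm_eq0; apply/eqP; rewrite -normr_le0.
apply/ler_addgt0Pl => e e0; rewrite addr0.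
have small : \forall t \near +oo,
    `|l2norm (orth_proj (Hsupp (- t)) f)| <= e :> R.
  by have /cvgr0Pnorm_le /(_ _ e0) := tail_cvg0 f.
near (pinfty_nbhs R) => t.
have t0 : 0 <= t by near: t; apply: nbhs_pinfty_ge; exact: num_real.
rewrite -[f in l2norm f](orth_proj_in (Hsupp_closed (- t)).1 (ft t t0)).
by near: t; exact: small.
Unshelve. all: by end_near. Qed.

End CocycleModel.

Theorem proposition2p3 (R : realType) (Theta : R[i] -> R[i])
    (M : L2 R -> L2 R) (U : R -> L2 R -> L2 R) :
  inner_function Theta ->
  is_inner_multiplier Theta M ->
  let V := M @` Hsupp 0 in
  let W := W_family M U in
  unitary_C0_group_on (ominus (Hsupp 0) V) U ->
  [/\ forall t, 0 <= t -> unitary_on (Hsupp 0) (W (- t)),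
      mult_cocycle W /\ markovian W,
      forall f, Hsupp 0 f -> l2norm (W (- t) f - M f) @[t --> +oo] --> (0 : R),
      forall f, ominus setT (Hsupp 0) f ->
        l2norm (W (- t) f - f) @[t --> +oo] --> (0 : R)
    & unitary_part_is (Hsupp 0) (perturbed_semigroup W)
        (ominus (Hsupp 0) V) U].
Proof.
move=> _ MT V W Ug; have [Miso _] := MT.
have Ms f t : Hsupp 0 f -> 0 <= t -> M (L2shift (- t) f) = L2shift (- t) (M f).
  exact: inner_multiplier_shift MT.
split.
- by move=> t; exact: W_unitary_half_line.
- by split; [exact: W_cocycle|exact: W_markovian].
- by move=> f; exact: W_limit.
- by move=> f; exact: W_limit_orth.
- exact: W_unitary_part.
Qed.
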